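(* Let $G$ be a 1-tough graph on $n$ vertices with minimum degree $\delta$, and let $c$ denote the circumference of $G$ (the length of a longest cycle in $G$). Then either $G$ is hamiltonian or $$ c\ge\begin{cases} 2\delta+2 & \text{when } n\equiv 1 \pmod 3,\\ 2\delta+3 & \text{when } n\equiv 2 \pmod 3 \text{ or } n\equiv 1 \pmod 4,\\ 2\delta+4 & \text{otherwise}. \end{cases} $$
   Context: All graphs are finite, undirected, without loops or multiple edges. For a graph $G$ and $S\subseteq V(G)$, $G\setminus S$ is the subgraph induced by $V(G)\setminus S$, and $s(H)$ denotes the number of components of a graph $H$. A graph $G$ is 1-tough if $|S|\ge s(G\setminus S)$ for every subset $S\subseteq V(G)$ with $s(G\setminus S)>1$. A graph on $n$ vertices is hamiltonian if it contains a cycle of length $n$. The length of a path or cycle is its number of edges. *)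

(* Defs.v *)
From mathcomp Require Import all_boot.

Set Implicit Arguments.
Unset Strict Implicit.
Unset Printing Implicit Defensive.

(* A graph is a symmetric irreflexive relation [e] on a finite type [T] of
   vertices; symmetry and irreflexivity are hypotheses of the theorem. *)
Section Graph.

Variables (T : finType) (e : rel T).

Definition induced (A : {set T}) : rel T :=
  [rel x y | [&& x \in A, y \in A & e x y]].

(* In [induced (~: S)] the vertices of [S] are isolated; restricting [n_comp]
   to [~: S] leaves exactly the components of G \ S. *)
Definition ncomp_minus (S : {set T}) : nat :=
  n_comp (induced (~: S)) (~: S).

Definition one_tough : Prop :=
  forall S : {set T}, 1 < ncomp_minus S -> ncomp_minus S <= #|S|.

Definition degree (x : T) : nat := #|[set y | e x y]|.

(* Degrees are smaller than #|T|, so the neutral value #|T| is only returned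
   when there are no vertices. *)
Definition min_degree : nat := \big[minn/#|T|]_(x : T) degree x.

(* The lower bound on the size is needed: [ucycleb e] also accepts [::] and,
   for an edge xy, [:: x; y]. *)
Definition graph_cycle (p : seq T) : bool := (2 < size p) && ucycleb e p.

(* A cycle has as many edges as vertices, so its length is its size. *)
Definition has_cycle_of_length (k : nat) : bool :=
  [exists p : k.-tuple T, graph_cycle p].

Definition hamiltonian : bool := has_cycle_of_length #|T|.

(* A cycle has at most #|T| vertices; the value is 0 for an acyclic graph. *)
Definition circumference : nat :=
  \max_(k < #|T|.+1 | has_cycle_of_length k) k.

End Graph.

(* Main.v *)
(* Suppose that the longest cycle C has c <= 2d + 3 vertices, where d is the
   minimum degree, and that it misses a vertex. For a component H of G - C let S
   be the set of its neighbours on C. Comparing a longest path through H between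
   two vertices of C with the degrees of its end vertices (by a lemma in the style
   of Erdos and Gallai) shows that any two vertices of S are joined by a path
   through all of H.
   Hence each interval of C between consecutive vertices of S has at least
   q = |H| vertices. Toughness, applied to S, links two of these intervals outside
   H; rerouting C along such a link and through H shows that these two intervals
   have together at least 2q + 2 vertices. Counting gives 2d + 2 <= c,
   |S| + q = d + 1 and (|S| - 2)(q - 1) <= 1.

   If q = 1 and |S| > 2, then the lengths of the intervals are almost determined;
   toughness and further reroutings leave only d = 3, where n = 10 or n = 11. The
   case q = 2, |S| = 3 is impossible for similar reasons. In all other cases every
   component has d - 1 vertices and two neighbours on C. If there are two such
   components, they share a neighbour on C and c = 2d + 3, and there cannot be
   three; so n is 3d + 1 (with c = 2d + 2), 3d + 2 or 4d + 1. *)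

Require Import Defs.
From mathcomp Require Import all_boot zify.
From Stdlib Require Import Classical.

Set Implicit Arguments.
Unset Strict Implicit.
Unset Printing Implicit Defensive.

(** Two estimates are played off against each other. Toughness at the two ends of a path through H
    with k vertices gives 2k + 4 <= c, hence k < d. On the other hand, if a connected set K has all
    its outside neighbours on a path Z, and no excursion into K lengthens Z, then d < |Z|. So a
    longest path through H can leave nothing of H aside. The count rests on the identity k (q + 1) =
    (k - 2)(q - 1) + 2 (k + q - 1) with k = |S|: as c is at least k (q + 1) + 2 and k + q is at
    least d + 1, the slack below 2d + 4 is a single unit. This thin margin shapes the rest: the few
    surviving interval lengths cannot be refuted by counting and need explicit reroutings. Each
    rerouting is written as a list, and its simplicity is checked by comparing multiplicities with
    those of C and a path off C, so that disjointness of the pieces is never tracked. *)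

Ltac arith :=
  repeat match goal with
  | H : is_true (leq _ _) |- _ => revert H
  | H : @eq nat _ _ |- _ => revert H
  end; clear; lia.
(** Compares the multiplicities of a vertex in two concatenations: each test of that vertex against
    a named one is replaced by an arbitrary number, after which the inequality is linear. *)
Ltac cnt := let w := fresh "w" in
  move=> w; do 6 rewrite ?count_cat ?count_rev /=;
  repeat match goal with |- context [nat_of_bool ?b] => move: (nat_of_bool b) => ? end;
  arith.
Ltac szs := do 6 rewrite ?size_cat ?size_rev /=; arith.

(** * Walks and links *)

Section Walks.

Variables (T : finType) (e : rel T).
Implicit Types (s t L : seq T) (K S X : {set T}).

(** The list carries both end vertices, so walks concatenate and reverse as lists; the empty list is
    no walk. *)
Definition walk s (x y : T) : bool :=
  if s is z :: s' then [&& z == x, path e z s' & last z s' == y] else false.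

(* The list [L] holds only the interior vertices and may be empty. *)
Definition link (x : T) L (y : T) : bool := path e x (rcons L y).

Definition joined K (x y : T) : Prop :=
  exists s, [/\ walk s x y, uniq s & {subset s <= K}].

Lemma walk1 x : walk [:: x] x x.
Proof. by rewrite /= !eqxx. Qed.

Lemma walkP s x y :
  walk s x y -> exists s', [/\ s = x :: s', path e x s' & last x s' = y].
Proof. by case: s => //= z s' /and3P[/eqP-> p /eqP l]; exists s'. Qed.

Lemma walkI x s y : path e x s -> last x s = y -> walk (x :: s) x y.
Proof. by move=> p l; rewrite /= eqxx p l eqxx. Qed.

Lemma walkS x z s y : walk s z y -> e x z -> walk (x :: s) x y.
Proof. by move=> /walkP[s' [-> p l]] xz; apply: walkI => //=; rewrite xz. Qed.

Lemma walk_cat s t x y z w :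
  walk s x y -> walk t z w -> e y z -> walk (s ++ t) x w.
Proof.
move=> /walkP[s' [-> p l]] /walkP[t' [-> p' l']] yz.
by apply: walkI; rewrite ?cat_path ?last_cat /= ?l ?p ?yz.
Qed.

Lemma walk_link s L t x y z w :
  walk s x y -> walk t z w -> link y L z -> walk (s ++ L ++ t) x w.
Proof.
move=> /walkP[s' [-> p l]] /walkP[t' [-> p' l']] yz.
apply: walkI; last by rewrite !last_cat.
rewrite cat_path p l /= -cat_rcons cat_path last_rcons p' andbT.
exact: yz.
Qed.

Lemma walkSL y L t z w : walk t z w -> link y L z -> walk (y :: L ++ t) y w.
Proof. by move=> wt l; apply: (walk_link (s := [:: y]) (walk1 y) wt l). Qed.

Lemma walk_mem s x y : walk s x y -> (x \in s) * (y \in s).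
Proof. by move=> /walkP[s' [-> _ <-]]; rewrite mem_last mem_head. Qed.

Lemma walk_head s x y z : walk s x y -> head z s = x.
Proof. by move=> /walkP[s' [-> _ _]]. Qed.

Lemma walk_lastE s x y z : walk s x y -> last z s = y.
Proof. by move=> /walkP[s' [-> _ /= ->]]. Qed.

Lemma walk_size s x y : walk s x y -> 0 < size s.
Proof. by case: s. Qed.

Lemma walk_split s1 v s2 x y : walk (s1 ++ v :: s2) x y ->
  walk (rcons s1 v) x v /\ walk (v :: s2) v y.
Proof.
case: s1 => [|z s1] /= /and3P[/eqP<-].
  by move=> p l; rewrite !eqxx p.
rewrite cat_path last_cat /= => /and3P[p1 p2 p3] l.
by rewrite !eqxx rcons_path last_rcons p1 p2 p3 eqxx l.
Qed.

Lemma linkE x y : link x [::] y = e x y.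
Proof. by rewrite /link /= andbT. Qed.

Lemma link_edge x y : e x y -> link x [::] y.
Proof. by rewrite linkE. Qed.

Lemma link_of_walk x L y : walk (x :: rcons L y) x y = link x L y.
Proof. by rewrite /= last_rcons !eqxx andbT. Qed.

Lemma link_walk x P p p' y : walk P p p' -> e x p -> e p' y -> link x P y.
Proof.
by move=> /walkP[P' [-> w l]] xp py; rewrite /link /= xp rcons_path w l.
Qed.

Lemma link_cons x z L y : link x (z :: L) y = e x z && link z L y.
Proof. by []. Qed.

Lemma link_cat x s z L y :
  link x (s ++ z :: L) y = link x s z && link z L y.
Proof. by rewrite /link rcons_cat cat_path /= (rcons_path _ _ s) andbA. Qed.

(** Reroutings are shown to be simple in this way: bounding multiplicities by those of a
    duplicate-free list replaces all disjointness arguments between the pieces. *)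
Lemma uniq_count s t :
  uniq t -> (forall v, count_mem v s <= count_mem v t) -> uniq s.
Proof.
elim: s => //= x s IHs ut st; rewrite IHs // ?andbT; last first.
  by move=> v; apply: leq_trans (st v); rewrite leq_addl.
apply/negP => xs; have := st x; rewrite /= eqxx (count_uniq_mem _ ut).
have: 0 < count_mem x s by rewrite -has_count has_pred1.
by case: (x \in t) => /=; rewrite -/(count_mem x s); lia.
Qed.

Lemma count_le1 z s : uniq s -> count_mem z s <= 1.
Proof. by move=> us; rewrite count_uniq_mem //; case: (z \in s). Qed.

Lemma count_gt0 z s : (0 < count_mem z s) = (z \in s).
Proof. by rewrite -has_count has_pred1. Qed.

Lemma uniq_cat_out s t : uniq s -> uniq t ->
  (forall z, z \in t -> z \notin s) -> uniq (s ++ t).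
Proof. by move=> us ut ts; rewrite cat_uniq us ut andbT; apply/hasPn. Qed.

Lemma has_first (p : pred T) s : has p s ->
  exists s1 x s2, [/\ s = s1 ++ x :: s2, p x & count p s1 = 0].
Proof.
elim: s => //= y s IH; case py: (p y) => /=; first by exists [::], y, s.
by move=> /IH [s1 [x [s2 [-> px c0]]]]; exists (y :: s1), x, s2; rewrite /= py.
Qed.

Lemma has_last (p : pred T) s : has p s ->
  exists s1 x s2, [/\ s = s1 ++ x :: s2, p x & count p s2 = 0].
Proof.
rewrite -has_rev => /has_first [s1 [x [s2 [E px c0]]]].
exists (rev s2), x, (rev s1); split; rewrite ?count_rev //.
by rewrite -(revK s) E rev_cat rev_cons -cats1 -catA.
Qed.

Lemma card_le_size (A : {set T}) s : {subset A <= s} -> #|A| <= size s.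
Proof.
move=> As; apply: leq_trans (card_size s); apply: subset_leq_card.
by apply/subsetP => v /As.
Qed.

Lemma card_undup_set s : uniq s -> #|[set z in s]| = size s.
Proof. by move=> us; rewrite cardsE; apply/card_uniqP. Qed.

Hypothesis esym : symmetric e.

Lemma walk_rev s x y : walk s x y -> walk (rev s) y x.
Proof.
move=> /walkP[s' [-> p <-]].
case/lastP: s' p => [|s' z] p; first exact: walk1.
rewrite last_rcons -rcons_cons rev_rcons; apply: walkI.
  have := rev_path e x (rcons s' z); rewrite last_rcons belast_rcons => ->.
  by rewrite (eq_path (e' := e)) // => u v; rewrite esym.
by rewrite rev_cons last_rcons.
Qed.

Lemma link_rev x L y : link x L y -> link y (rev L) x.
Proof.
by rewrite -!link_of_walk => /walk_rev; rewrite rev_cons rev_rcons.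
Qed.

Lemma joined_refl K x : x \in K -> joined K x x.
Proof.
by move=> xK; exists [:: x]; split; [exact: walk1 | | move=> v /[!inE] /eqP->].
Qed.

Lemma joinedP K x y : joined K x y <-> x \in K /\ connect (induced e K) x y.
Proof.
split=> [[s [/walkP[s' [-> p l]] _ sK]]|[xK /connectP[p pp ->]]].
  split; first by apply: sK; rewrite mem_head.
  apply/connectP; exists s' => //.
  elim: s' x p sK {l} => //= z s' IH x /andP[xz p] sK.
  rewrite /= {1}/induced /= xz !sK ?inE ?eqxx ?orbT //=.
  by apply: IH p _ => v vs; apply: sK; rewrite inE vs orbT.
case/shortenP: pp => p' pp up _; exists (x :: p'); split=> //.
  apply: walkI => //; elim: p' x pp {xK up} => //= z p' IH x.
  by move=> /andP[/and3P[_ _ ->]] /IH.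
elim: p' x xK pp {up} => [|z p' IH] x xK /=; first by move=> _ v /[!inE] /eqP->.
move=> /andP[/and3P[_ zK _] pp] v; rewrite inE => /orP[/eqP-> //|].
exact: IH.
Qed.

Lemma joined_sym K x y : joined K x y -> joined K y x.
Proof.
move=> [s [w u sK]]; exists (rev s); split; rewrite ?rev_uniq ?walk_rev //.
by move=> v; rewrite mem_rev; apply: sK.
Qed.

Lemma joined_trans K x y z : joined K x y -> joined K y z -> joined K x z.
Proof.
move=> /joinedP[xK xy] /joinedP[yK yz]; apply/joinedP; split=> //.
exact: connect_trans xy yz.
Qed.

Lemma joined_edge K x y : x \in K -> y \in K -> e x y -> joined K x y.
Proof.
move=> xK yK xy; apply/joinedP; split=> //; apply: connect1.
by rewrite /induced /= xK yK.
Qed.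

Lemma joined_sub K K' x y : K \subset K' -> joined K x y -> joined K' x y.
Proof.
move=> /subsetP KK' [s [w u sK]]; exists s; split=> // v /sK.
exact: KK'.
Qed.

Lemma joined_in K x y : joined K x y -> (x \in K) * (y \in K).
Proof. by move=> [s [/walk_mem[xs ys] _ sK]]; rewrite !sK. Qed.

End Walks.

Arguments walk1 {T e}.

(** * Components and a lemma of Erdos and Gallai *)

Section Pieces.

Variables (T : finType) (e : rel T).
Hypothesis esym : symmetric e.
Implicit Types (s t L Q R : seq T) (H K S U W X Y : {set T}).

Definition connected K : Prop := forall x y, x \in K -> y \in K -> joined e K x y.

(* [H] is a connected component of the subgraph induced by [Y]. *)
Definition piece Y H : Prop :=
  [/\ exists h, h \in H, H \subset Y,
      forall h y, h \in H -> y \in Y -> e h y -> y \in H & connected H].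

Lemma joined_exit K H x y : joined e K x y -> x \in H -> y \notin H ->
  exists u v, [/\ u \in H, v \in K, v \notin H & e u v].
Proof.
move=> [s [/walkP[s' [-> p l]] _ sK]] xH; elim: s' x p l sK xH => [|z s' IH] x /=.
  by move=> _ -> _ ->.
move=> /andP[xz p] l sK xH yH; have [zH|zH] := boolP (z \in H).
  by apply: (IH z) => // v vs; apply: sK; rewrite inE vs orbT.
by exists x, z; rewrite xH xz zH sK // !inE eqxx orbT.
Qed.

Lemma piece_exists Y x : x \in Y -> exists H, piece Y H /\ x \in H.
Proof.
move=> xY; pose H := [set y | connect (induced e Y) x y].
have inH y : y \in H -> joined e Y x y by rewrite inE => c; apply/joinedP.
have Hin y : joined e Y x y -> y \in H by rewrite inE => /joinedP[].
have HY : H \subset Y by apply/subsetP => y /inH /joined_in ->.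
have xH : x \in H by rewrite inE.
have xjoin y : y \in H -> joined e H x y.
  move=> /inH [s [w u sY]]; exists s; split=> // v /splitPr vs.
  case: vs w u sY => s1 s2 w u sY; have [w1 _] := walk_split w.
  apply: Hin; exists (rcons s1 v); split=> //.
    by move: u; rewrite -cat_rcons cat_uniq => /andP[].
  by move=> z zs; apply: sY; rewrite -cat_rcons mem_cat zs.
exists H; split=> //; split=> //; first by exists x.
  move=> h y /inH hH yY hy; apply: Hin; apply: (joined_trans hH) => //.
  by apply: joined_edge => //; have [] := joined_in hH.
move=> y z yH zH; apply: (joined_trans _ (xjoin z zH)).
by apply: joined_sym => //; apply: xjoin.
Qed.

Lemma piece_closed Y H h y : piece Y H -> h \in H -> joined e Y h y -> y \in H.
Proof.
move=> [_ _ cl _] hH hy; apply: contraT => yH.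
have [u [v [uH vY vH uv]]] := joined_exit hy hH yH.
by rewrite (cl u v) in vH.
Qed.

Lemma piece_adj K H z : connected K -> z \in K -> piece (K :\ z) H ->
  exists2 h, h \in H & e z h.
Proof.
move=> cK zK [[h hH] /subsetP HK cl _].
have zH : z \notin H by apply/negP => /HK; rewrite !inE eqxx.
have hK : h \in K by move: (HK _ hH); rewrite !inE => /andP[].
have [u [v [uH vK vH uv]]] := joined_exit (cK _ _ hK zK) hH zH.
exists u => //; rewrite esym; have [<- //|vz] := eqVneq v z.
by move: vH; rewrite (cl u v) // !inE vz.
Qed.

(** As [H'] does not touch [z], deleting [z] beforehand made no difference to it. *)
Lemma sub_piece K H H' z z' : piece (K :\ z) H -> piece (H :\ z') H' ->
  (forall h, h \in H' -> ~~ e z h) -> piece (K :\ z') H'.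
Proof.
move=> [_ /subsetP HK cl _] [ne /subsetP HH cl' c'] nz; split=> //.
  apply/subsetP => h /HH; rewrite !inE => /andP[-> /HK].
  by rewrite !inE => /andP[].
move=> h y hH; rewrite !inE => /andP[yz' yK] hy.
have hHH : h \in H by move: (HH _ hH); rewrite !inE => /andP[].
apply: (cl' h) => //; rewrite !inE yz' /=; apply: (cl h) => //.
rewrite !inE yK andbT; apply/eqP => yz.
by move: (nz h hH); rewrite esym -yz hy.
Qed.

(* The Erdos-Gallai lemma in the form "some vertex of a suitable path has all
   its neighbours on the path". *)
Lemma path_capturing_vertex K U W :
  connected K -> U \subset K -> W \subset K ->
  (exists u, u \in U) -> (exists w, w \in W) ->
  (forall z H, z \in K -> piece (K :\ z) H ->
     exists2 h, h \in H & (h \in U) || (h \in W)) ->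
  exists Q u w x, [/\ walk e Q u w, uniq Q, {subset Q <= K}, u \in U & w \in W]
    /\ x \in Q /\ forall y, y \in K -> e x y -> y \in Q.
Proof.
have [n] := ubnP #|K|; elim: n K U W => // n IH K U W leK cK sU sW [u uU] [w wW] cond.
have HltK z H : z \in K -> piece (K :\ z) H -> #|H| < n.
  move=> zK [_ HK _ _]; apply: leq_ltn_trans (subset_leq_card HK) _.
  by move: leK; rewrite (cardsD1 z K) zK; lia.
have HK z H : piece (K :\ z) H -> {subset H <= K}.
  by move=> [_ /subsetP sH _ _] h /sH; rewrite !inE => /andP[].
have Hz z H : piece (K :\ z) H -> z \notin H.
  by move=> [_ /subsetP sH _ _]; apply/negP => /sH; rewrite !inE eqxx.
have back z H x y : piece (K :\ z) H -> x \in H -> y \in K -> e x y -> y != z -> y \in H.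
  by move=> [_ _ cl _] xH yK xy yz; apply: (cl x) => //; rewrite !inE yz.
(* A component [H] that misses [W] meets [U], by the hypothesis on components. The induction runs
   inside [H] from [U] to the neighbours of [z]; the path then passes through [z] and reaches [w]
   outside [H]. *)
have [[z [H [zK pH noW]]]|allW] := classic (exists z H,
    [/\ z \in K, piece (K :\ z) H & forall h, h \in H -> h \notin W]).
  have [h0 h0H h0z] := piece_adj cK zK pH.
  have [|||||||Q [u1 [w1 [x [[wQ uQ QH u1U w1W] [xQ xN]]]]]] :=
    IH H (U :&: H) [set y in H | e z y].
  - exact: HltK pH.
  - by case: pH.
  - exact: subsetIr.
  - by apply/subsetP => y; rewrite inE => /andP[].
  - have [h hH hUW] := cond z H zK pH; exists h.
    by move: hUW; rewrite (negPf (noW _ hH)) orbF inE hH => ->.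
  - by exists h0; rewrite inE h0H.
  - move=> z' H' z'H pH'.
    have H'H : {subset H' <= H}.
      by case: pH' => _ /subsetP sH _ _ h /sH; rewrite !inE => /andP[].
    have [[h hH' zh]|nz] := classic (exists2 h, h \in H' & e z h).
      by exists h; rewrite // !inE H'H // zh orbT.
    have pK : piece (K :\ z') H'.
      by apply: (sub_piece pH pH') => h hH'; apply/negP => zh; apply: nz; exists h.
    have [h hH' hUW] := cond z' H' (HK _ _ pH _ z'H) pK; exists h => //.
    by move: hUW; rewrite !inE (negPf (noW _ (H'H _ hH'))) orbF H'H // => ->.
  have [P [wP uP PK]] : joined e (K :\: H) z w.
    have [->|wz] := eqVneq z w.
      apply: joined_refl; rewrite !inE (subsetP sW) // andbT.
      by apply/negP => /noW; rewrite wW.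
    have wKz : w \in K :\ z by rewrite !inE eq_sym wz (subsetP sW).
    have [H2 [pH2 wH2]] := piece_exists wKz.
    have [h hH2 zh] := piece_adj cK zK pH2.
    have H2H y : y \in H2 -> y \notin H.
      move=> yH2; apply/negP => yH; have := noW w; rewrite wW => /(_ _)/negP; apply=> //.
      apply: (piece_closed pH yH).
      apply: (joined_sub (K := H2)); first by case: pH2.
      by case: pH2 => _ _ _; apply.
    have sH2 : H2 \subset K :\: H.
      by apply/subsetP => y yH2; rewrite !inE H2H //= (HK _ _ pH2).
    apply: (@joined_trans _ _ _ _ h).
      apply: joined_edge => //; last by rewrite (subsetP sH2).
      by rewrite !inE zK (Hz _ _ pH).
    by apply: joined_sub sH2 _; case: pH2 => _ _ _; apply.
  move: u1U w1W; rewrite !inE => /andP[u1U _] /andP[w1H zw1].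
  exists (Q ++ P), u1, w, x; split; [split=> //|].
  - by apply: walk_cat wQ wP _; rewrite esym.
  - rewrite cat_uniq uQ uP andbT /=; apply/hasPn => y /PK.
    by rewrite !inE => /andP[yH _]; apply/negP => /QH yH'; rewrite yH' in yH.
  - by move=> y; rewrite mem_cat => /orP[/QH/(HK _ _ pH)//|/PK]; rewrite !inE => /andP[].
  split; first by rewrite mem_cat xQ.
  move=> y yK xy; rewrite mem_cat; have [yz|yz] := eqVneq y z.
    by rewrite yz (walk_mem wP) orbT.
  by rewrite xN // (back z H x) // QH.
(* From here on every component left by deleting a vertex of [K] meets [W], so [u] may be used up:
   the induction runs in a component of the rest, from the neighbours of [u] to [W]. *)
have uK := subsetP sU _ uU.
have [Ku|[y yKu]] := set_0Vmem (K :\ u).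
  have Kx y : y \in K -> y = u.
    by move=> yK; apply/eqP; apply: contraT => yu; move: (in_set0 y); rewrite -Ku !inE yu yK.
  exists [:: u], u, w, u; rewrite (Kx w) ?(subsetP sW) //; split; [split|] => //.
  - exact: walk1.
  - by move=> y /[!inE] /eqP->.
  - by rewrite -(Kx w) ?(subsetP sW).
  by rewrite inE eqxx; split=> // y /Kx->; rewrite inE eqxx.
have [H [pH yH]] := piece_exists yKu.
have [h0 h0H h0u] := piece_adj cK uK pH.
have [|||||||Q [u1 [w1 [x [[wQ uQ QH u1U w1W] [xQ xN]]]]]] :=
  IH H [set y in H | e u y] (W :&: H).
- exact: HltK pH.
- by case: pH.
- by apply/subsetP => v; rewrite inE => /andP[].
- exact: subsetIr.
- by exists h0; rewrite inE h0H.
- apply: NNPP => nW; apply: allW; exists u, H; split=> // h hH.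
  by apply/negP => hW; apply: nW; exists h; rewrite inE hW.
- move=> z' H' z'H pH'.
  have H'H : {subset H' <= H}.
    by case: pH' => _ /subsetP sH _ _ h /sH; rewrite !inE => /andP[].
  have [[h hH' zh]|nz] := classic (exists2 h, h \in H' & e u h).
    by exists h; rewrite // !inE H'H // zh.
  have pK : piece (K :\ z') H'.
    by apply: (sub_piece pH pH') => h hH'; apply/negP => zh; apply: nz; exists h.
  apply: NNPP => nW; apply: allW; exists z', H'; split=> //; first exact: HK pH _ z'H.
  by move=> h hH'; apply/negP => hW; apply: nW; exists h; rewrite // !inE hW H'H // orbT.
move: u1U w1W; rewrite !inE => /andP[u1H uu1] /andP[w1W _].
exists (u :: Q), u, w1, x; split; [split=> //|].
- exact: walkS wQ uu1.
- by rewrite /= uQ andbT; apply: contra (Hz _ _ pH) => /QH.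
- by move=> v; rewrite inE => /orP[/eqP->//|/QH/(HK _ _ pH)].
split; first by rewrite inE xQ orbT.
move=> v vK xv; rewrite inE; have [->//|vu] := eqVneq v u.
by rewrite xN // (back u H x) // QH.
Qed.

End Pieces.

(** * Longest cycles in 1-tough graphs *)

Section LongestCycle.

Variables (T : finType) (e : rel T) (c d : nat).
Implicit Types (s t L P Q R : seq T) (H K S X Y : {set T}).

(** Toughness in terms of representatives: no components are counted, and a use of it only requires
    a choice of [R]. *)
Definition tough_lists := forall S R, uniq R -> #|S| < size R -> 1 < size R ->
  (forall r, r \in R -> r \notin S) ->
  exists r r', [/\ r \in R, r' \in R, r != r' & joined e (~: S) r r'].

(** Toughness for a single vertex: there is no cut vertex. *)
Lemma joined_minus z r r' : symmetric e -> tough_lists -> r != z -> r' != z ->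
  joined e (~: [set z]) r r'.
Proof.
move=> e_sym tough rz rz'; have [->|rr'] := eqVneq r r'.
  by apply: joined_refl; rewrite !inE.
have [||||r1 [r2 [r1R r2R r12 j]]] := tough [set z] [:: r; r'].
- by rewrite /= inE rr'.
- by rewrite cards1.
- by [].
- by move=> v; rewrite !inE => /orP[]/eqP->.
move: r1R r2R r12 j; rewrite !inE => /orP[]/eqP-> /orP[]/eqP->; rewrite ?eqxx // => _.
exact: joined_sym.
Qed.

(* [c] is the circumference and [d] a lower bound for the degrees. *)
Record tough_ctx : Prop := ToughCtx {
  ctx_sym : symmetric e;
  ctx_irr : irreflexive e;
  ctx_deg : forall v, d <= #|[set y | e v y]|;
  ctx_tough : tough_lists;
  ctx_max : forall s, cycle e s -> uniq s -> 2 < size s -> size s <= c;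
  ctx_gt2 : 2 < c;
  ctx_small : c <= 2 * d + 3 }.

Hypothesis G : tough_ctx.
Let esym := ctx_sym G.

(* [s] lists, in cyclic order, a longest cycle with vertex set [X]. *)
Definition lcycle X s := [/\ cycle e s, uniq s, size s = c & s =i X].

Lemma lcycle_rot X s t : lcycle X (s ++ t) -> lcycle X (t ++ s).
Proof.
move=> [cs us sz sX]; split; first by rewrite -(rot_size_cat s t) rot_cycle.
- by rewrite uniq_catC.
- by rewrite -sz !size_cat addnC.
- by move=> v; rewrite -sX !mem_cat orbC.
Qed.

Lemma lcycle_rev X s : lcycle X s -> lcycle X (rev s).
Proof.
move=> [cs us sz sX]; split; rewrite ?rev_uniq ?size_rev //; last first.
  by move=> v; rewrite mem_rev.
by rewrite rev_cycle (eq_cycle (e' := e)) // => u v; rewrite esym.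
Qed.

Lemma walk_cycle s x y : walk e s x y -> e y x -> cycle e s.
Proof. by move=> /walkP[s' [-> p l]] yx; rewrite /= rcons_path p l. Qed.

Lemma no_longer X s P t x y : lcycle X s -> uniq P ->
  (forall z, z \in P -> z \notin X) -> walk e t x y -> e y x ->
  (forall v, count_mem v t <= count_mem v (s ++ P)) -> size t <= c.
Proof.
move=> [_ us _ sX] uP PX wt yx ct; have [|t2] := leqP (size t) 2.
  by move/leq_ltn_trans/(_ (ctx_gt2 G))/ltnW.
apply: (ctx_max G) t2; first exact: walk_cycle wt yx.
apply: (uniq_count _ ct); rewrite cat_uniq us uP andbT; apply/hasPn => z /PX.
by rewrite /= sX.
Qed.

(** The common end of the reroutings: the new cycle [t] draws its vertices from the old one and from
    a list [P] off it. *)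
Lemma too_long X s P t x y : lcycle X s -> uniq P ->
  (forall z, z \in P -> z \notin X) -> walk e t x y -> e y x ->
  (forall v, count_mem v t <= count_mem v (s ++ P)) -> size s < size t -> False.
Proof.
move=> lc uP PX wt yx ct; have := no_longer lc uP PX wt yx ct.
by case: lc => _ _ -> _; rewrite leqNgt => /negP.
Qed.

Lemma connected_minus z r r' : r != z -> r' != z -> joined e (~: [set z]) r r'.
Proof. exact: joined_minus (ctx_tough G). Qed.

(** [f] colours the vertices of [Y]. On the way from [r] to [r'] the colour of the last visited
    vertex of [Y] changes at some point; the stretch between these two visits is the link. *)
Lemma extract_link (A : eqType) (f : T -> A) S Y r r' :
  joined e (~: S) r r' -> r \in Y -> r' \in Y -> f r != f r' ->
  exists u v L, [/\ u \in Y :\: S, v \in Y :\: S, f u != f v, link e u L v & uniq L]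
    /\ forall z, z \in L -> z \notin Y :|: S.
Proof.
move=> [s [/walkP[p [-> pp l]] up sS]] rY r'Y fr.
(* [u] is the last visited vertex of [Y], [L] the stretch since then and [q] the rest of the
   walk. *)
suff gen q L u : path e u (L ++ q) -> last u (L ++ q) = r' -> uniq (L ++ q) ->
    (forall z, z \in L -> z \notin Y :|: S) -> (forall z, z \in q -> z \notin S) ->
    u \in Y :\: S -> f u != f r' ->
    exists u v L, [/\ u \in Y :\: S, v \in Y :\: S, f u != f v, link e u L v & uniq L]
    /\ forall z, z \in L -> z \notin Y :|: S.
  apply: (gen p [::] r) => //.
  - by move: up => /= /andP[].
  - by move=> z zp; move: (sS z); rewrite !inE zp orbT => ->.
  - by move: (sS r); rewrite !inE eqxx rY => ->.
elim: q L u {r p l pp up sS rY fr} => [|z q IH] L u.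
  rewrite cats0; case/lastP: L => [|L w] _ /=; first by move=> -> _ _ _ _; rewrite eqxx.
  rewrite last_rcons => -> _ /(_ r'); rewrite mem_rcons !inE eqxx r'Y.
  by move=> /(_ isT).
move=> pp l uL LYS qS uYS fu; have zS : z \notin S by rewrite qS ?mem_head.
have qS' y : y \in q -> y \notin S by move=> yq; rewrite qS // inE yq orbT.
have [zY|zY] := boolP (z \in Y).
  have [fuz|fuz] := eqVneq (f u) (f z); last first.
    exists u, z, L; split=> //; split=> //.
    - by rewrite inE zS.
    - by move: pp; rewrite -cat_rcons cat_path => /andP[].
    - by move: uL; rewrite cat_uniq => /andP[].
  apply: (IH [::] z) => //=.
  - by move: pp; rewrite cat_path /= => /and3P[].
  - by rewrite -l last_cat.
  - by move: uL; rewrite cat_uniq /= => /and3P[_ _ /andP[]].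
  - by rewrite inE zS.
  - by rewrite -fuz.
apply: (IH (rcons L z) u) => //; rewrite ?cat_rcons // => y.
rewrite mem_rcons inE => /orP[/eqP->|/LYS //].
by rewrite inE negb_or zY zS.
Qed.

(** An inner vertex in [H] would need a predecessor in [H] or in [S], and the link starts outside
    both. *)
Lemma link_avoid H S u L v :
  (forall h y, h \in H -> e h y -> y \in H \/ y \in S) ->
  u \notin H -> u \notin S -> (forall z, z \in L -> z \notin S) ->
  link e u L v -> forall z, z \in L -> z \notin H.
Proof.
move=> cl; elim: L u => //= z L IH u uH uS LS /andP[uz p].
have zH : z \notin H.
  apply/negP => zH; rewrite esym in uz; case: (cl _ _ zH uz) => h.
    by rewrite h in uH.
  by rewrite h in uS.
have LS' y : y \in L -> y \notin S by move=> yL; rewrite LS // inE yL orbT.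
move=> y; rewrite inE => /orP[/eqP-> //|]; apply: IH p y => //.
by apply: LS; rewrite mem_head.
Qed.

(** Otherwise [P] could replace [I] on the cycle. *)
Lemma gap X a I b J P : lcycle X (a :: I ++ b :: J) -> link e a P b ->
  uniq P -> (forall z, z \in P -> z \notin X) -> size P <= size I.
Proof.
move=> lc lP uP PX; have [cs us sz sX] := lc.
move: cs; rewrite /= rcons_cat cat_path rcons_cons => /andP[_ /=].
rewrite rcons_path => /and3P[_ pJ la].
have wJ : walk e (b :: J) b (last b J) by apply: walkI.
rewrite leqNgt; apply/negP => lt.
by apply: (too_long lc uP PX (walkSL wJ lP) la); [cnt | szs].
Qed.

(** The cycle through [P], back along [P1] and [I2] to [u], over [L] to [v] and on along [J2] and
    [P2] gains [L] and [P] and omits just [I1] and [J1]. *)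
Lemma cross X P2 I1 u I2 P1 J1 v J2 L P p p' p1 p1' p2 p2' :
  lcycle X (P2 ++ (I1 ++ u :: I2) ++ P1 ++ (J1 ++ v :: J2)) ->
  walk e P1 p1 p1' -> walk e P2 p2 p2' -> link e u L v ->
  uniq (L ++ P) -> (forall z, z \in L ++ P -> z \notin X) ->
  walk e P p p' -> e p2' p -> e p' p1' ->
  size L + size P <= size I1 + size J1.
Proof.
move=> lc w1 w2 luv uLP LPX wP ep ep'; have [cs us sz sX] := lc.
have [l1 l2] : link e u I2 p1 /\ link e v J2 p2.
  move: cs; have [P1' [-> _ _]] := walkP w1; have [P2' [-> _ _]] := walkP w2.
  do 9! rewrite ?rcons_cat ?cat_path ?last_cat /=.
  move=> /and5P[_ /and3P[_ _ ?] ? _ /and3P[_ _ ?]].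
  by rewrite /link rcons_path; split=> //; apply/andP.
rewrite leqNgt; apply/negP => lt.
apply: (too_long lc uLP LPX (walk_cat wP (walk_link (walk_rev esym w1)
  (walkSL (walkSL w2 l2) luv) (link_rev esym l1)) ep') ep); [cnt | szs].
Qed.

(** The mirror image of [cross]: the ear joins the first vertices of the arcs, and [I2] and [J2] are
    omitted. *)
Lemma cross' X P2 I1 u I2 P1 J1 v J2 L P p p' p1 p1' p2 p2' :
  lcycle X (P2 ++ (I1 ++ u :: I2) ++ P1 ++ (J1 ++ v :: J2)) ->
  walk e P1 p1 p1' -> walk e P2 p2 p2' -> link e u L v ->
  uniq (L ++ P) -> (forall z, z \in L ++ P -> z \notin X) ->
  walk e P p p' -> e p1 p -> e p' p2 ->
  size L + size P <= size I2 + size J2.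
Proof.
move=> /lcycle_rev lc w1 w2 luv uLP LPX wP ep ep'.
have {}lc : lcycle X (rev P1 ++ (rev I2 ++ u :: rev I1) ++ rev P2 ++ rev J2 ++ v :: rev J1).
  suff : lcycle X ((rev J2 ++ v :: rev J1) ++ rev P1 ++ (rev I2 ++ u :: rev I1) ++ rev P2).
    by move/lcycle_rot; rewrite -!catA.
  by move: lc; rewrite !rev_cat !rev_cons -!cats1 -!catA.
have := cross lc (walk_rev esym w2) (walk_rev esym w1) luv uLP LPX wP ep ep'.
by rewrite !size_rev.
Qed.

Lemma lcycle_at X s a : lcycle X s -> a \in X -> exists s', lcycle X (a :: s').
Proof.
move=> lc; have [_ _ _ <-] := lc => /splitPr as_; case: as_ lc => s1 s2 lc.
by exists (s2 ++ s1); apply: (lcycle_rot (s := s1) (t := a :: s2)).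
Qed.

Lemma lcycle_at2 X s a b : lcycle X s -> a \in X -> b \in X -> a != b ->
  exists I J, lcycle X (a :: I ++ b :: J).
Proof.
move=> lc aX bX ab; have [s' lc'] := lcycle_at lc aX.
have : b \in a :: s' by case: lc' => _ _ _ ->.
rewrite inE eq_sym (negPf ab) /= => /splitPr bs; case: bs lc' => I J lc'.
by exists I, J.
Qed.

(** Toughness for [a] and [b] links two of the three paths [I], [J], [Q] between them. Whichever two
    these are, the resulting cycles bound [|I| + |J|] below by [2 |Q| + 2]. *)
Lemma theta X s a b Q x y : lcycle X s -> a \in X -> b \in X -> a != b ->
  walk e Q x y -> uniq Q -> (forall z, z \in Q -> z \notin X) ->
  e a x -> e y b -> 2 * size Q + 4 <= c.
Proof.
move=> lc0 aX bX ab wQ uQ QX ax yb.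
have [I [J lc]] := lcycle_at2 lc0 aX bX ab.
have half a' b' I' J' Q' x' y' r r' : lcycle X (a' :: I' ++ b' :: J') ->
    walk e Q' x' y' -> Q' =i Q -> uniq Q' -> size Q' = size Q -> e a' x' -> e y' b' ->
    r \in I' -> r' \in J' ++ Q' -> joined e (~: [set a'; b']) r r' ->
    2 * size Q + 2 <= size I' + size J'.
  move=> lc' wQ' Q'Q uQ' sQ' ax' yb' rI rJ jr; have [_ us sz sX] := lc'.
  have Q'X z : z \in Q' -> z \notin X by rewrite Q'Q; apply: QX.
  have IX z : z \in I' -> z \in X by move=> h; rewrite -sX inE mem_cat h !orbT.
  have JX z : z \in J' -> z \in X by move=> h; rewrite -sX !inE mem_cat inE h !orbT.
  have IJ z : z \in I' -> z \in J' = false.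
    rewrite -!count_gt0; have := count_le1 z us; rewrite /= count_cat /=; arith.
  have IQ z : z \in I' -> z \in Q' = false.
    by move=> zI; apply/negP => /Q'X; rewrite IX.
  pose Y := X :|: [set z in Q'].
  have [u0 [v0 [L0 [[uY0 vY0 fuv0 l0 uL0] L0Y]]]] : exists u v L,
      [/\ u \in Y :\: [set a'; b'], v \in Y :\: [set a'; b'],
      (u \in I') != (v \in I'), link e u L v & uniq L]
      /\ forall z, z \in L -> z \notin Y :|: [set a'; b'].
    apply: (extract_link jr); first by rewrite !inE IX.
      by move: rJ; rewrite mem_cat !inE => /orP[/JX->//|->]; rewrite orbT.
    rewrite rI; move: rJ; rewrite mem_cat => /orP[rJ|rQ].
      by case rI': (r' \in I') => //; have := IJ _ rI'; rewrite rJ.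
    by case rI': (r' \in I') => //; have := IQ _ rI'; rewrite rQ.
  have [u [v [L [[uI vI vY luv uL] LY]]]] : exists u v L,
      [/\ u \in I', v \notin I', v \in Y :\: [set a'; b'], link e u L v & uniq L]
      /\ forall z, z \in L -> z \notin Y :|: [set a'; b'].
    case uI: (u0 \in I') fuv0 => fuv.
      by exists u0, v0, L0; split=> //; split=> //; move: fuv; case: (v0 \in I').
    exists v0, u0, (rev L0); split; last by move=> z; rewrite mem_rev; apply: L0Y.
    split; rewrite ?rev_uniq ?uI //; first by move: fuv; case: (v0 \in I').
    exact: link_rev.
  have LX z : z \in L -> z \notin X by move/LY; rewrite !inE !negb_or => /andP[/andP[]].
  have LQ z : z \in L -> z \notin Q'.
    by move/LY; rewrite !inE !negb_or => /andP[/andP[]].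
  have uLQ : uniq (L ++ Q').
    rewrite cat_uniq uL uQ' andbT /=; apply/hasPn => z zQ; apply/negP => /LQ.
    by rewrite zQ.
  have LQX z : z \in L ++ Q' -> z \notin X by rewrite mem_cat => /orP[/LX|/Q'X].
  have sLJ : (v \in J') || (v \in Q').
    move: vY; rewrite !inE -sX !inE mem_cat !inE (negPf vI) negb_or.
    by case/andP=> /andP[/negPf-> /negPf->].
  case/splitPr: uI IX IJ IQ lc' {sz us sX rI} => I1 I2 IX IJ IQ lc'.
  (* For a link to [J'] the two crossings are added. For a link to [Q'] the gap bound is applied to
     [J'] and to both parts of [I'], with detours that use [L] and one part of [Q']. *)
  case/orP: sLJ => [/splitPr vJ|/splitPr vQ].
    case: vJ lc' {JX IJ rJ} => J1 J2 lc'.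
    have h1 := cross (P2 := [:: a']) (P1 := [:: b']) lc' (walk1 _) (walk1 _) luv uLQ LQX wQ' ax' yb'.
    have h2 : size L + size (rev Q') <= size I2 + size J2.
      apply: (cross' (P2 := [:: a']) (P1 := [:: b']) lc' (walk1 _) (walk1 _) luv _ _ (walk_rev esym wQ')).
      - by move: uLQ; rewrite !cat_uniq rev_uniq (eq_has_r (mem_rev Q')).
      - by move=> z; rewrite mem_cat mem_rev -mem_cat; apply: LQX.
      - by rewrite esym.
      - by rewrite esym.
    by move: h1 h2; szs.
  have h1 : size Q <= size J'.
    rewrite -sQ' -(size_rev Q').
    apply: (gap (a := b') (b := a') (X := X) (J := I1 ++ u :: I2)).
    - exact: (lcycle_rot (s := a' :: I1 ++ u :: I2) (t := b' :: J') lc').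
    - by apply: (link_walk (walk_rev esym wQ')); rewrite esym.
    - by rewrite rev_uniq.
    - by move=> z; rewrite mem_rev; apply: Q'X.
  have lQ := link_walk wQ' ax' yb'.
  case: vQ lQ uLQ LQX sQ' {rJ IQ} => Q1 Q2; rewrite link_cat => /andP[lQ1 lQ2] uLQ LQX sQ'.
  have h2 : size (Q1 ++ v :: rev L) <= size I1.
    apply: (gap (b := u) (J := I2 ++ b' :: J') (X := X)) (_ : link e a' _ u) _ _.
    - by move: lc'; rewrite -catA.
    - by rewrite link_cat lQ1 link_rev.
    - apply: (uniq_count uLQ); cnt.
    - move=> z; rewrite mem_cat inE mem_rev => zQ; apply: LQX.
      by rewrite !mem_cat inE; case/or3P: zQ => ->; rewrite ?orbT.
  have h3 : size (L ++ v :: Q2) <= size I2.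
    apply: (gap (a := u) (b := b') (J := J' ++ a' :: I1) (X := X)).
    - move: lc'; rewrite -catA -cat_cons => /lcycle_rot.
      by rewrite -catA.
    - by rewrite link_cat luv.
    - apply: (uniq_count uLQ); cnt.
    - move=> z; rewrite mem_cat inE => zQ; apply: LQX.
      by rewrite !mem_cat inE; case/or3P: zQ => ->; rewrite ?orbT.
  by move: h1 h2 h3; rewrite -sQ'; szs.
have [_ us sz sX] := lc.
have lc' := lcycle_rot (s := a :: I) (t := b :: J) lc.
have wQ' := walk_rev esym wQ.
have q0 := walk_size wQ.
have gI : size Q <= size I by apply: (gap lc) => //; apply: link_walk ax yb.
have gJ : size Q <= size J.
  rewrite -(size_rev Q); apply: (gap lc').
  - by apply: link_walk wQ' _ _; rewrite esym.
  - by rewrite rev_uniq.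
  - by move=> z; rewrite mem_rev; apply: QX.
suff : 2 * size Q + 2 <= size I + size J by move: sz; rewrite /= size_cat /=; arith.
case: I J gI gJ lc lc' us sz sX => [|i I] [|j J] gI gJ lc lc' us sz sX; try by move: q0 gI gJ => /=; arith.
have xX : x \notin X by apply: QX; rewrite (walk_mem wQ).
have iX : i \in X by rewrite -sX !inE eqxx orbT.
have jX : j \in X by rewrite -sX !(inE, mem_cat) eqxx !orbT.
(* Three representatives for two vertices: one on each path between [a] and [b]. *)
have [||||r [r' [rR r'R rr jr]]] := ctx_tough G (S := [set a; b]) (R := [:: i; j; x]).
- rewrite /= !inE negb_or andbT -andbA; apply/and3P; split.
  + move: us; rewrite /= mem_cat !inE => /and3P[_ /norP[_ /norP[_ /norP[]]]].
    by [].
  + by apply/negP => /eqP ix; rewrite -ix iX in xX.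
  + by apply/negP => /eqP jx; rewrite -jx jX in xX.
- by rewrite cards2; case: (a != b).
- by [].
- move=> r; rewrite !inE => /or3P[]/eqP->; apply/norP; split; apply/eqP => E.
  + by have := count_le1 a us; rewrite /= ?count_cat /= E !eqxx; arith.
  + by have := count_le1 b us; rewrite /= ?count_cat /= E !eqxx; arith.
  + by have := count_le1 a us; rewrite /= ?count_cat /= E !eqxx; arith.
  + by have := count_le1 b us; rewrite /= ?count_cat /= E !eqxx; arith.
  + by rewrite E aX in xX.
  + by rewrite E bX in xX.
have Hi r0 : r0 \in [:: j; x] -> joined e (~: [set a; b]) i r0 ->
    2 * size Q + 2 <= size (i :: I) + size (j :: J).
  move=> h; apply: (half a b _ _ Q x y i r0 lc wQ) => //; first exact: mem_head.
  move: h; rewrite mem_cat !inE => /orP[]/eqP->; first by rewrite eqxx.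
  by rewrite (walk_mem wQ) !orbT.
have Hj r0 : r0 = x -> joined e (~: [set a; b]) j r0 ->
    2 * size Q + 2 <= size (i :: I) + size (j :: J).
  move=> -> h; rewrite [_ + size (j :: J)]addnC; rewrite setUC in h.
  apply: (half b a (j :: J) (i :: I) (rev Q) y x j x lc' wQ') => //.
  - by move=> z; rewrite mem_rev.
  - by rewrite rev_uniq.
  - by rewrite size_rev.
  - by rewrite esym.
  - by rewrite esym.
  - exact: mem_head.
  - by rewrite mem_cat mem_rev (walk_mem wQ) orbT.
have jr' := joined_sym esym jr.
move: rR r'R rr jr jr'; rewrite !inE => /or3P[]/eqP-> /or3P[]/eqP->; rewrite ?eqxx // => _ j1 j2.
- by apply: Hi j1; rewrite !inE eqxx.
- by apply: Hi j1; rewrite !inE eqxx orbT.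
- by apply: Hi j2; rewrite !inE eqxx.
- exact: Hj j1.
- by apply: Hi j2; rewrite !inE eqxx orbT.
- exact: Hj j2.
Qed.

End LongestCycle.

(** * Paths through a component *)

Section Attached.

Variables (T : finType) (e : rel T) (c d : nat).
Implicit Types (s t L P Q R Z : seq T) (H K S X Y : {set T}).
Hypothesis G : tough_ctx e c d.
Let esym := ctx_sym G.
Local Notation lcycle := (lcycle e c).

(* Replacing parts of the path [Z] by excursions into [K] cannot lengthen it;
   a vertex of [K] given by [path_capturing_vertex] then has few neighbours
   outside [Z]. *)
Lemma detour_bound K Z z0 :
  connected e K -> (forall k v, k \in K -> e k v -> v \in K \/ v \in Z) ->
  uniq Z -> 1 < size Z -> (forall z, z \in Z -> z \notin K) ->
  z0 \in Z -> (exists2 h, h \in K & e z0 h) ->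
  (forall Z1 a Zm b Z2 R, Z = Z1 ++ a :: Zm ++ b :: Z2 -> link e a R b ->
     uniq R -> {subset R <= K} -> size R <= size Zm) ->
  d < size Z.
Proof.
move=> cK NK uZ sZ ZK z0Z [h0 h0K zh0] maxZ.
have [z1 z1Z z10] : exists2 z1, z1 \in Z & z1 != z0.
  case: Z uZ sZ {ZK NK maxZ z0Z} => [|y [|y' Z]] //= /andP[]; rewrite inE negb_or.
  case/andP=> yy' _ _ _; have [yz|yz] := eqVneq y z0.
    by exists y'; rewrite ?inE ?eqxx ?orbT // -yz eq_sym.
  by exists y; rewrite ?inE ?eqxx.
pose U := [set h in K | e z0 h].
pose W := [set h in K | has (fun z => (z != z0) && e z h) Z].
have [|||||Q [u [w [v [[wQ uQ QK uU wW] [vQ vN]]]]]] :=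
    path_capturing_vertex esym (U := U) (W := W) cK.
- by apply/subsetP => h; rewrite inE => /andP[].
- by apply/subsetP => h; rewrite inE => /andP[].
- by exists h0; rewrite inE h0K.
- have h0z : h0 != z0 by apply: contraTneq z0Z => <-; apply: contraL h0K; apply: ZK.
  have [u [v [uK]]] := joined_exit (connected_minus G h0z z10) h0K (ZK _ z1Z).
  rewrite !inE => vz vK uv; case: (NK _ _ uK uv) => [h|vZ]; first by rewrite h in vK.
  by exists u; rewrite inE uK; apply/hasP; exists v => //; rewrite vz esym.
(* [z] is no cut vertex, so an edge leaves the component for a vertex other than [z], and that
   vertex can only lie on [Z]. *)
- move=> z H zK pH; have [[h hH] /subsetP HK cl _] := pH.
  have zH : z \notin H by apply/negP => /HK; rewrite !inE eqxx.
  have z0z : z0 != z by apply: contraTneq zK => <-; apply: ZK.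
  have hz : h != z by apply: contraTneq hH => ->.
  have z0H : z0 \notin H.
    by apply/negP => /HK; rewrite !inE (negPf (ZK _ z0Z)) andbF.
  have [u [v [uH]]] := joined_exit (connected_minus G hz z0z) hH z0H.
  have uK : u \in K by move: (HK _ uH); rewrite !inE => /andP[].
  rewrite !inE => vz vH uv; case: (NK _ _ uK uv) => [vK|vZ].
    by rewrite (cl u) // !inE vz in vH.
  exists u; rewrite // !inE uK /=; have [<-|vz0] := eqVneq v z0; first by rewrite esym uv.
  by apply/orP; right; apply/hasP; exists v; rewrite // vz0 esym.
move: uU wW; rewrite !inE => /andP[_ z0u] /andP[_ /hasP[z2 z2Z /andP[z20 z2w]]].
(* The captured path is oriented along [Z]: [a] precedes [b], and [R] competes with the stretch [Zm]
   between them. *)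
have {z0 z0Z h0 h0K zh0 z1 z1Z z10 U W z0u z2 z2Z z20 z2w wQ uQ QK vQ vN u w v Q}
  [Z1 [a [Zm [b [Z2 [R [v [ZE lR uR RK [vR vN]]]]]]]]] :
    exists Z1 a Zm b Z2 R v, [/\ Z = Z1 ++ a :: Zm ++ b :: Z2, link e a R b,
      uniq R, {subset R <= K} & v \in R /\ forall y, y \in K -> e v y -> y \in R].
  have lQ : link e z0 Q z2 by apply: (link_walk wQ) => //; rewrite esym.
  move: z2Z; case/splitPr: z0Z => Z1 Z2; rewrite mem_cat inE (negPf z20) /=.
  case/orP=> [/splitPr|/splitPr] [Za Zb].
    exists Za, z2, Zb, z0, Z2, (rev Q), v; split=> //.
    - by rewrite -catA.
    - exact: link_rev.
    - by rewrite rev_uniq.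
    - by move=> y; rewrite mem_rev; apply: QK.
    - by rewrite mem_rev vQ; split=> // y yK vy; rewrite mem_rev vN.
  by exists Z1, z0, Za, z2, Zb, Q, v.
have sR := maxZ _ _ _ _ _ _ ZE lR uR RK.
have vK := RK v vR.
case/splitPr: vR lR uR RK sR vN => R1 R2; rewrite link_cat => /andP[l1 l2] uR RK sR vN.
have dle : d <= size (R1 ++ R2) + count (e v) Z.
  apply: leq_trans (ctx_deg G v) _.
  rewrite -size_filter -size_cat; apply: card_le_size => y.
  rewrite inE => vy; rewrite mem_cat mem_filter vy.
  case: (NK _ _ vK vy) => [/vN/(_ vy)|->]; last by rewrite orbT.
  rewrite !mem_cat inE => /or3P[->//|/eqP yv|->]; rewrite ?orbT //.
  by move: vy; rewrite yv (ctx_irr G).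
(* Let [f] and [g] be the first and last neighbour of [v] on [Zm]. The detours from [a] over [R1]
   and [v] to [f], and from [g] over [v] and [R2] to [b], show that the stretches before [f] and
   behind [g], free of neighbours of [v], have together more than [|R|] vertices. *)
have mid : count (e v) Zm + size (R1 ++ v :: R2) <= size Zm.
  have [hm|] := boolP (has (e v) Zm); last by rewrite has_count -eqn0Ngt => /eqP->.
  have [M1 [f [M' [ME vf c1]]]] := has_first hm.
  have hm' : has (e v) (f :: M') by rewrite /= vf.
  have [M2 [g [M3 [M'E vg c3]]]] := has_last hm'.
  have s1 : size (rcons R1 v) <= size M1.
    apply: (maxZ Z1 a M1 f (M' ++ b :: Z2)).
    - by rewrite ZE ME -catA.
    - by rewrite -cats1 link_cat l1 linkE.
    - by move: uR; rewrite -cat_rcons cat_uniq => /andP[].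
    - by move=> y; rewrite mem_rcons => yR; apply: RK; move: yR; rewrite !inE mem_cat inE => /orP[]->; rewrite ?orbT.
  have s2 : size (v :: R2) <= size M3.
    apply: (maxZ (Z1 ++ a :: M1 ++ M2) g M3 b Z2).
    - by rewrite ZE ME M'E -!catA /= -!catA.
    - by rewrite link_cons l2 esym vg.
    - by move: uR; rewrite cat_uniq => /and3P[].
    - by move=> y yR; apply: RK; rewrite mem_cat yR orbT.
  move: s1 s2 c1 c3; rewrite ME M'E size_rcons /= !count_cat /= vg.
  by have := count_size (e v) M2; szs.
move: dle mid (count_size (e v) Z1) (count_size (e v) Z2).
rewrite ZE !count_cat /= !count_cat /=.
case: (e v a); case: (e v b); szs.
Qed.

Section Component.

Variables (X H : {set T}) (s0 : seq T).
Hypotheses (lc0 : lcycle X s0) (pH : piece e (~: X) H).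

Definition ear a Q b : Prop :=
  [/\ a \in X, b \in X, a != b, link e a Q b &
    [/\ uniq Q, {subset Q <= H} & 0 < size Q]].

Lemma comp_out h : h \in H -> h \notin X.
Proof. by case: pH => _ /subsetP sH _ _ /sH; rewrite inE. Qed.

Lemma comp_cl h v : h \in H -> e h v -> v \in H \/ v \in X.
Proof.
case: pH => _ _ cl _ hH hv; case: (boolP (v \in X)) => vX; first by right.
by left; apply: cl hH _ hv; rewrite inE.
Qed.

Lemma comp_conn : connected e H.
Proof. by case: pH. Qed.

Lemma ear_rev a Q b : ear a Q b -> ear b (rev Q) a.
Proof.
case=> aX bX ab l [u QH q0]; split; rewrite 1?eq_sym //; first exact: link_rev.
by split; rewrite ?rev_uniq ?size_rev // => y; rewrite mem_rev; apply: QH.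
Qed.

(** [theta] gives [2 |Q| + 4 <= c], and [c <= 2 d + 3]. This is the bound that conclusions of
    [detour_bound] contradict. *)
Lemma ear_le a Q b : ear a Q b -> size Q < d.
Proof.
case=> aX bX ab l [u QH q0].
have cs := ctx_small G; case: Q l u QH q0 => [//|x Q] l u QH _.
suff : 2 * size (x :: Q) + 4 <= c by arith.
have [y [wQ yb]] : exists y, walk e (x :: Q) x y /\ e y b.
  move: l; rewrite /link /= rcons_path => /and3P[ax p l].
  by exists (last x Q); split=> //; apply: walkI.
apply: (theta G lc0 aX bX ab wQ u) => //.
  by move=> z /QH /comp_out.
by move: l => /= /andP[].
Qed.

Lemma ear_cons a b k P x y : b \in X -> a \in X -> a != b -> e a k ->
  walk e P k x -> uniq P -> {subset P <= H} -> e y b -> forall Q x', walk e Q x' y ->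
  e x x' -> uniq (P ++ Q) -> {subset Q <= H} -> ear a (P ++ Q) b.
Proof.
move=> bX aX ab ak wP uP PH yb Q x' wQ xx' uKQ QH; split=> //.
  by apply: link_walk (walk_cat wP wQ xx') ak yb.
split=> [//|z|]; first by rewrite mem_cat => /orP[/PH|/QH].
by have := walk_size wP; szs.
Qed.

(** A single attachment vertex would be a cut vertex; two of them are joined through the connected
    set [H]. *)
Lemma ear_exists : exists a Q b, ear a Q b.
Proof.
have [h hH] : exists h, h \in H by case: pH.
have [_ us sz sX] := lc0.
have : 2 < size s0 by rewrite sz; apply: ctx_gt2 G.
case E: s0 us sX => [|x0 [|x1 [|x2 s]]] //= us sX _.
have [x0X x1X] : x0 \in X /\ x1 \in X by rewrite -!sX !inE !eqxx orbT.
have x01 : x0 != x1 by case/andP: us; rewrite inE negb_or => /andP[].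
have nb z z' : z \in X -> z' \in X -> z' != z -> exists u v,
    [/\ u \in H, v \in X, v != z & e u v].
  move=> zX z'X zz'; have hz : h != z by apply: contraTneq zX => <-; apply: comp_out.
  have z'H : z' \notin H by apply: contraL z'X; apply: comp_out.
  have [u [v [uH]]] := joined_exit (connected_minus G hz zz') hH z'H.
  rewrite !inE => vz vH uv; exists u, v; split=> //.
  by case: (comp_cl uH uv) => // vH'; rewrite vH' in vH.
have [u [a [uH aX _ ua]]] := nb _ _ x1X x0X x01.
have [z' [z'X z'a]] : exists z', z' \in X /\ z' != a.
  have [<-|x0a] := eqVneq x0 a; last by exists x0.
  by exists x1; rewrite eq_sym.
have [v [b [vH bX ba vb]]] := nb _ _ aX z'X z'a.
have [Q [wQ uQ QH]] := comp_conn uH vH.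
exists a, Q, b; split=> //; first by rewrite eq_sym.
  by apply: (link_walk wQ) => //; rewrite esym.
by split=> //; apply: walk_size wQ.
Qed.

Lemma longest_ear : exists a Q b, ear a Q b /\
  forall a' Q' b', ear a' Q' b' -> size Q' <= size Q.
Proof.
have [a [Q [b E]]] := ear_exists.
have [n] := ubnP (d - size Q); elim: n a Q b E => // n IH a Q b E le.
have [[a' [Q' [b' [E' lt]]]]|no] :=
    classic (exists a' Q' b', ear a' Q' b' /\ size Q < size Q').
  by apply: (IH _ _ _ E'); have := ear_le E'; arith.
exists a, Q, b; split=> // a' Q' b' E'; rewrite leqNgt; apply/negP => lt.
by apply: no; exists a', Q', b'.
Qed.

(** Let [K] be the component of [H] minus [Q] that contains [h]. Maximality leaves [K] no neighbours
    except on [Q] and at [b], and no detour through [K] lengthens this path, so [detour_bound] gives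
    [d <= |Q|], against [ear_le]. *)
Lemma ear_end a Q b x y : ear a Q b ->
  (forall a' Q' b', ear a' Q' b' -> size Q' <= size Q) ->
  walk e Q x y -> forall h, h \in H -> e x h -> h \in Q.
Proof.
move=> E maxQ wQ h hH xh; apply: contraT => hQ.
have [aX bX ab l [uQ QH q0]] := E.
have [xQ yQ] := walk_mem wQ.
have yb : e y b.
  move: l; have [Q' [-> _ <-]] := walkP wQ.
  by rewrite /link rcons_path => /andP[_].
have hHQ : h \in H :\: [set z in Q] by rewrite !inE hQ.
have [K [pK hK]] := piece_exists esym hHQ.
have [_ /subsetP KH clK cK] := pK.
have KH' k : k \in K -> k \in H by move/KH; rewrite !inE => /andP[].
have KQ k : k \in K -> k \notin Q by move/KH; rewrite !inE => /andP[].
suff : d < size (rcons Q b) by have := ear_le E; rewrite size_rcons; arith.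
have uZ : uniq (rcons Q b).
  by rewrite rcons_uniq uQ andbT; apply: contraL bX => /QH /comp_out.
apply: (detour_bound (K := K) (z0 := x)) => //.
- move=> k v kK kv; rewrite mem_rcons inE.
  case: (comp_cl (KH' k kK) kv) => [vH|vX].
    have [vQ|vQ] := boolP (v \in Q); first by rewrite orbT; right.
    by left; apply: clK kv => //; rewrite !inE vQ.
  have [->|vb] := eqVneq v b; first by right.
  (* From a cycle vertex [v] other than [b] next to [K] a longer ear would start: through [K] to [x]
     and then along [Q]. *)
  have [P [wP uP PK]] := cK _ _ kK hK.
  have : size (P ++ Q) <= size Q.
    apply: (maxQ v _ b); apply: (ear_cons bX vX vb _ wP uP _ yb wQ) => //.
    - by rewrite esym.
    - by move=> z /PK /KH'.
    - by rewrite esym.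
    - apply: uniq_cat_out => // z zQ; apply: contraL zQ => /PK; exact: KQ.
  by have := walk_size wP; szs.
- by rewrite size_rcons; have := walk_size wQ; arith.
- move=> z; rewrite mem_rcons inE => /orP[/eqP->|zQ].
    by apply: contraL bX => /KH' /comp_out.
  by apply: contraL zQ => /KQ.
- by rewrite mem_rcons inE xQ orbT.
- by exists h.
move=> Z1 z1 Zm z2 Z2 R ZE lR uR RK; rewrite leqNgt; apply/negP => lt.
have pZ : path e a (rcons Q b) by [].
pose Z' := Z1 ++ z1 :: R ++ z2 :: Z2.
have uZ' : uniq Z'.
  apply: (uniq_count (t := rcons Q b ++ R)); last by rewrite ZE /Z'; cnt.
  apply: uniq_cat_out => // z /RK zK; rewrite mem_rcons inE negb_or KQ // andbT.
  by apply: contraTneq bX => <-; apply: comp_out; apply: KH'.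
have pZ' : path e a Z'.
  move: pZ lR; rewrite ZE /Z' !cat_path /= !cat_path /link rcons_path /=.
  by case/and3P=> -> -> /and3P[_ _ ->] /andP[-> ->].
have lZ' : last a Z' = b.
  have : last a (rcons Q b) = b by rewrite last_rcons.
  by rewrite ZE /Z' !last_cat /= !last_cat.
have sZ' : size (rcons Q b) < size Z' by rewrite ZE /Z'; szs.
have subZ z : z \in Z' -> z \in H \/ z = b.
  rewrite mem_cat inE mem_cat => zZ.
  have [zR|zR] := boolP (z \in R); first by left; apply/KH'/RK.
  have : z \in rcons Q b.
    by move: zZ; rewrite ZE !(mem_cat, inE) (negPf zR) /= => /or4P[]->; rewrite ?orbT.
  by rewrite mem_rcons inE => /orP[/eqP->|/QH]; [right | left].
case/lastP: Z' uZ' pZ' lZ' sZ' subZ => [|Q' b'] // uZ' pZ'; rewrite last_rcons => bb.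
rewrite {b'}bb in uZ' pZ' * => sZ' subZ.
have /maxQ : ear a Q' b.
  move: uZ'; rewrite rcons_uniq => /andP[bQ' uQ']; split=> //; split=> // [z zQ|]; last first.
    by move: sZ'; rewrite !size_rcons; arith.
  case: (subZ z) => //; first by rewrite mem_rcons inE zQ orbT.
  by move=> zb; rewrite -zb zQ in bQ'.
by move: sZ'; rewrite !size_rcons; arith.
Qed.

End Component.
End Attached.

(** * The attachment set of a component *)

Section Counting.

Variables (T : finType) (e : rel T) (c d : nat).
Implicit Types (s t L P Q R Z I J : seq T) (A B H K S X Y : {set T}).
Hypothesis G : tough_ctx e c d.
Local Notation lcycle := (lcycle e c).

Lemma lcycle_neq X a I b J : lcycle X (a :: I ++ b :: J) -> a != b.
Proof.
case=> _ us _ _; apply/eqP => E; have := count_le1 a us.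
by rewrite /= count_cat /= E eqxx; arith.
Qed.

Lemma count_lcycle X S s : lcycle X s -> S \subset X -> count (mem S) s = #|S|.
Proof.
case=> _ us _ sX /subsetP SX; rewrite -size_filter.
have /card_uniqP <- := filter_uniq (mem S) us.
apply: eq_card => v; rewrite mem_filter sX inE.
by case vS: (v \in S) => //=; rewrite SX.
Qed.

(** Quantifying over all longest cycles on [X] keeps the bound available after rotations. *)
Definition gapped X S g := forall a I b J, a \in S -> b \in S ->
  lcycle X (a :: I ++ b :: J) -> g <= size I.

Lemma gapped_arc X S g a I b J : gapped X S g -> a \in S -> b \in S ->
  lcycle X (a :: I ++ b :: J) -> g + count (mem S) I * g.+1 <= size I.
Proof.
move=> gS; have [n] := ubnP (size I); elim: n a I b J => // n IH a I b J le aS bS lc.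
have [hI|] := boolP (has (mem S) I); last first.
  by rewrite has_count -eqn0Ngt => /eqP->; have := gS _ _ _ _ aS bS lc; arith.
have [I1 [z [I2 [IE zS c1]]]] := has_first hI.
rewrite IE in le lc *; rewrite -catA cat_cons in lc.
have g1 := gS _ _ _ _ aS zS lc.
have lc' : lcycle X (z :: I2 ++ b :: J ++ a :: I1).
  by have := lcycle_rot (s := a :: I1) lc; rewrite /= -catA.
have := IH z I2 b _ _ zS bS lc'.
have zT : (z \in S) = true by exact: zS.
move: le c1 g1; rewrite size_cat count_cat /= zT => le -> g1 h.
have {}h := h ltac:(arith); move: h g1; rewrite mulSn; arith.
Qed.

Lemma gapped_count X S g s : lcycle X s -> S \subset X -> 1 < #|S| ->
  gapped X S g -> #|S| * g.+1 <= c.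
Proof.
move=> lc SX /card_gt1P [a [b [aS bS ab]]] gS.
have [I [J lc']] := lcycle_at2 lc (subsetP SX _ aS) (subsetP SX _ bS) ab.
have h1 := gapped_arc gS aS bS lc'.
have h2 := gapped_arc gS bS aS (lcycle_rot (s := a :: I) (t := b :: J) lc').
rewrite -(count_lcycle lc' SX); have [_ _ <- _] := lc'.
have [aT bT] : (a \in S) = true /\ (b \in S) = true by split.
rewrite /= count_cat /= size_cat /= aT bT; move: h1 h2 => /=; set m := count _ I; set m' := count _ J.
rewrite (_ : (1 + (m + (1 + m'))) * g.+1 = g.+1 + m * g.+1 + (g.+1 + m' * g.+1)).
  by move: (m * _) (m' * _); arith.
by rewrite !mulnDl !mul1n addnA.
Qed.

(** Between [a] and [b] the vertices of [A :|: B] pass at some point from one in [A] to a next one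
    in [B]; the interval there has [q] vertices, every other one at least one. *)
Lemma mixed_arc X A B q a I b J : 0 < q -> gapped X (A :|: B) 1 ->
  (forall a I b J, a \in A -> b \in B -> lcycle X (a :: I ++ b :: J) -> q <= size I) ->
  a \in A -> b \in B -> lcycle X (a :: I ++ b :: J) ->
  q + 2 * count (mem (A :|: B)) I <= size I.
Proof.
move=> q0 g1 gq aA; have [n] := ubnP (size I); elim: n a I b J aA => // n IH a I b J aA le bB lc.
have aS : a \in A :|: B by rewrite inE aA.
have bS : b \in A :|: B by rewrite inE bB orbT.
have [hI|] := boolP (has (mem (A :|: B)) I); last first.
  by rewrite has_count -eqn0Ngt => /eqP->; have := gq _ _ _ _ aA bB lc; arith.
have [I1 [z [I2 [IE zS c1]]]] := has_first hI.
have zT : (z \in A :|: B) = true by exact: zS.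
rewrite IE in le lc *; rewrite -catA cat_cons in lc.
have lc' : lcycle X (z :: I2 ++ b :: J ++ a :: I1).
  by have := lcycle_rot (s := a :: I1) lc; rewrite /= -catA.
have h1 := g1 _ _ _ _ aS zS lc; have h2 := gapped_arc g1 zS bS lc'.
move: (zS); rewrite /= inE => /orP[zA|zB]; last first.
  have := gq _ _ _ _ aA zB lc; move: c1 h2; rewrite size_cat count_cat /= zT.
  by move=> ->; arith.
have h3 := IH _ _ _ _ zA _ bB lc'.
move: le c1 h1 h3; rewrite size_cat count_cat /= zT => le -> h1 h3.
by have {}h3 := h3 ltac:(arith); move: h3 h1; arith.
Qed.

(** Each of the two arcs between [a] and [b] contains one interval of [q] vertices. *)
Lemma mixed_count X A B q s a b : lcycle X s -> A :|: B \subset X ->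
  0 < q -> gapped X (A :|: B) 1 ->
  (forall a I b J, a \in A -> b \in B -> lcycle X (a :: I ++ b :: J) -> q <= size I) ->
  (forall a I b J, a \in B -> b \in A -> lcycle X (a :: I ++ b :: J) -> q <= size I) ->
  a \in A -> b \in B -> a != b -> 2 * #|A :|: B| + 2 * q <= c + 2.
Proof.
move=> lc SX q0 g1 gAB gBA aA bB ab.
have aS : a \in A :|: B by rewrite inE aA.
have bS : b \in A :|: B by rewrite inE bB orbT.
have [I [J lc']] := lcycle_at2 lc (subsetP SX _ aS) (subsetP SX _ bS) ab.
have h1 := mixed_arc q0 g1 gAB aA bB lc'.
have := @mixed_arc X B A q b J a I q0; rewrite setUC => /(_ g1 gBA bB aA).
move=> /(_ (lcycle_rot (s := a :: I) (t := b :: J) lc')) h2.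
rewrite -(count_lcycle lc' SX); have [_ _ <- _] := lc'.
have [aT bT] : (a \in A :|: B) = true /\ (b \in A :|: B) = true by split.
by rewrite /= count_cat /= size_cat /= aT bT; move: h1 h2; arith.
Qed.

End Counting.

(** * Longest ears and the attachment set *)

Section Classification.

Variables (T : finType) (e : rel T) (c d : nat).
Implicit Types (s t L P Q R I J : seq T) (A B K S W Y Z : {set T}).
Hypothesis G : tough_ctx e c d.
Let esym := ctx_sym G.
Local Notation lcycle := (lcycle e c).
Variables (X H : {set T}) (s0 : seq T).
Hypotheses (lc0 : lcycle X s0) (pH : piece e (~: X) H).
Local Notation ear := (ear e X H).

(* As [#|H| = q], the ears joining the vertices of [S] span [H]. *)
Record ear_set S q : Prop := EarSet {
  es_sub : S \subset X;
  es_nb : forall h v, h \in H -> v \in X -> e h v -> v \in S;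
  es_card : #|H| = q;
  es_le : d + 1 <= #|S| + q;
  es_two : 1 < #|S|;
  es_pos : 0 < q;
  es_ear : forall a b, a \in S -> b \in S -> a != b ->
    exists P, ear a P b /\ size P = q }.

Lemma ear_gap a P b I J : ear a P b -> lcycle X (a :: I ++ b :: J) -> size P <= size I.
Proof.
case=> aX bX ab l [uP PH _] lc; apply: (gap G lc l uP) => z /PH.
exact: comp_out pH _.
Qed.

Lemma ears_gapped S q : (forall a b, a \in S -> b \in S -> a != b ->
    exists P, ear a P b /\ size P = q) -> gapped e c X S q.
Proof.
move=> eS a I b J aS bS lc.
have [P [E <-]] := eS _ _ aS bS (lcycle_neq lc); exact: ear_gap E lc.
Qed.

Section Longest.

Variables (a0 b0 x y : T) (Q : seq T).
Hypotheses (E0 : ear a0 Q b0) (wQ : walk e Q x y).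
Hypothesis maxQ : forall a P b, ear a P b -> size P <= size Q.
Let q := size Q.
Let A := [set v in X | e x v].
Let B := [set v in X | e y v].
Let S := A :|: B.

Let uQ : uniq Q. Proof. by case: E0 => _ _ _ _ []. Qed.
Let QH : {subset Q <= H}. Proof. by case: E0 => _ _ _ _ []. Qed.
Let q_gt0 : 0 < q. Proof. by case: E0 => _ _ _ _ []. Qed.
Let q_lt : q < d. Proof. exact: (ear_le G lc0 pH E0). Qed.
Let wQr := walk_rev esym wQ.

Let nbx h : h \in H -> e x h -> h \in Q.
Proof. exact: (ear_end G lc0 pH E0 maxQ wQ). Qed.

Let nby h : h \in H -> e y h -> h \in Q.
Proof.
rewrite -mem_rev; apply: (ear_end G lc0 pH (ear_rev G E0) _ wQr) => a P b.
by rewrite size_rev; apply: maxQ.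
Qed.

(** [z] lies on [Q] but is not its own neighbour, hence the strict inequality. *)
Let card_end z : z \in Q -> (forall h, h \in H -> e z h -> h \in Q) ->
  d < #|[set v in X | e z v]| + q.
Proof.
move=> zQ nz; apply: (@leq_ltn_trans #|[set v in X | e z v] :|: ([set v in Q] :\ z)|).
  apply: leq_trans (ctx_deg G z) _; apply: subset_leq_card; apply/subsetP => v.
  rewrite !inE => zv; rewrite zv andbT.
  case: (comp_cl pH (QH zQ) zv) => [vH|->//].
  rewrite nz // andbT; have [vz|_] := eqVneq v z; last by rewrite orbT.
  by move: zv; rewrite vz (ctx_irr G).
have := cardsD1 z [set v in Q]; rewrite card_undup_set // inE zQ => qE.
apply: leq_ltn_trans (leq_of_leqif (leq_card_setU _ _)) _.
by rewrite /q; move: qE; rewrite /=; arith.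
Qed.

Let xQ : x \in Q. Proof. by rewrite (walk_mem wQ). Qed.
Let yQ : y \in Q. Proof. by rewrite (walk_mem wQ). Qed.
Let cardA : d < #|A| + q. Proof. exact: card_end xQ nbx. Qed.
Let cardB : d < #|B| + q. Proof. exact: card_end yQ nby. Qed.
Let SX : S \subset X.
Proof. by apply/subsetP => v; rewrite !inE => /orP[]/andP[]. Qed.

Let earAB a b : a \in A -> b \in B -> a != b -> ear a Q b.
Proof.
rewrite !inE => /andP[aX xa] /andP[bX yb] ab; split=> //.
by apply: (link_walk wQ) => //; rewrite esym.
Qed.

Let earBA a b : a \in B -> b \in A -> a != b -> ear a (rev Q) b.
Proof. by move=> aB bA ab; apply: (ear_rev G); apply: earAB; rewrite // eq_sym. Qed.

Let ear1 z a b : z \in H -> a \in X -> b \in X -> e z a -> e z b -> a != b ->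
  ear a [:: z] b.
Proof.
move=> zH aX bX za zb ab; split=> //; first by rewrite /link /= esym za zb.
by split=> // v; rewrite inE => /eqP->.
Qed.

Let gS1 : gapped e c X S 1.
Proof.
move=> a I b J aS bS lc; have ab := lcycle_neq lc.
have xH := QH xQ; have yH := QH yQ.
move: aS bS; rewrite !in_setU => /orP[aA|aB] /orP[bA|bB].
- move: aA bA; rewrite !inE => /andP[aX xa] /andP[bX xb].
  exact: ear_gap (ear1 xH aX bX xa xb ab) lc.
- by apply: leq_trans q_gt0 _; apply: ear_gap (earAB aA bB ab) lc.
- apply: leq_trans q_gt0 _; rewrite /q -size_rev; exact: ear_gap (earBA aB bA ab) lc.
- move: aB bB; rewrite !inE => /andP[aX xa] /andP[bX xb].
  exact: ear_gap (ear1 yH aX bX xa xb ab) lc.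
Qed.

Let two_reps : exists a b, [/\ a \in A, b \in B & a != b].
Proof.
have /card_gt0P [a aA] : 0 < #|A| by move: cardA q_lt; arith.
have : 1 < #|B| by move: cardB q_lt; arith.
move=> /card_gt1P [b [b' [bB b'B bb']]].
have [ab|ab] := eqVneq a b; last by exists a, b.
by exists a, b'; split=> //; rewrite ab.
Qed.

(** [mixed_count] gives [2 |S| + 2 q <= c + 2 <= 2 d + 5]. *)
Let cardS_le : #|S| + q <= d + 2.
Proof.
have [a [b [aA bB ab]]] := two_reps.
have gAB a' I b' J : a' \in A -> b' \in B -> lcycle X (a' :: I ++ b' :: J) -> q <= size I.
  by move=> a'A b'B lc; apply: (ear_gap (earAB a'A b'B (lcycle_neq lc)) lc).
have gBA a' I b' J : a' \in B -> b' \in A -> lcycle X (a' :: I ++ b' :: J) -> q <= size I.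
  move=> a'A b'B lc; rewrite /q -size_rev.
  exact: (ear_gap (earBA a'A b'B (lcycle_neq lc)) lc).
have := mixed_count lc0 SX q_gt0 gS1 gAB gBA aA bB ab.
by have := ctx_small G; rewrite -/S; arith.
Qed.

(** By [cardS_le] each of [S :\: A] and [S :\: B] has at most one element. So of two distinct
    vertices of [S] one lies in [A] and the other in [B], and [Q] joins them. *)
Let ears a b : a \in S -> b \in S -> a != b -> exists P, ear a P b /\ size P = q.
Proof.
have one Z W : Z :|: W = S -> d < #|W| + q -> #|Z :\: W| <= 1.
  move=> ZW cW; rewrite cardsD; have := cardsUI Z W.
  by rewrite ZW; move: cardS_le cW; arith.
have h1 := one _ _ (erefl S) cardB; have h2 := one _ _ (setUC B A) cardA.
move=> aS bS ab; case: (boolP ((a \in A) && (b \in B))) => [/andP[aA bB]|n1].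
  by exists Q; split=> //; apply: earAB.
case: (boolP ((a \in B) && (b \in A))) => [/andP[aB bA]|n2].
  by exists (rev Q); rewrite size_rev; split=> //; apply: earBA.
exfalso; move: aS bS n1 n2; rewrite !in_setU.
have no Z W : #|Z :\: W| <= 1 -> a \in Z -> a \notin W -> b \in Z -> b \notin W -> False.
  move=> le1 aZ aW bZ bW; have : 1 < #|Z :\: W|; last by rewrite ltnNge le1.
  by apply/card_gt1P; exists a, b; rewrite !in_setD aZ aW bZ bW.
case aA: (a \in A); case aB: (a \in B); case bA: (b \in A); case bB: (b \in B) => //= _ _ _ _.
  by apply: (no A B); rewrite ?aA ?aB ?bA ?bB.
by apply: (no B A); rewrite ?aA ?aB ?bA ?bB.
Qed.

Let S_gt1 : 1 < #|S|.
Proof.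
apply: (@leq_trans #|A|); last by apply: subset_leq_card; apply: subsetUl.
by move: cardA q_lt; arith.
Qed.

(** Counting intervals gives [|Z| (q + 1) <= c]. With [|Z| >= d + 2 - q] and [k = d - q > 0] this
    yields [k q <= k + 1], which fails for [q >= 3]. *)
Let small_count Z : Z \subset X -> (forall a b, a \in Z -> b \in Z -> a != b ->
    exists P, ear a P b /\ size P = q) -> d + 2 <= #|Z| + q -> q <= 2.
Proof.
move=> ZX eZ cZ; have Z1 : 1 < #|Z| by move: cZ q_lt; arith.
have := gapped_count lc0 ZX Z1 (ears_gapped eZ).
have := ctx_small G; move: q_lt cZ q_gt0; move: #|Z| q => m r.
case: (leqP r 2) => // r2 rd cZ r0 cs h.
have := leq_mul (leqnn r.+1) (_ : d + 2 - r <= m); rewrite mulnC => hh.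
have : (d + 2 - r) * r.+1 <= 2 * d + 3.
  apply: leq_trans (leq_mul (_ : d + 2 - r <= m) (leqnn _)) _; first by arith.
  by apply: leq_trans h _.
have -> : d = r + (d - r) by arith.
have : 0 < d - r by arith.
move: (d - r) => k k0; rewrite (_ : r + k + 2 - r = k + 2); last by arith.
rewrite mulnDl !mulnS.
have : 3 * k <= k * r by rewrite mulnC leq_mul.
by arith.
Qed.

Let small_ends z : q <= 2 -> z \in Q -> (z == x) || (z == y).
Proof.
have [Q' [QE _ l]] := walkP wQ; move=> q2 zQ; move: q2 zQ l; rewrite /q QE /=.
by case: Q' {QE} => [|v [|]] //= _; rewrite !inE => + <-; rewrite ?orbb.
Qed.

Let H_small : q <= 2 -> forall h, h \in H -> h \in Q.
Proof.
move=> q2 h hH; apply: contraT => hQ.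
have hQ' : h \notin [set z in Q] by rewrite inE.
have xQ' : x \in [set z in Q] by rewrite inE.
have [u [v [uQ' vH vQ uv]]] := joined_exit (comp_conn pH (QH xQ) hH) xQ' hQ'.
move: uQ' vQ; rewrite !inE => uQ' vQ; suff : v \in Q by rewrite (negPf vQ).
have : (u == x) || (u == y).
  exact: small_ends.
by case/orP=> /eqP E; [apply: nbx | apply: nby]; rewrite -?E.
Qed.

(* When [S] has its minimum size both ends of [Q] are adjacent to all other
   vertices of [Q], so every vertex of [Q] starts a path spanning [Q]. *)
Let adj_end z : z \in Q -> (forall h, h \in H -> e z h -> h \in Q) -> #|S| + q <= d + 1 ->
  [set v in X | e z v] \subset S -> forall w, w \in Q -> w != z -> e z w.
Proof.
move=> zQ nz le sub w wQ' wz.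
have sN : [set v | e z v] \subset S :|: ([set v in Q] :\ z).
  apply/subsetP => v; rewrite !in_setU !inE => zv.
  case: (comp_cl pH (QH zQ) zv) => [vH|vX].
    rewrite nz // andbT; have [vz|//] := eqVneq v z; last by rewrite !orbT.
    by move: zv; rewrite vz (ctx_irr G).
  by have := subsetP sub v; rewrite !inE vX zv => /(_ isT) ->.
have := cardsD1 z [set v in Q]; rewrite card_undup_set // inE zQ => qE.
have cle : #|S :|: ([set v in Q] :\ z)| <= #|[set v | e z v]|.
  apply: leq_trans (ctx_deg G z); apply: leq_trans (leq_of_leqif (leq_card_setU _ _)) _.
  by move: le; rewrite /q; move: qE => /=; arith.
have wS : w \in S :|: ([set v in Q] :\ z) by rewrite in_setU !inE wz wQ' orbT.
have EE : [set v | e z v] = S :|: ([set v in Q] :\ z).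
  by apply/eqP; rewrite eqEcard sN cle.
by move: wS; rewrite -EE inE.
Qed.

(** A rotation in the sense of Posa: [x] is adjacent to the successor [v] of [z] on [Q], so one may
    go from [z] back to [x], jump to [v] and go on to [y]. *)
Let spanning z : #|S| + q <= d + 1 -> z \in Q -> z != y ->
  exists Q', walk e Q' z y /\ perm_eq Q' Q.
Proof.
move=> le zQ zy; have [->|zx] := eqVneq z x; first by exists Q.
have adjx : forall w, w \in Q -> w != x -> e x w.
  by apply: adj_end => //; apply: subsetUl.
move: (wQ) adjx (uQ); case/splitPr: zQ => Q1 Q2 w adjx u.
have [w1 w2] := walk_split w.
case: Q2 => [|v Q2] in w adjx u w2 *.
  by move: w2 zy => /= /andP[_ /eqP->]; rewrite eqxx.
case: Q1 => [|x' Q1] in w adjx u w1 *.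
  by move: w zx => /= /and3P[/eqP->]; rewrite eqxx.
have xx' : x' = x by move: w => /and3P[/eqP].
rewrite {x'}xx' in w adjx u w1 *.
have w2' : walk e (v :: Q2) v y.
  by move: w2 => /= /and3P[_ /andP[_ ->] ->]; rewrite eqxx.
have vx : v != x.
  by apply/eqP => E; have := count_le1 x u; rewrite /= count_cat /= E !eqxx; arith.
exists (rev (rcons (x :: Q1) z) ++ v :: Q2); split.
  apply: walk_cat (walk_rev esym w1) w2' _; apply: adjx vx.
  by rewrite mem_cat !inE eqxx !orbT.
by apply/permP => p; rewrite rev_rcons; do 4 rewrite ?count_cat ?count_rev /=; arith.
Qed.

Let ear_to a Q' z b : a \in X -> b \in B -> a != b -> e z a -> walk e Q' z y ->
  perm_eq Q' Q -> ear a Q' b.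
Proof.
rewrite inE => aX /andP[bX yb] ab za w Q'Q; split=> //.
  by apply: (link_walk w) => //; rewrite esym.
split; rewrite ?(perm_uniq Q'Q) ?(perm_size Q'Q) //.
by move=> h; rewrite (perm_mem Q'Q); apply: QH.
Qed.

Let end_nb z : z \in Q -> (z == x) || (z == y) -> forall h, h \in H -> e z h -> h \in Q.
Proof. by move=> _ /orP[]/eqP-> h; [apply: nbx | apply: nby]. Qed.

Let S_eqB : #|S| + q <= d + 1 -> S = B.
Proof.
move=> le; apply/eqP; rewrite eq_sym eqEcard subsetUr /=.
by move: cardB le; arith.
Qed.

(** From a neighbour [v] outside [S] there would be spanning ears to all of [S], because a path
    spanning [Q] starts at [z]. Then [S] with [v] is too large for [small_count] unless [q <= 2],
    and for such [q] every vertex of [Q] is an end. *)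
Let nb_in_S z v : z \in Q -> v \in X -> e z v -> v \in S.
Proof.
move=> zQ vX zv; apply: contraT => vS.
have zx : z != x by apply: contraNneq vS => zx; rewrite !inE vX -zx zv.
have zy : z != y by apply: contraNneq vS => zy; rewrite !inE vX -zy zv orbT.
have q3 : 2 < q.
  rewrite ltnNge; apply/negP => /small_ends/(_ zQ).
  by rewrite (negPf zx) (negPf zy).
have [le|gt] := leqP (#|S| + q) (d + 1); last first.
  by have := small_count SX ears; move: gt q3; rewrite ltnNge; arith.
have [Q' [w' Q'Q]] := spanning le zQ zy.
have earv b : b \in S -> exists P, ear v P b /\ size P = q.
  move=> bS; exists Q'; rewrite (perm_size Q'Q); split=> //.
  apply: (ear_to vX _ _ zv w' Q'Q); first by rewrite -(S_eqB le).
  by apply: contraNneq vS => ->.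
have : q <= 2; last by rewrite leqNgt q3.
apply: (small_count (Z := v |: S)).
- by rewrite subUset sub1set vX.
- move=> a b; rewrite !in_setU1 => /orP[/eqP->|aS] /orP[/eqP->|bS] ab.
  + by rewrite eqxx in ab.
  + exact: earv.
  + have [P [E sP]] := earv a aS; exists (rev P); rewrite size_rev sP; split=> //.
    exact: (ear_rev G E).
  + exact: ears.
- have := cardA; have : #|A| <= #|S| by apply: subset_leq_card; apply: subsetUl.
  by rewrite cardsU1 vS; arith.
Qed.

(** A component [K] of [H] minus [Q] would hang on an inner vertex [z] of [Q] and, since a path
    spanning [Q] starts at [z], could have no neighbour on the cycle. Then [detour_bound] gives
    [d < |Q|], against [ear_le]. If [|S| + q > d + 1], then [q <= 2] and there are no inner
    vertices. *)
Let H_sub h : h \in H -> h \in Q.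
Proof.
move=> hH; have [le|gt] := leqP (#|S| + q) (d + 1); last first.
  by apply: H_small => //; apply: (small_count SX ears); move: gt; arith.
apply: contraT => hQ.
have hHQ : h \in H :\: [set z in Q] by rewrite !inE hQ.
have [K [pK hK]] := piece_exists esym hHQ.
have [_ /subsetP KH clK cK] := pK.
have KH' k : k \in K -> k \in H by move/KH; rewrite !inE => /andP[].
have KQ k : k \in K -> k \notin Q by move/KH; rewrite !inE => /andP[].
have xK : x \notin K by apply: contraL xQ => /KQ.
have [k0 [z [k0K zH zK k0z]]] := joined_exit (comp_conn pH hH (QH xQ)) hK xK.
have zQ : z \in Q.
  by apply: contraT => zQ; rewrite (clK k0 z) ?inE ?zQ // in zK.
have zk0 : e z k0 by rewrite esym.
have nend : ~~ ((z == x) || (z == y)).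
  by apply/negP => /(end_nb zQ)/(_ k0 (KH' _ k0K) zk0); rewrite (negPf (KQ _ k0K)).
have zy : z != y by move: nend; rewrite negb_or => /andP[].
have [Q' [w' Q'Q]] := spanning le zQ zy.
have KnX k v : k \in K -> v \in X -> ~~ e k v.
  move=> kK vX; apply/negP => kv.
  have [P [wP uP PK]] := cK _ _ kK k0K.
  have [b bB bv] : exists2 b, b \in B & b != v.
    have : 1 < #|B| by move: cardB q_lt; arith.
    move=> /card_gt1P [b [b' [bB b'B bb']]].
    have [bv|bv] := eqVneq b v; last by exists b.
    by exists b'; rewrite // -bv eq_sym.
  move: (bB); rewrite inE => /andP[bX yb].
  have : size (P ++ Q') <= q.
    apply: (maxQ (a := v) (b := b)).
    apply: (ear_cons bX vX _ _ wP uP _ yb w') => //.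
    - by rewrite eq_sym.
    - by rewrite esym.
    - by move=> u /PK /KH'.
    - apply: uniq_cat_out => //; first by rewrite (perm_uniq Q'Q).
      by move=> u; rewrite (perm_mem Q'Q); apply: contraL => /PK; apply: KQ.
    - by move=> u; rewrite (perm_mem Q'Q); apply: QH.
  by rewrite size_cat (perm_size Q'Q) /q -{2}[size Q]add0n leq_add2r leqNgt (walk_size wP).
suff : d < size Q by move: q_lt; rewrite /q; arith.
apply: (detour_bound G (K := K) (z0 := z)) => //.
- move=> k v kK kv; case: (comp_cl pH (KH' _ kK) kv) => [vH|vX].
    have [vQ|vQ] := boolP (v \in Q); first by right.
    by left; apply: clK kv => //; rewrite !inE vQ.
  by move: (KnX _ _ kK vX); rewrite kv.
- rewrite ltnNge; apply/negP => q1; move: zQ zy (yQ) q1; case: (Q) => [|v [|]] //=.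
  by rewrite !inE => /eqP-> vy /eqP yv; rewrite yv eqxx in vy.
- by move=> u uQ'; apply: contraL uQ' => /KQ.
- by exists k0.
move=> Z1 z1 Zm z2 Z2 R ZE lR uR RK; rewrite leqNgt; apply/negP => lt.
have [a [b [aA bB ab]]] := two_reps.
have lZ : link e a Q b by case: (earAB aA bB ab).
have : size (Z1 ++ z1 :: R ++ z2 :: Z2) <= q; last by rewrite /q ZE; szs.
apply: (maxQ (a := a) (b := b)); move: aA bB; rewrite !inE => /andP[aX _] /andP[bX _].
split=> //.
  by move: lZ; rewrite ZE !link_cat => /and3P[-> _ ->]; rewrite lR.
split; last by szs.
- apply: (uniq_count (t := Q ++ R)); last by rewrite ZE; cnt.
  by apply: uniq_cat_out => // u /RK; apply: KQ.
- move=> u; rewrite mem_cat inE mem_cat => uZ.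
  have [/RK/KH'//|uR'] := boolP (u \in R); apply: QH.
  by move: uZ; rewrite ZE !(mem_cat, inE) (negPf uR') /= => /or4P[]->; rewrite ?orbT.
Qed.

Let cardH : #|H| = q.
Proof.
rewrite /q -(card_undup_set uQ); apply: eq_card => v; rewrite inE.
by apply/idP/idP => [/H_sub|/QH].
Qed.

Lemma longest_ear_set : ear_set S q.
Proof.
split=> //; first by move=> h v /H_sub; apply: nb_in_S.
have := cardA; have : #|A| <= #|S| by apply: subset_leq_card; apply: subsetUl.
by arith.
Qed.

End Longest.

Lemma ear_set_exists : exists S q, ear_set S q.
Proof.
have [a [Q [b [E maxQ]]]] := longest_ear G lc0 pH.
have [_ _ _ l [_ _ q0]] := E.
have [x [y wQ]] : exists x y, walk e Q x y.
  case: Q l q0 {E maxQ} => // x Q; rewrite /link /= rcons_path => /and3P[_ p _] _.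
  by exists x, (last x Q); apply: walkI.
exact: ex_intro _ _ (ex_intro _ _ (longest_ear_set E wQ maxQ)).
Qed.


End Classification.

(** * Intervals between attachment vertices *)

Section Blocks.

Variables (T : finType) (e : rel T) (c d : nat).
Implicit Types (s t L P Q R I J : seq T) (A B K S W Y Z : {set T}).
Hypothesis G : tough_ctx e c d.
Local Notation lcycle := (lcycle e c).
Implicit Types (bl m : seq (T * seq T)) (b : T * seq T).

Definition flat bl : seq T := flatten [seq b.1 :: b.2 | b <- bl].

(* The cycle cut at the vertices of [S]: a block is a vertex of [S] with the
   interval following it. *)
Record blocks (X S : {set T}) bl : Prop := Blocks {
  bk_lc : lcycle X (flat bl);
  bk_in : forall b, b \in bl -> b.1 \in S;
  bk_out : forall b z, b \in bl -> z \in b.2 -> z \notin S }.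

(** The truncated subtraction loses nothing where intervals have at least [q] vertices. *)
Definition excess q bl := sumn [seq size b.2 - q | b <- bl].

(** Tells in which interval a vertex lies, as a function on all of [T] with values in an [eqType]:
    the kind of colour that [extract_link] expects. *)
Definition pattern bl z := [seq z \in b.2 | b <- bl].

Lemma flat_cat bl m : flat (bl ++ m) = flat bl ++ flat m.
Proof. by rewrite /flat map_cat flatten_cat. Qed.

Lemma flat_cons b bl : flat (b :: bl) = b.1 :: b.2 ++ flat bl.
Proof. by []. Qed.

Lemma excess_cat q bl m : excess q (bl ++ m) = excess q bl + excess q m.
Proof. by rewrite /excess map_cat sumn_cat. Qed.

Lemma excess_perm q bl m : perm_eq bl m -> excess q bl = excess q m.
Proof. by move=> p; apply: perm_sumn; apply: perm_map. Qed.

Lemma mem_flat bl z : (z \in flat bl) = has (fun b => (z == b.1) || (z \in b.2)) bl.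
Proof.
elim: bl => [|b bl IH] //; rewrite flat_cons inE mem_cat IH /=.
by rewrite orbA.
Qed.

Variables X S : {set T}.

Lemma blocks_rot bl m : blocks X S (bl ++ m) -> blocks X S (m ++ bl).
Proof.
move=> [lc i o]; split.
- by rewrite flat_cat; apply: lcycle_rot; rewrite -flat_cat.
- by move=> b bm; apply: i; rewrite mem_cat orbC -mem_cat.
- by move=> b z bm; apply: o; rewrite mem_cat orbC -mem_cat.
Qed.

Lemma blocks_exist s a : lcycle X s -> a \in X -> a \in S ->
  exists bl i, [/\ blocks X S bl, flat bl = rot i s & i <= size s].
Proof.
move=> lc aX aS; have [s' [i [si le lc']]] : exists s' i,
    [/\ rot i s = a :: s', i <= size s & lcycle X (a :: s')].
  have [_ _ _ sX] := lc; move: aX; rewrite -sX => /splitPr as_; case: as_ lc => s1 s2 lc.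
  exists (s2 ++ s1), (size s1); rewrite rot_size_cat; split=> //; first by szs.
  exact: (lcycle_rot (s := s1) (t := a :: s2)).
have [I [bl [sE IS inS o]]] : exists I bl, [/\ s' = I ++ flat bl,
    forall z, z \in I -> z \notin S, forall b, b \in bl -> b.1 \in S &
    forall b z, b \in bl -> z \in b.2 -> z \notin S].
  elim: s' {lc' si} => [|z s' [I [bl [-> IS inS o]]]]; first by exists [::], [::].
  case: (boolP (z \in S)) => zS.
    exists [::], ((z, I) :: bl); split=> // [b|b v]; rewrite inE => /orP[/eqP->|] //.
    - exact: inS.
    - exact: IS.
    - exact: o.
  exists (z :: I), bl; split=> // v; rewrite inE => /orP[/eqP->//|].
  exact: IS.
exists ((a, I) :: bl), i; split=> //; last by rewrite si sE.
split.
- by rewrite flat_cons /= -sE.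
- by move=> b; rewrite inE => /orP[/eqP->|/inS].
- by move=> b z; rewrite inE => /orP[/eqP->|/o]; [apply: IS | apply].
Qed.

Section OneBlocks.

Variable bl : seq (T * seq T).
Hypothesis B : blocks X S bl.

Lemma bk_uniq_fst : uniq [seq b.1 | b <- bl].
Proof.
have [_ us _ _] := bk_lc B; elim: bl us => //= b m IH.
rewrite mem_cat negb_or cat_uniq => /and3P[/andP[_ bm] _ /andP[_ um]].
rewrite IH // andbT; apply: contra bm => /mapP[b' b'm ->].
by rewrite mem_flat; apply/hasP; exists b'; rewrite ?eqxx.
Qed.

Lemma bk_uniq : uniq bl.
Proof. exact: map_uniq bk_uniq_fst. Qed.

Lemma bk_sub b z : b \in bl -> z \in b.2 -> z \in X :\: S.
Proof.
move=> bB zb; rewrite inE (bk_out B bB zb) /=; have [_ _ _ <-] := bk_lc B.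
by rewrite mem_flat; apply/hasP; exists b; rewrite ?zb ?orbT.
Qed.

Lemma bk_own b b' z : b \in bl -> b' \in bl -> z \in b.2 -> z \in b'.2 -> b = b'.
Proof.
have [_ us _ _] := bk_lc B; elim: bl us => // b0 m IH.
rewrite flat_cons => us.
have um : uniq (flat m) by move: us; rewrite /= cat_uniq => /and4P[].
have no b1 : b1 \in m -> z \in b0.2 -> z \in b1.2 -> False.
  move=> b1m z0 z1; have : 0 < count_mem z b0.2 by rewrite count_gt0.
  have : 0 < count_mem z (flat m).
    by rewrite count_gt0 mem_flat; apply/hasP; exists b1; rewrite ?z1 ?orbT.
  by have := count_le1 z us; rewrite /= count_cat /=; arith.
rewrite !inE => /orP[/eqP->|bm] /orP[/eqP->|b'm] // z1 z2.
- by case: (no b').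
- by case: (no b).
- exact: IH.
Qed.

Lemma bk_find z : z \in X :\: S -> exists2 b, b \in bl & z \in b.2.
Proof.
rewrite inE => /andP[zS]; have [_ _ _ <-] := bk_lc B.
rewrite mem_flat => /hasP[b bB /orP[/eqP zb|zb]]; last by exists b.
by rewrite zb (bk_in B bB) in zS.
Qed.

Lemma bk_size : S \subset X -> size bl = #|S|.
Proof.
move=> SX; rewrite -(count_lcycle (bk_lc B) SX).
have i := bk_in B; have o := bk_out B; elim: bl i o => // b m IH i o.
rewrite flat_cons /= count_cat -IH; last first.
- by move=> b' z b'm; apply: o; rewrite inE b'm orbT.
- by move=> b' b'm; apply: i; rewrite inE b'm orbT.
have -> : count (mem S) b.2 = 0.
  apply/eqP; rewrite -leqn0 leqNgt -has_count -all_predC; apply/allP => z zb /=.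
  by apply: o zb; rewrite mem_head.
by have -> : b.1 \in S by apply: i; rewrite mem_head.
Qed.

Lemma patternP b z z' : b \in bl -> z \in b.2 ->
  pattern bl z = pattern bl z' -> z' \in b.2.
Proof. by move=> bB zb /eq_in_map/(_ b bB) <-. Qed.

Lemma pattern_own b z z' : b \in bl -> z \in b.2 -> z' \in b.2 ->
  pattern bl z = pattern bl z'.
Proof.
move=> bB zb zb'; apply/eq_in_map => b' b'B; apply/idP/idP => h.
  by rewrite -(bk_own bB b'B zb h).
by rewrite -(bk_own bB b'B zb' h).
Qed.

Lemma bk_two b b' : b \in bl -> b' \in bl -> b != b' ->
  exists m m', blocks X S (b :: m ++ b' :: m') /\ perm_eq bl (b :: m ++ b' :: m').
Proof.
move=> /splitPr bB; case: bB B => p1 p2 BB; rewrite mem_cat inE orbCA -mem_cat eq_sym.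
move=> + bb'; rewrite (negPf bb') /= mem_cat orbC -mem_cat => b'B.
have p : perm_eq (p1 ++ b :: p2) (b :: p2 ++ p1) by rewrite perm_catC.
have := blocks_rot BB; rewrite cat_cons; move: (p2 ++ p1) b'B p => r /splitPr b'B.
by case: b'B => m m' p BB'; exists m, m'.
Qed.

Lemma bk_gap q b : gapped e c X S q -> 1 < size bl -> b \in bl -> q <= size b.2.
Proof.
move=> gS b1 /splitPr bB; case: bB b1 B => p1 p2 b1 BB.
have [lc i _] := blocks_rot BB.
case E: (p2 ++ p1) => [|b' m]; first by move: b1 (congr1 size E); rewrite !size_cat /=; arith.
rewrite /= E in lc i.
apply: (gS b.1 _ b'.1 (b'.2 ++ flat m)) => //; apply: i; rewrite !inE eqxx ?orbT //.
Qed.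

Lemma bk_excess q : (forall b, b \in bl -> q <= size b.2) ->
  c = size bl * q.+1 + excess q bl.
Proof.
have [_ _ <- _] := bk_lc B; elim: bl => // b m IH h.
rewrite flat_cons /= size_cat IH => [|b' b'm]; last by rewrite h // inE b'm orbT.
have := h b (mem_head _ _); rewrite /excess /= mulSn.
by move: (_ * _) (sumn _); arith.
Qed.

End OneBlocks.

Lemma cycle_sub_walk s1 s s2 : cycle e (s1 ++ s ++ s2) -> 0 < size s ->
  exists x y, walk e s x y.
Proof.
rewrite -(rot_cycle (size s1)) rot_size_cat -catA; case: s => // x s /=.
rewrite rcons_cat cat_path => /andP[p _] _; exists x, (last x s); exact: walkI.
Qed.

(** The vertex of [S] in front of an interval is moved to the end of the preceding arc, so that both
    arcs begin and end in [S], as [cross] requires. *)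
Lemma bk_arcs b m b' m' : blocks X S (b :: m ++ b' :: m') -> exists p1 p2,
  [/\ lcycle X (rcons (flat m') b.1 ++ b.2 ++ rcons (flat m) b'.1 ++ b'.2),
      walk e (rcons (flat m) b'.1) p1 b'.1, walk e (rcons (flat m') b.1) p2 b.1 &
      [/\ p1 \in S, p2 \in S, p1 != p2 & b.1 != b'.1]].
Proof.
move=> [lc i _]; have lc' : lcycle X (rcons (flat m') b.1 ++ b.2 ++ rcons (flat m) b'.1 ++ b'.2).
  have lc1 : lcycle X ((b.1 :: b.2 ++ flat m ++ b'.1 :: b'.2) ++ flat m').
    by move: lc; rewrite flat_cons flat_cat flat_cons; do 3 rewrite /= -?catA.
  by have := lcycle_rot lc1; rewrite -!cats1; do 3 rewrite /= -?catA.
have hd m0 a : (forall b0, b0 \in m0 -> b0.1 \in S) -> a \in S ->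
    forall x y, walk e (rcons (flat m0) a) x y -> x \in S /\ y = a.
  move=> im aS x y w; split; last first.
    by rewrite -(walk_lastE x w) last_rcons.
  rewrite -(walk_head x w); case: m0 im {w} => [|b0 m0] im //=.
  by apply: im; rewrite mem_head.
have [cs us _ _] := lc'.
have bS : b.1 \in S by apply: i; rewrite mem_head.
have b'S : b'.1 \in S by apply: i; rewrite !(inE, mem_cat) eqxx !orbT.
have imm' b0 : b0 \in m' -> b0.1 \in S.
  by move=> h; apply: i; rewrite !(inE, mem_cat) h !orbT.
have imm b0 : b0 \in m -> b0.1 \in S.
  by move=> h; apply: i; rewrite !(inE, mem_cat) h !orbT.
have [p1 [y1 w1]] : exists x y, walk e (rcons (flat m) b'.1) x y.
  apply: (cycle_sub_walk (s1 := rcons (flat m') b.1 ++ b.2) (s2 := b'.2)).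
    by rewrite -!catA.
  by rewrite size_rcons.
have [p2 [y2 w2]] : exists x y, walk e (rcons (flat m') b.1) x y.
  by apply: (cycle_sub_walk (s1 := [::]) cs); rewrite size_rcons.
have [p1S E1] := hd _ _ imm b'S _ _ w1; have [p2S E2] := hd _ _ imm' bS _ _ w2.
rewrite {}E1 in w1; rewrite {}E2 in w2; exists p1, p2; split=> //; split=> //.
- apply/eqP => E; have := count_le1 p1 us; have [h1 _] := walk_mem w1.
  have [h2 _] := walk_mem w2; rewrite -E in h2; move: h1 h2.
  by rewrite -!count_gt0 !count_cat; arith.
- apply/eqP => E; have := count_le1 b.1 us; have [_ h1] := walk_mem w1.
  have [_ h2] := walk_mem w2; rewrite -{1}E in h1; move: h1 h2.
  by rewrite -!count_gt0 !count_cat; arith.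
Qed.

End Blocks.

(** * Links forced by toughness outside the component *)

Section Toughness.

Variables (T : finType) (e : rel T) (c d : nat).
Implicit Types (s t L P Q R I J : seq T) (A B K S W Y Z : {set T}).
Implicit Types (bl m : seq (T * seq T)) (b : T * seq T).
Hypothesis G : tough_ctx e c d.
Let esym := ctx_sym G.
Local Notation lcycle := (lcycle e c).
Variables (X H : {set T}) (s0 : seq T).
Hypotheses (lc0 : lcycle X s0) (pH : piece e (~: X) H).
Variables (S : {set T}) (q : nat).
Hypothesis ES : ear_set e d X H S q.
Local Notation blocks := (blocks e c X S).

Lemma es_gapped : gapped e c X S q.
Proof. exact: (ears_gapped G pH (es_ear ES)). Qed.

Lemma es_cl h v : h \in H -> e h v -> v \in H \/ v \in S.
Proof.
move=> hH hv; case: (comp_cl pH hH hv); [by left | right].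
exact: (es_nb ES) hH _ hv.
Qed.

Lemma es_ear_walk (a b : T) : a \in S -> b \in S -> a != b -> exists P p p',
  [/\ walk e P p p', e a p, e p' b, uniq P & {subset P <= H}] /\ size P = q.
Proof.
move=> aS bS ab; have [P [[_ _ _ l [uP PH P0]] sP]] := es_ear ES aS bS ab.
case: P l uP PH P0 sP => // p P; rewrite /link /= rcons_path => /and3P[ap pp pb] uP PH _ sP.
by exists (p :: P), p, (last p P); split=> //; split=> //; apply: walkI.
Qed.

Lemma es_blocks s : lcycle X s ->
  exists bl i, [/\ blocks bl, flat bl = rot i s & i <= size s].
Proof.
move=> lc; have /card_gt0P [a aS] : 0 < #|S| by have := es_two ES; arith.
exact: blocks_exist lc (subsetP (es_sub ES) _ aS) aS.
Qed.

Lemma es_stuck S' h r : S \subset S' -> h \in H -> joined e (~: S') h r -> r \in H.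
Proof.
move=> SS' hH j; apply: contraT => rH.
have [u [v [uH]]] := joined_exit j hH rH; rewrite inE => vS' vH uv.
case: (es_cl uH uv) => [vH'|/(subsetP SS')]; first by rewrite vH' in vH.
by rewrite (negPf vS').
Qed.

Lemma es_link_avoid u L v : u \in X :\: S -> link e u L v ->
  (forall z, z \in L -> z \notin X) -> forall z, z \in L -> z \notin H.
Proof.
rewrite inE => /andP[uS uX] l LX; apply: (link_avoid G es_cl _ uS _ l).
  by apply: contraL uX => /(comp_out pH).
by move=> z /LX; apply: contra; apply: (subsetP (es_sub ES)).
Qed.

(** The ear used in [cross] joins the last vertices of the two arcs, the one in [cross'] their first
    vertices; both have [q] vertices. *)
Lemma es_link bl b b' I1 u I2 J1 v J2 L : blocks bl ->
  b \in bl -> b' \in bl -> b != b' -> b.2 = I1 ++ u :: I2 -> b'.2 = J1 ++ v :: J2 ->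
  link e u L v -> uniq L -> (forall z, z \in L -> z \notin X) ->
  size L + q <= size I1 + size J1 /\ size L + q <= size I2 + size J2.
Proof.
move=> B bB b'B bb' bE b'E luv uL LX.
have uXS : u \in X :\: S by apply: (bk_sub B bB); rewrite bE mem_cat mem_head orbT.
have LH := es_link_avoid uXS luv LX.
have [m [m' [B' _]]] := bk_two B bB b'B bb'.
have [p1 [p2 [lc w1 w2 [p1S p2S p12 bb1]]]] := bk_arcs B'.
have bS := bk_in B bB; have b'S := bk_in B b'B.
rewrite bE b'E in lc.
have [P [p [p' [[wP ap pb uP PH] sP]]]] := es_ear_walk bS b'S bb1.
have [P' [r [r' [[wP' ar rb uP' PH'] sP']]]] := es_ear_walk p1S p2S p12.
have LP R : uniq R -> {subset R <= H} -> uniq (L ++ R) /\ forall z, z \in L ++ R -> z \notin X.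
  move=> uR RH; split; last by move=> z; rewrite mem_cat => /orP[/LX//|/RH]; apply: comp_out pH _.
  by apply: uniq_cat_out => // z /RH; apply: contraL => /LH.
have [u1 o1] := LP _ uP PH; have [u2 o2] := LP _ uP' PH'.
split; first by rewrite -sP; apply: (cross G lc w1 w2 luv u1 o1 wP ap pb).
by rewrite -sP'; apply: (cross' G lc w1 w2 luv u2 o2 wP' ar rb).
Qed.

(* [H] is one more component outside [S'], so [R] may be as small as [S']. *)
Lemma es_tough (A : eqType) (f : T -> A) S' R : S \subset S' -> S' \subset X ->
  uniq R -> #|S'| <= size R -> {subset R <= X :\: S'} -> {in R &, injective f} ->
  exists u v L, [/\ u \in X :\: S', v \in X :\: S', f u != f v, link e u L v & uniq L]
    /\ forall z, z \in L -> z \notin X.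
Proof.
move=> SS' S'X uR sR RX fR; have [h hH] : exists h, h \in H by case: pH.
have RX' r : r \in R -> (r \in X) && (r \notin S') by move/RX; rewrite inE andbC.
have hX := comp_out pH hH.
have hS' : h \notin S' by apply: contra hX; apply: (subsetP S'X).
have stuck r : r \in R -> joined e (~: S') h r -> False.
  by move=> /RX'/andP[rX _] /(es_stuck SS' hH)/(comp_out pH); rewrite rX.
have [||||r [r' [rR r'R rr j]]] := ctx_tough G (S := S') (R := h :: R).
- by rewrite /= uR andbT; apply: contra hX => /RX'/andP[].
- by rewrite /=; arith.
- by have := subset_leq_card SS'; have := es_two ES; rewrite /=; arith.
- by move=> r; rewrite inE => /orP[/eqP->//|/RX'/andP[]].
move: rR r'R rr j; rewrite !inE => /orP[/eqP->|rR] /orP[/eqP->|r'R]; rewrite ?eqxx //.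
- by move=> _ /(stuck _ r'R).
- by move=> _ /(joined_sym esym)/(stuck _ rR).
move=> rr j; have frr : f r != f r' by apply: contra rr => /eqP/fR->.
have /andP[rX _] := RX' _ rR; have /andP[r'X _] := RX' _ r'R.
have [u [v [L [p LX]]]] := extract_link j rX r'X frr.
by exists u, v, L; split=> // z /LX; rewrite inE negb_or => /andP[].
Qed.

(** The first vertices of the intervals are [|S|] representatives, and [pattern] tells the intervals
    apart. *)
Lemma es_tough_blocks bl : blocks bl -> exists b b' I1 u I2 J1 v J2 L,
  [/\ b \in bl, b' \in bl, b != b', b.2 = I1 ++ u :: I2 & b'.2 = J1 ++ v :: J2] /\
  [/\ link e u L v, uniq L & forall z, z \in L -> z \notin X].
Proof.
move=> B; have sz := bk_size B (es_sub ES).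
have ne b : b \in bl -> 0 < size b.2.
  move=> bB; apply: leq_trans (es_pos ES) _; apply: (bk_gap B es_gapped _ bB).
  by rewrite sz; apply: es_two ES.
pose hd b := head b.1 b.2.
have hdin b : b \in bl -> hd b \in b.2.
  by move=> /ne; rewrite /hd; case: b.2 => //= z I _; rewrite mem_head.
have ih : {in bl &, injective hd}.
  by move=> b b' bB b'B E; apply: (bk_own B bB b'B (hdin b bB)); rewrite E hdin.
have [||||u [v [L [[uX vX fuv luv uL] LX]]]] :=
    @es_tough _ (pattern bl) S [seq hd b | b <- bl] (subxx _) (es_sub ES).
- by rewrite map_inj_in_uniq // (bk_uniq B).
- by rewrite size_map sz.
- by move=> r /mapP[b bB ->]; apply: (bk_sub B bB (hdin b bB)).
- move=> r r' /mapP[b bB ->] /mapP[b' b'B ->] /(patternP bB (hdin b bB)) h.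
  by rewrite (bk_own B bB b'B h (hdin b' b'B)).
have [b bB ub] := bk_find B uX; have [b' b'B vb'] := bk_find B vX.
have bb' : b != b'.
  by apply: contra fuv => /eqP E; rewrite (pattern_own B bB ub (z' := v)) ?E.
have [I1 [I2 bE]] : exists I1 I2, b.2 = I1 ++ u :: I2 by case/splitPr: ub => I1 I2; exists I1, I2.
have [J1 [J2 b'E]] : exists J1 J2, b'.2 = J1 ++ v :: J2 by case/splitPr: vb' => J1 J2; exists J1, J2.
by exists b, b', I1, u, I2, J1, v, J2, L.
Qed.

(** [es_link] puts at least [q] vertices before and [q] behind the two ends of the link, which count
    two more. *)
Lemma es_excess bl : blocks bl -> c = #|S| * q.+1 + excess q bl /\ 2 <= excess q bl.
Proof.
move=> B; have sz := bk_size B (es_sub ES).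
have g b : b \in bl -> q <= size b.2.
  by move=> bB; apply: (bk_gap B es_gapped _ bB); rewrite sz; apply: es_two ES.
split; first by rewrite -sz; exact: (bk_excess B g).
have [b [b' [I1 [u [I2 [J1 [v [J2 [L [[bB b'B bb' bE b'E] [luv uL LX]]]]]]]]]]] := es_tough_blocks B.
have [h1 h2] := es_link B bB b'B bb' bE b'E luv uL LX.
have [m [m' [_ p]]] := bk_two B bB b'B bb'.
rewrite (excess_perm _ p) /excess /= map_cat sumn_cat /= bE b'E.
by move: h1 h2; szs.
Qed.

(** With [k = |S|], [es_excess] gives [c >= k (q + 1) + 2], and [k (q + 1) = (k - 2)(q - 1) + 2 (k +
    q - 1)]. So [k + q >= d + 2] would give [c >= 2 d + 4], and [k + q = d + 1] gives
    [c >= (k - 2)(q - 1) + 2 d + 2]. *)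
Lemma es_bounds : [/\ #|S| + q = d + 1, (#|S| - 2) * (q - 1) <= 1 & 2 * d + 2 <= c].
Proof.
have [bl [_ [B _ _]]] := es_blocks lc0; have [cE ex] := es_excess B.
have := ctx_small G; have := es_le ES; have := es_two ES; have := es_pos ES.
move: ex cE; move: (excess q bl) => x; move: #|S| q => k r x2 ->.
case: k => [|[|k]] // ; case: r => // r _ _ le1 sm1; rewrite !subSS !subn0.
have [kr krE] : exists kr, kr = k * r by exists (k * r).
rewrite -krE.
have kE : k.+2 * r.+2 = kr + 2 * k + 2 * r + 4 by rewrite krE !mulSn !mulnS; move: (k * r); clear; lia.
rewrite {}kE in sm1 *; have [lt|ge] := leqP (k.+2 + r.+1) (d + 1); first by split; arith.
exfalso; destruct k as [|k]; first by rewrite mul0n in krE; arith.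
by have : r <= kr; [rewrite krE mulSn leq_addr | arith].
Qed.

End Toughness.

Ltac edge := first
  [ assumption
  | match goal with s : symmetric ?e |- is_true (?e _ _) => rewrite s; assumption end ].
Ltac lnk := first
  [ assumption
  | match goal with s : symmetric ?e |- is_true (link ?e _ (rev _) _) =>
      apply: (link_rev s); assumption end ].
(** Proves that an explicitly written list is a walk, by cutting it into walks and links known from
    the context, their reverses, and single edges. *)
Ltac wk := first
  [ eassumption
  | exact: walk1
  | match goal with s : symmetric ?e |- is_true (walk ?e (rev _) _ _) =>
      eapply (walk_rev s); wk end
  | simple eapply walkS; [wk | edge]
  | simple eapply walkSL; [wk | lnk]
  | simple eapply walk_link; [wk | wk | lnk]
  | simple eapply walk_cat; [wk | wk | edge] ].

(** * Components with one vertex *)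

Section WalkInversion.

Variables (T : finType) (e : rel T).
Implicit Types (s t P : seq T).

Lemma walk_cat_inv s t x y : walk e (s ++ t) x y -> 0 < size s -> 0 < size t ->
  exists y1 x1, [/\ walk e s x y1, walk e t x1 y & e y1 x1].
Proof.
case: s => // a s; case: t => // b t /= /and3P[/eqP-> p /eqP l] _ _.
move: p l; rewrite cat_path last_cat /= => /and3P[p1 p2 p3] l.
by exists (last x s), b; rewrite !eqxx p1 p3 l eqxx.
Qed.

Lemma walk_cons_inv u s x y : walk e (u :: s) x y -> 0 < size s ->
  exists x1, [/\ u = x, e x x1 & walk e s x1 y].
Proof.
case: s => // b s /= /and3P[/eqP-> /andP[p1 p2] l] _.
by exists b; rewrite eqxx p1 p2.
Qed.

Lemma cycle_walk s : cycle e s -> 0 < size s -> exists x y, walk e s x y /\ e y x.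
Proof.
case: s => // a s; rewrite /= rcons_path => /andP[p l] _.
by exists a, (last a s); rewrite !eqxx p.
Qed.

Lemma cycle_walks4 P I Q J : cycle e (P ++ I ++ Q ++ J) ->
  0 < size P -> 0 < size I -> 0 < size Q -> 0 < size J ->
  exists p p' i i' q q' j j',
    [/\ walk e P p p', walk e I i i', walk e Q q q' & walk e J j j'] /\
    [/\ e p' i, e i' q, e q' j & e j' p].
Proof.
move=> cs P0 I0 Q0 J0; have [|p [j' [w c]]] := cycle_walk cs; first by szs.
have [|p' [i [wP w' e1]]] := walk_cat_inv w P0; first by szs.
have [|i' [q [wI w2 e2]]] := walk_cat_inv w' I0; first by szs.
have [q' [j [wQ wJ e3]]] := walk_cat_inv w2 Q0 J0.
by exists p, p', i, i', q, q', j, j'.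
Qed.

End WalkInversion.

(** * Arcs whose intervals are single vertices *)

Section Alternating.

Variables (T : finType) (e : rel T) (S : {set T}).
Hypothesis esym : symmetric e.
Implicit Types (P : seq T) (W : pred T).

(** The stretches of a cycle along which every interval has one vertex; [W] records what is known of
    these vertices. *)
Inductive alt W : seq T -> Prop :=
| alt1 a : a \in S -> alt W [:: a]
| altS a w P : a \in S -> w \notin S -> W w -> alt W P -> alt W (a :: w :: P).

Lemma alt_size W P : alt W P -> 0 < size P.
Proof. by case. Qed.

Lemma alt_ends W P p p' : alt W P -> walk e P p p' -> p \in S /\ p' \in S.
Proof.
move=> aP; elim: aP p p' => [a aS|a w Q aS wS Ww aQ IH] p p'.
  by move=> /= /andP[/eqP<- /eqP<-].
case: Q aQ IH => [/alt_size//|q Q] aQ IH /= /and3P[/eqP<- /and3P[_ _ pQ] /eqP l].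
by split=> //; case: (IH q p') => //; apply: walkI.
Qed.

Lemma alt_cat W P Q w : alt W P -> w \notin S -> W w -> alt W Q -> alt W (P ++ w :: Q).
Proof.
move=> aP wS Ww aQ; elim: aP => [a aS|a w' P' aS w'S Ww' _ IH] /=; exact: altS.
Qed.

Lemma alt_rev W P : alt W P -> alt W (rev P).
Proof.
elim=> [a aS|a w Q aS wS Ww _ IH]; first exact: alt1.
by rewrite !rev_cons -cats1 cat_rcons; apply: alt_cat => //; apply: alt1.
Qed.

Lemma alt_split W P w : alt W P -> w \in P -> w \notin S -> exists P1 P2,
  [/\ P = P1 ++ w :: P2, alt W P1, alt W P2 & W w].
Proof.
elim=> [a aS|a w' Q aS w'S Ww' aQ IH].
  by rewrite inE => /eqP->; rewrite aS.
rewrite !inE => /or3P[/eqP->|/eqP->|/IH h wS]; first by rewrite aS.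
  by exists [:: a], Q; split=> //; apply: alt1.
by have [P1 [P2 [-> a1 a2 Ww]]] := h wS; exists (a :: w' :: P1), P2; split=> //; apply: altS.
Qed.

Lemma alt_single W P : alt W P -> (exists2 a, a \in S & P = [:: a]) \/
  exists a w Q, [/\ P = [:: a] ++ w :: Q, a \in S, W w, w \notin S & alt W Q].
Proof. by case=> [a aS|a w Q aS wS Ww aQ]; [left; exists a | right; exists a, w, Q]. Qed.

Definition full : pred T := [pred w | [forall a, (a \in S) ==> e w a]].

Lemma fullP w a : full w -> a \in S -> e w a.
Proof. by move=> /forallP/(_ a)/implyP. Qed.

Lemma alt_enter W P a : alt W P -> a \in P -> a \in S ->
  (exists Q, P = a :: Q) \/ exists P1 z Q, [/\ P = P1 ++ z :: a :: Q, alt W P1 & W z].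
Proof.
elim=> [b bS|b w Q bS wS Ww aQ IH].
  by rewrite inE => /eqP-> _; left; exists [::].
rewrite !inE => /or3P[/eqP->|/eqP->|/IH h] aS; first by left; exists (w :: Q).
  by rewrite aS in wS.
have [[Q' QE]|[P1 [z [Q' [QE a1 Wz]]]]] := h aS; right.
  by exists [:: b], w, Q'; rewrite QE; split=> //; apply: alt1.
by exists (b :: w :: P1), z, Q'; rewrite QE; split=> //; apply: altS.
Qed.

(* Entering an alternating arc anywhere, one can traverse the whole arc: go to
   its end, then use a full vertex to jump back over the entrance. *)
Lemma alt_cover P M p p' a : alt full P -> walk e (P ++ M) p p' -> p' \in S ->
  a \in P -> a \in S -> exists Q q, [/\ walk e Q a q, q \in S & perm_eq Q (P ++ M)].
Proof.
move=> aP w p'S aP' aS; have [[Q PE]|[P1 [z [Q [PE a1 fz]]]]] := alt_enter aP aP' aS.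
  rewrite PE in w *; exists ((a :: Q) ++ M), p'; split=> //.
  by move: w => /= /and3P[/eqP-> -> ->]; rewrite eqxx.
rewrite PE -catA in w *.
have [y1 [x1 [w1 w2 e1]]] := walk_cat_inv w (alt_size a1) (isT : 0 < size ((z :: a :: Q) ++ M)).
have [x2 [zx1 e2 w3]] := walk_cons_inv w2 (isT : 0 < size ((a :: Q) ++ M)).
have ax2 : x2 = a by move: w3 => /= /and3P[/eqP].
rewrite ax2 -zx1 in e1 w3 e2.
have [pS y1S] := alt_ends a1 w1.
have zp' := fullP fz p'S.
exists (((a :: Q) ++ M) ++ z :: rev P1), p; split=> //; first by wk.
by apply/permP => v; do 4 rewrite ?count_cat ?count_rev /=; arith.
Qed.

End Alternating.

(** * Reroutings through a one-vertex component *)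

Section SingleComponent.

Variables (T : finType) (e : rel T) (c d : nat).
Implicit Types (s t L P Q R I J : seq T) (A B K : {set T}) (W : pred T).
Implicit Types (bl m : seq (T * seq T)) (b : T * seq T).
Hypothesis G : tough_ctx e c d.
Let esym := ctx_sym G.
Local Notation lcycle := (lcycle e c).
Variables (X S : {set T}) (x : T).
Hypotheses (pH : piece e (~: X) [set x]) (ES : ear_set e d X [set x] S 1).
Local Notation blocks := (blocks e c X S).
Local Notation alt := (alt S).

Definition olink u L v := [/\ link e u L v, uniq L, forall z, z \in L -> z \notin X & x \notin L].

Lemma olink_sym u L v : olink u L v -> olink v (rev L) u.
Proof.
case=> l uL LX xL; split; rewrite ?rev_uniq ?mem_rev //; first exact: link_rev.
by move=> z; rewrite mem_rev; apply: LX.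
Qed.

Lemma olink_edge u v : e u v -> olink u [::] v.
Proof. by move=> uv; split=> //; apply: link_edge. Qed.

Lemma xX : x \notin X.
Proof. by apply: (comp_out pH); rewrite inE. Qed.

Lemma xS a : a \in S -> e x a.
Proof.
move=> aS; have [b bS ba] : exists2 b, b \in S & a != b.
  have /card_gt1P [b [b' [bS b'S bb]]] := es_two ES.
  have [ab|ab] := eqVneq a b; last by exists b.
  by exists b'; rewrite // ab.
have [P [[_ _ _ l [uP PH _]] sP]] := es_ear ES aS bS ba.
case: P l uP PH sP => [|h [|]] //= l _ PH _.
have := PH h (mem_head _ _); rewrite inE => /eqP <-.
by move: l => /= /andP[]; rewrite esym.
Qed.

Lemma xnb v : e x v -> v \in S.
Proof.
move=> xv; have xH : x \in [set x] by rewrite inE.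
case: (comp_cl pH xH xv) => [|vX]; last exact: (es_nb ES) xH vX xv.
by rewrite inE => /eqP vx; move: xv; rewrite vx (ctx_irr G).
Qed.

Lemma SsubX : S \subset X. Proof. exact: es_sub ES. Qed.

Lemma SX a : a \in S -> a \in X. Proof. exact: subsetP SsubX a. Qed.

Lemma too_longx s L t y z : lcycle X s -> uniq L -> (forall v, v \in L -> v \notin X) ->
  x \notin L -> walk e t y z -> e z y ->
  (forall v, count_mem v t <= count_mem v (s ++ x :: L)) -> size s < size t -> False.
Proof.
move=> lc uL LX xL; apply: (too_long G lc); first by rewrite /= xL.
by move=> v; rewrite inE => /orP[/eqP->|/LX//]; apply: xX.
Qed.

(** An arc with both ends in [S], phrased through [walk] so that no default vertex is needed. *)
Definition Sarc P := 0 < size P /\ forall p p', walk e P p p' -> p \in S /\ p' \in S.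

Lemma alt_arc W P : alt W P -> Sarc P.
Proof. by move=> aP; split=> [|p p' w]; [exact: (alt_size aP) | exact: (alt_ends aP w)]. Qed.

(** Names the ends of the four pieces once, so that [wk] finds every edge it may use among the
    hypotheses. *)
Lemma conf_facts P I Q J : lcycle X (P ++ I ++ Q ++ J) -> Sarc P -> Sarc Q ->
  0 < size I -> 0 < size J -> exists p p' i i' q q' j j',
    [/\ walk e P p p', walk e I i i', walk e Q q q' & walk e J j j'] /\
    [/\ e p' i, e i' q, e q' j & e j' p] /\
    [/\ e x p, e x p', e x q & e x q'] /\
    [/\ p \in S, p' \in S, q \in S & q' \in S].
Proof.
move=> [cs _ _ _] [P0 aP] [Q0 aQ] I0 J0.
have [p [p' [i [i' [q [q' [j [j' [[wP wI wQ wJ] es]]]]]]]]] := cycle_walks4 cs P0 I0 Q0 J0.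
have [pS p'S] := aP _ _ wP; have [qS q'S] := aQ _ _ wQ.
by exists p, p', i, i', q, q', j, j'; do ! split=> //; apply: xS.
Qed.

Lemma walk_lit1 u y z : walk e [:: u] y z -> y = u /\ z = u.
Proof. by move=> /= /andP[/eqP<- /eqP<-]. Qed.

Lemma walk_lit2 u v y z : walk e [:: u; v] y z -> [/\ y = u, z = v & e u v].
Proof. by move=> /= /and3P[/eqP<- /andP[-> _] /eqP<-]. Qed.

Lemma walk_lit3 u v w y z : walk e [:: u; v; w] y z -> [/\ y = u, z = w, e u v & e v w].
Proof. by move=> /= /and3P[/eqP<- /and3P[-> -> _] /eqP<-]. Qed.

Lemma walk_lit4 u v w r y z : walk e [:: u; v; w; r] y z ->
  [/\ y = u, z = r, e u v, e v w & e w r].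
Proof. by move=> /= /and3P[/eqP<- /and4P[-> -> -> _] /eqP<-]. Qed.

Lemma conf_rev P I Q J : lcycle X (P ++ I ++ Q ++ J) ->
  lcycle X (rev Q ++ rev I ++ rev P ++ rev J).
Proof.
move=> /(lcycle_rev G); rewrite !rev_cat -!catA => lc.
by have := lcycle_rot lc; rewrite -!catA.
Qed.

(** The link bypasses [v2], which is then free to carry the way from [v3] to [w]; nothing is omitted
    and [x] is gained. *)
Lemma reroute_middle_of_three P w Q v1 v2 v3 L : lcycle X (P ++ [:: w] ++ Q ++ [:: v1; v2; v3]) ->
  Sarc P -> Sarc Q -> e w v2 -> olink v1 L v3 -> False.
Proof.
move=> lc aP aQ wv [l uL LX xL].
have [p [p' [i [i' [q [q' [j [j' [[wP wI wQ wJ] [[e1 e2 e3 e4] [[xp xp' xq xq'] _]]]]]]]]]]] :=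
  conf_facts lc aP aQ isT isT.
have [iE i'E] := walk_lit1 wI; have [jE j'E v12 v23] := walk_lit3 wJ; subst.
apply: (@too_longx _ L (Q ++ v1 :: L ++ v3 :: v2 :: w :: rev P ++ [:: x]) q x lc uL LX xL).
- wk.
- edge.
- cnt.
- szs.
Qed.

(** Given the edge from [w] to [v2], each of the four further connections yields a cycle through all
    old vertices and [x]. *)
Lemma reroute_middle_of_four W P w Q v1 v2 v3 v4 : lcycle X (P ++ [:: w] ++ Q ++ [:: v1; v2; v3; v4]) ->
  alt W P -> alt W Q -> e w v2 ->
  [/\ forall L, ~ olink v1 L v3, forall L, ~ olink v1 L v4, ~ e w v3 &
      forall w', w' \in P ++ Q -> w' \notin S -> ~ e w' v3].
Proof.
move=> lc aP aQ wv.
have [p [p' [i [i' [q [q' [j [j' [[wP wI wQ wJ] [[e1 e2 e3 e4] [[xp xp' xq xq'] _]]]]]]]]]]] :=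
  conf_facts lc (alt_arc aP) (alt_arc aQ) isT isT.
have [iE i'E] := walk_lit1 wI; have [jE j'E v12 v23 v34] := walk_lit4 wJ; subst.
split.
- move=> L [l uL LX xL].
  apply: (@too_longx _ L (x :: rev P ++ v4 :: v3 :: rev L ++ v1 :: v2 :: w :: Q)
    x q' lc uL LX xL); [wk | edge | cnt | szs].
- move=> L [l uL LX xL].
  apply: (@too_longx _ L (Q ++ v1 :: L ++ v4 :: v3 :: v2 :: w :: rev P ++ [:: x])
    q x lc uL LX xL); [wk | edge | cnt | szs].
- move=> wv3; apply: (@too_longx _ [::] (P ++ x :: Q ++ [:: v1; v2; w; v3; v4])
    p v4 lc) => //; [wk | cnt | szs].
move=> w'; rewrite mem_cat => /orP[w'P|w'Q] w'S wv3.
  have [Y [Z [PE aY aZ _]]] := alt_split aP w'P w'S; subst P.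
  have [y [z [wY wZ ez]]] := walk_cat_inv wP (alt_size aY) isT.
  have [z' [zE ez' wZ']] := walk_cons_inv wZ (alt_size aZ); subst.
  have [_ yS] := alt_ends aY wY; have xy := xS yS.
  apply: (@too_longx _ [::] (Q ++ v1 :: v2 :: w :: rev Z ++ z :: v3 :: v4 :: Y ++ [:: x])
    q x lc) => //; [wk | cnt | szs].
have [Y [Z [QE aY aZ _]]] := alt_split aQ w'Q w'S; subst Q.
have [y [z [wY wZ ez]]] := walk_cat_inv wQ (alt_size aY) isT.
have [z' [zE ez' wZ']] := walk_cons_inv wZ (alt_size aZ); subst.
have [z'S _] := alt_ends aZ wZ'; have xz := xS z'S.
apply: (@too_longx _ [::] (Z ++ v1 :: v2 :: w :: rev P ++ v4 :: v3 :: z :: rev Y ++ [:: x])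
    z' x lc) => //; [wk | cnt | szs].
Qed.

Section FixedBlocks.

Variable bl : seq (T * seq T).
Hypothesis B : blocks bl.

Let sizebl : size bl = #|S|. Proof. exact: bk_size B SsubX. Qed.

Lemma bl_pos b : b \in bl -> 0 < size b.2.
Proof.
move=> bB; apply: (bk_gap B (es_gapped G pH ES)) => //.
by rewrite sizebl; apply: es_two ES.
Qed.

Lemma bl_uniq b : b \in bl -> uniq b.2.
Proof.
have [_ us _ _] := bk_lc B => /splitPr bB; case: bB us => m m' us.
apply: (uniq_count us) => v; rewrite flat_cat flat_cons count_cat /= count_cat; arith.
Qed.

Lemma bl_link b b' u v L : b \in bl -> b' \in bl -> b != b' -> u \in b.2 -> v \in b'.2 ->
  link e u L v -> uniq L -> (forall z, z \in L -> z \notin X) -> exists I1 I2 J1 J2,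
  [/\ b.2 = I1 ++ u :: I2, b'.2 = J1 ++ v :: J2, size L < size I1 + size J1 &
      size L < size I2 + size J2].
Proof.
move=> bB b'B bb' ub vb' l uL LX.
have [I1 [I2 bE]] : exists I1 I2, b.2 = I1 ++ u :: I2 by case/splitPr: ub => I1 I2; exists I1, I2.
have [J1 [J2 b'E]] : exists J1 J2, b'.2 = J1 ++ v :: J2 by case/splitPr: vb' => J1 J2; exists J1, J2.
have [h1 h2] := es_link G pH ES B bB b'B bb' bE b'E l uL LX.
by exists I1, I2, J1, J2; split=> //; move: h1 h2; arith.
Qed.

Lemma bl_link_x u L v : u \in X :\: S -> link e u L v -> (forall z, z \in L -> z \notin X) ->
  x \notin L.
Proof.
move=> uX l LX; apply/negP => xL.
by have := es_link_avoid G pH ES uX l LX xL; rewrite inE eqxx.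
Qed.

Lemma alt_blocks W m a : (forall b, b \in m -> b \in bl /\ exists2 w, b.2 = [:: w] & W w) ->
  a \in S -> alt W (rcons (flat m) a).
Proof.
elim: m => [|b m IH] h aS; first exact: alt1.
have [bB [w bE Ww]] := h b (mem_head _ _).
rewrite flat_cons bE; apply: altS => //; first exact: (bk_in B).
  by apply: (bk_out B bB); rewrite bE inE.
by apply: IH => // b' b'm; apply: h; rewrite inE b'm orbT.
Qed.

Lemma bl_conf W b b' : b \in bl -> b' \in bl -> b != b' ->
  (forall b0, b0 \in bl -> b0 != b -> b0 != b' -> exists2 w, b0.2 = [:: w] & W w) ->
  exists P Q, [/\ lcycle X (P ++ b.2 ++ Q ++ b'.2), alt W P & alt W Q].
Proof.
move=> bB b'B bb' h; have [m [m' [B' p]]] := bk_two B bB b'B bb'.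
have [_ [_ [lc _ _ _]]] := bk_arcs B'.
have := bk_uniq B; rewrite (perm_uniq p) /= cat_uniq /= mem_cat inE !negb_or.
move=> /and5P[/and3P[bm _ bm'] _ /andP[b'm _] b'm' _].
have mem b0 : b0 \in m ++ m' -> b0 \in bl /\ exists2 w, b0.2 = [:: w] & W w.
  rewrite mem_cat => bmm; have b0B : b0 \in bl.
    by rewrite (perm_mem p) !(inE, mem_cat); case/orP: bmm => ->; rewrite ?orbT.
  split=> //; apply: h => //; apply/eqP => E; move: bmm; rewrite E.
    by rewrite (negPf bm) (negPf bm').
  by rewrite (negPf b'm) (negPf b'm').
exists (rcons (flat m') b.1), (rcons (flat m) b'.1); split=> //.
  by apply: alt_blocks; rewrite ?(bk_in B) // => b0 h0; apply: mem; rewrite mem_cat h0 orbT.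
by apply: alt_blocks; rewrite ?(bk_in B) // => b0 h0; apply: mem; rewrite mem_cat h0.
Qed.

(* Toughness for the set [S] with one more vertex [y], which cuts the interval
   [b] into two pieces told apart by [g]. *)
Lemma tough_mid b y z (g : T -> bool) : b \in bl -> y \in b.2 -> z \in b.2 ->
  z != y -> head y b.2 != y -> g z != g (head y b.2) ->
  exists u v L b1 b2, [/\ b1 \in bl, b2 \in bl, u \in b1.2, v \in b2.2 & u != y] /\
    [/\ v != y, b1 != b2 \/ b1 = b2 /\ g u != g v & olink u L v].
Proof.
move=> bB yb zb zy hy gz; pose hd (b0 : T * seq T) := head y b0.2.
have hdin b0 : b0 \in bl -> hd b0 \in b0.2.
  by move=> /bl_pos; rewrite /hd; case: b0.2 => //= r I _; rewrite mem_head.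
have ih : {in bl &, injective hd}.
  by move=> b1 b2 b1B b2B E; apply: (bk_own B b1B b2B (hdin b1 b1B)); rewrite E hdin.
have yX := bk_sub B bB yb; move: (yX); rewrite inE => /andP[yS yX'].
have hny b0 : b0 \in bl -> hd b0 != y.
  move=> b0B; have [->//|bb] := eqVneq b0 b; apply: contra bb => /eqP E.
  by apply/eqP; apply: (bk_own B b0B bB (z := y)); rewrite // -E hdin.
have zhd : z \notin [seq hd b0 | b0 <- bl].
  apply/negP => /mapP[b0 b0B zE]; have b0b : b0 = b.
    by apply: (bk_own B b0B bB (z := z)); rewrite // zE hdin.
  by move: gz; rewrite zE b0b eqxx.
have patt b1 b2 r r' : b1 \in bl -> b2 \in bl -> r \in b1.2 -> r' \in b2.2 ->
    pattern bl r = pattern bl r' -> b1 = b2.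
  by move=> b1B b2B r1 r2 /(patternP b1B r1) h; apply: (bk_own B b1B b2B h r2).
have [||||||u [v [L [[uX vX fuv luv uL] LX]]]] :=
    @es_tough _ _ _ _ G _ _ pH _ _ ES _ (fun r => (pattern bl r, g r))
      (y |: S) (z :: [seq hd b0 | b0 <- bl]).
- exact: subsetUr.
- by rewrite subUset sub1set yX' SsubX.
- by rewrite /= zhd map_inj_in_uniq // (bk_uniq B).
- by rewrite /= size_map sizebl cardsU1 yS; arith.
- move=> r; rewrite inE => /orP[/eqP->|/mapP[b0 b0B ->]]; rewrite in_setD in_setU1 negb_or.
    by rewrite zy -andbA; move: (bk_sub B bB zb); rewrite inE.
  by rewrite hny //= -in_setD (bk_sub B b0B) // hdin.
- move=> r r'; rewrite !inE => /orP[/eqP->|/mapP[b0 b0B ->]] /orP[/eqP->|/mapP[b1 b1B ->]] //.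
  + move=> [/(patt _ _ _ _ bB b1B zb (hdin _ b1B)) E gE].
    by move: gz; rewrite gE /hd -E eqxx.
  + move=> [/(patt _ _ _ _ b0B bB (hdin _ b0B) zb) E gE].
    by move: gz; rewrite -gE /hd E eqxx.
  + by move=> [/(patt _ _ _ _ b0B b1B (hdin _ b0B) (hdin _ b1B)) -> _].
move: uX vX; rewrite !in_setD !in_setU1 !negb_or -!andbA => /and3P[uy uS uX] /and3P[vy vS vX].
have uXS : u \in X :\: S by rewrite inE uS.
have vXS : v \in X :\: S by rewrite inE vS.
have [b1 b1B ub] := bk_find B uXS; have [b2 b2B vb] := bk_find B vXS.
exists u, v, L, b1, b2; split=> //; split=> //; last first.
  by split=> //; apply: bl_link_x uXS luv LX.
have [E|] := eqVneq b1 b2; [right; split=> // | by left].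
by apply: contra fuv => /eqP gE; rewrite (pattern_own B b1B ub (z' := v)) ?gE // E.
Qed.

Lemma size1 (s : seq T) w : size s = 1 -> w \in s -> s = [:: w].
Proof. by case: s => [|v []] //= _; rewrite inE => /eqP->. Qed.

(** An interval of one vertex offers nothing before or behind the end of the link, so the other
    interval must provide both. *)
Lemma single_link b b' u v L : b \in bl -> b' \in bl -> b != b' -> size b.2 = 1 ->
  u \in b.2 -> v \in b'.2 -> olink u L v ->
  exists J1 J2, [/\ b'.2 = J1 ++ v :: J2, size L < size J1 & size L < size J2].
Proof.
move=> bB b'B bb' s1 ub vb [l uL LX _].
have [I1 [I2 [J1 [J2 [bE b'E h1 h2]]]]] := bl_link bB b'B bb' ub vb l uL LX.
exists J1, J2; rewrite b'E; split=> //; move: s1; rewrite bE; move: h1 h2; szs.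
Qed.

Lemma big_link b b' u v L : b \in bl -> b' \in bl -> b != b' ->
  u \in b.2 -> v \in b'.2 -> olink u L v -> 2 * size L + 4 <= size b.2 + size b'.2.
Proof.
move=> bB b'B bb' ub vb [l uL LX _].
have [I1 [I2 [J1 [J2 [bE b'E h1 h2]]]]] := bl_link bB b'B bb' ub vb l uL LX.
by rewrite bE b'E; move: h1 h2; szs.
Qed.

Lemma tough_bl : exists b b' u v L,
  [/\ b \in bl, b' \in bl, b != b', u \in b.2 & v \in b'.2] /\ olink u L v.
Proof.
have [b [b' [I1 [u [I2 [J1 [v [J2 [L [[bB b'B bb' bE b'E] [l uL LX]]]]]]]]]]] :=
  es_tough_blocks G pH ES B.
have ub : u \in b.2 by rewrite bE mem_cat mem_head orbT.
exists b, b', u, v, L; split; first by rewrite b'E mem_cat mem_head orbT.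
by split=> //; apply: bl_link_x (bk_sub B bB ub) l LX.
Qed.

(** A link between two intervals must be an edge from a one-vertex interval to [v2]. Toughness for
    [S] with [v2] then links [v1] to [v3], and [reroute_middle_of_three] applies. *)
Lemma no_interval_of_size3 b : b \in bl -> size b.2 = 3 ->
  (forall b', b' \in bl -> b' != b -> size b'.2 = 1) -> False.
Proof.
move=> bB s3 s1.
have {s3} [v1 [v2 [v3 bE]]] : exists v1 v2 v3, b.2 = [:: v1; v2; v3].
  by case: b.2 s3 => [|v1 [|v2 [|v3 []]]] // _; exists v1, v2, v3.
have mid b1 b2 u v L : b1 \in bl -> b2 \in bl -> b1 != b2 -> u \in b1.2 -> v \in b2.2 ->
    olink u L v -> [/\ b1 = b, u = v2 & b2.2 = [:: v] /\ e v v2] \/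
    [/\ b2 = b, v = v2 & b1.2 = [:: u] /\ e u v2].
  have half b3 b4 y z M : b3 \in bl -> b4 \in bl -> b3 != b4 -> y \in b3.2 -> z \in b4.2 ->
      olink y M z -> b4 = b -> [/\ b4 = b, z = v2 & b3.2 = [:: y] /\ e y v2].
    move=> b3B b4B b34 yb zb o b4b; have s := s1 b3 b3B; rewrite -b4b in s.
    have [J1 [J2 [E]]] := single_link b3B b4B b34 (s b34) yb zb o.
    have := congr1 size E; rewrite b4b bE size_cat /= => sE h1 h2.
    have M0 : M = [::] by apply: size0nil; move: sE h1 h2; arith.
    have zE : z = v2.
      have {h1 h2 sE} : size J1 = 1 by move: sE h1 h2; arith.
      by case: J1 E => [|r []] //; rewrite b4b bE => -[].
    split=> //; split; first exact: size1 (s b34) yb.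
    by case: o; rewrite M0 linkE zE.
  move=> b1B b2B b12 ub vb o; have [E2|n2] := eqVneq b2 b; first by right; apply: half o E2.
  left; have [E1|n1] := eqVneq b1 b.
    by apply: (half b2 b1 v u (rev L)) => //; [rewrite eq_sym | apply: olink_sym].
  by have := big_link b1B b2B b12 ub vb o; rewrite !s1 //; arith.
have /and3P[v1n v2n _] : uniq [:: v1; v2; v3] by rewrite -bE; apply: bl_uniq.
move: v1n v2n; rewrite !inE negb_or => /andP[n12 n13] n23.
have [w [b0 [b0B b0b b0E wv2]]] : exists w b0, [/\ b0 \in bl, b0 != b, b0.2 = [:: w] & e w v2].
  have [b1 [b2 [u [v [L [[b1B b2B b12 ub vb] o]]]]]] := tough_bl.
  have [[E _ [bv ev]]|[E _ [bu eu]]] := mid _ _ _ _ _ b1B b2B b12 ub vb o.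
    by exists v, b2; split=> //; rewrite -E eq_sym.
  by exists u, b1; split=> //; rewrite -E.
have [P [Q [lc aP aQ]]] : exists P Q, [/\ lcycle X (P ++ b0.2 ++ Q ++ b.2), alt predT P & alt predT Q].
  apply: bl_conf => // b' b'B _ b'b; have := s1 b' b'B b'b.
  by case: b'.2 => [|r []] // _; exists r.
rewrite b0E bE in lc.
have [|||||u [v [L [b1 [b2 [[b1B b2B ub vb uy] [vy h o]]]]]]] :=
  @tough_mid b v2 v3 (fun r => r == v3) bB.
- by rewrite bE !inE eqxx orbT.
- by rewrite bE !inE eqxx !orbT.
- by rewrite eq_sym.
- by rewrite bE.
- by rewrite bE /= eqxx (negPf n13).
case: h => [b12|[E guv]].
  have [[_ uE _]|[_ vE _]] := mid _ _ _ _ _ b1B b2B b12 ub vb o.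
    by rewrite uE eqxx in uy.
  by rewrite vE eqxx in vy.
have [b1b|b1b] := eqVneq b1 b; last first.
  move: vb (s1 b1 b1B b1b) guv; rewrite -E; case: b1.2 ub => [|r []] //.
  by rewrite !inE => /eqP-> /eqP-> _; rewrite eqxx.
move: ub vb; rewrite -E b1b bE !inE (negPf uy) (negPf vy) /= => ub vb.
case/orP: ub => /eqP uE; case/orP: vb => /eqP vE; subst u v.
- by rewrite eqxx in guv.
- exact: reroute_middle_of_three lc (alt_arc aP) (alt_arc aQ) wv2 o.
- exact: reroute_middle_of_three lc (alt_arc aP) (alt_arc aQ) wv2 (olink_sym o).
- by rewrite eqxx in guv.
Qed.

(** Links between intervals are edges from a one-vertex interval to [v2] or [v3], say to [v2].
    Toughness for [S] with [v2] then provides one of the connections excluded by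
    [reroute_middle_of_four]. *)
Lemma no_interval_of_size4 b : b \in bl -> size b.2 = 4 ->
  (forall b', b' \in bl -> b' != b -> size b'.2 = 1) -> False.
Proof.
move=> bB s4 s1.
have no_mid v1 v2 v3 v4 b0 w : b.2 = [:: v1; v2; v3; v4] \/ b.2 = [:: v4; v3; v2; v1] ->
    b0 \in bl -> b0 != b -> b0.2 = [:: w] -> e w v2 -> False.
  move=> bE b0B b0b b0E wv2.
  have ub : uniq b.2 by apply: bl_uniq.
  have {ub} /and4P[v1n v2n v3n _] : uniq [:: v1; v2; v3; v4].
    by case: bE ub => -> //; rewrite -(rev_uniq [:: v1; v2; v3; v4]).
  move: v1n v2n v3n; rewrite !inE !negb_or => /and3P[n12 n13 n14] /andP[n23 n24] n34.
  have inb r : (r \in b.2) = [|| r == v1, r == v2, r == v3 | r == v4].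
    by case: bE => ->; rewrite !inE //; do 4 case: (r == _).
  have [P [Q [lc aP aQ]]] : exists P Q, [/\ lcycle X (P ++ [:: w] ++ Q ++ [:: v1; v2; v3; v4]),
      alt predT P & alt predT Q].
    have [P [Q [lc aP aQ]]] : exists P Q,
        [/\ lcycle X (P ++ b0.2 ++ Q ++ b.2), alt predT P & alt predT Q].
      apply: bl_conf => // b' b'B _ b'b; have := s1 b' b'B b'b.
      by case: b'.2 => [|r []] // _; exists r.
    rewrite b0E in lc; case: bE lc => -> lc; first by exists P, Q.
    exists (rev Q), (rev P); split; [exact: conf_rev lc | exact: alt_rev | exact: alt_rev].
  have [c1 c2 c3 c4] := reroute_middle_of_four lc aP aQ wv2.
  have hdb : head v2 b.2 = v1 \/ head v2 b.2 = v4 by case: bE => ->; [left | right].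
  (* [b] may list its interval in either direction, and [tough_mid] takes the head as one
     representative; [z] is the opposite end. *)
  pose z := if head v2 b.2 == v1 then v4 else v1.
  have [|||||u [v [L [b1 [b2 [[b1B b2B ub vb uy] [vy h o]]]]]]] :=
    @tough_mid b v2 z (fun r => r == v1) bB.
  - by rewrite inb eqxx orbT.
  - by rewrite inb /z; case: ifP; rewrite eqxx ?orbT.
  - by rewrite /z; case: ifP => _ //; rewrite eq_sym.
  - by case: hdb => -> //; rewrite eq_sym.
  - by rewrite /z; case: hdb => ->; rewrite ?eqxx // (eq_sym v4) (negPf n14) ?eqxx.
  have big b3 b4 y r M : b3 \in bl -> b4 \in bl -> b3 != b4 -> y \in b3.2 -> r \in b4.2 ->
      olink y M r -> b4 = b -> r = v2 \/ e y v3.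
    move=> b3B b4B b34 yb rb om b4b; have s := s1 b3 b3B; rewrite -b4b in s.
    have [J1 [J2 [E]]] := single_link b3B b4B b34 (s b34) yb rb om.
    have := congr1 size E; rewrite b4b s4 size_cat /= => sE h1 h2.
    have M0 : M = [::] by apply: size0nil; move: sE h1 h2; arith.
    have : r = v2 \/ r = v3.
      case: J1 E sE h1 h2 => [|j1 [|j2 [|j3 J1]]] E sE h1 h2;
        try (exfalso; move: sE h1 h2 => /=; arith).
        by move: E; rewrite b4b; case: bE => -> /= [_ <- _]; [left | right].
      by move: E; rewrite b4b; case: bE => -> /= [_ _ <- _]; [right | left].
    by case=> rE; [left | right; case: om; rewrite M0 linkE rE].
  have finish b3 b4 y r M : b3 \in bl -> b4 \in bl -> b3 != b4 -> y \in b3.2 -> r \in b4.2 ->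
      olink y M r -> b4 = b -> r <> v2 -> False.
    move=> b3B b4B b34 yb rb om b4b rv2; case: (big _ _ _ _ _ b3B b4B b34 yb rb om b4b) => // ev3.
    have yS : y \notin S := bk_out B b3B yb.
    have yX : y \in X by have := bk_sub B b3B yb; rewrite inE => /andP[].
    have [yw|yw] := eqVneq y w; first by apply: c3; rewrite -yw.
    apply: (c4 y) => //; have [_ _ _ sX] := lc; move: yX; rewrite -sX !mem_cat inE (negPf yw) /=.
    case/or3P=> [->//|->|yb']; first by rewrite orbT.
    have yb2 : y \in b.2 by rewrite inb; move: yb'; rewrite !inE.
    by move: b34; rewrite b4b (bk_own B b3B bB yb yb2) eqxx.
  case: h => [b12|[E guv]].
    have [b2b|b2b] := eqVneq b2 b.
      by apply: (finish _ _ _ _ _ b1B b2B b12 ub vb o b2b); apply/eqP.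
    have [b1b|b1b] := eqVneq b1 b.
      apply: (finish _ _ _ _ _ b2B b1B _ vb ub (olink_sym o) b1b); first by rewrite eq_sym.
      by apply/eqP.
    by have := big_link b1B b2B b12 ub vb o; rewrite !s1 //; arith.
  have [b1b|b1b] := eqVneq b1 b; last first.
    move: vb (s1 b1 b1B b1b) guv; rewrite -E; case: b1.2 ub => [|r []] //.
    by rewrite !inE => /eqP-> /eqP-> _; rewrite eqxx.
  move: ub vb; rewrite -E b1b !inb (negPf uy) (negPf vy) /= => ub vb.
  have os := olink_sym o.
  case/or3P: ub => /eqP uE; case/or3P: vb => /eqP vE; subst u v; rewrite ?eqxx in guv => //.
  - exact: c1 o.
  - exact: c2 o.
  - exact: c1 os.
  - by rewrite (eq_sym v3) (eq_sym v4) (negPf n13) (negPf n14) in guv.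
  - exact: c2 os.
  - by rewrite (eq_sym v3) (eq_sym v4) (negPf n13) (negPf n14) in guv.
have [v1 [v2 [v3 [v4 bE]]]] : exists v1 v2 v3 v4, b.2 = [:: v1; v2; v3; v4].
  by case: b.2 s4 => [|v1 [|v2 [|v3 [|v4 []]]]] // _; exists v1, v2, v3, v4.
have fin b3 y r M : b3 \in bl -> b3 != b -> y \in b3.2 -> r \in b.2 -> olink y M r -> False.
  move=> b3B b3b yb rb om; have s := s1 b3 b3B b3b.
  have [J1 [J2 [E]]] := single_link b3B bB b3b s yb rb om.
  have := congr1 size E; rewrite s4 size_cat /= => sE h1 h2.
  have M0 : M = [::] by apply: size0nil; move: sE h1 h2; arith.
  have er : e y r by case: om; rewrite M0 linkE.
  have [rE|rE] : r = v2 \/ r = v3.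
    case: J1 E sE h1 h2 => [|j1 [|j2 [|j3 J1]]] E sE h1 h2;
      try (exfalso; move: sE h1 h2 => /=; arith); move: E; rewrite bE.
      by move=> [_ <- _]; left.
    by move=> [_ _ <- _]; right.
  - by apply: (no_mid v1 v2 v3 v4 b3 y (or_introl bE) b3B b3b (size1 s yb)); rewrite -rE.
  - by apply: (no_mid v4 v3 v2 v1 b3 y (or_intror bE) b3B b3b (size1 s yb)); rewrite -rE.
have [b1 [b2 [u [v [L [[b1B b2B b12 ub vb] o]]]]]] := tough_bl.
have [b2b|b2b] := eqVneq b2 b.
  by move: b12 vb; rewrite b2b => b12 vb; apply: fin b1B b12 ub vb o.
have [b1b|b1b] := eqVneq b1 b.
  by move: ub; rewrite b1b => ub; apply: fin b2B b2b vb ub (olink_sym o).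
by have := big_link b1B b2B b12 ub vb o; rewrite !s1 //; arith.
Qed.

End FixedBlocks.
End SingleComponent.

(** * Configurations with two longer intervals *)

Section TwoIntervals.

Variables (T : finType) (e : rel T) (c d : nat).
Implicit Types (s t D L P Q R I J : seq T) (A B K : {set T}) (W : pred T).
Implicit Types (bl m : seq (T * seq T)) (b : T * seq T).
Hypothesis G : tough_ctx e c d.
Let esym := ctx_sym G.
Local Notation lcycle := (lcycle e c).
Variables (X S : {set T}) (x : T).
Hypotheses (pH : piece e (~: X) [set x]) (ES : ear_set e d X [set x] S 1).
Local Notation blocks := (blocks e c X S).
Local Notation full := (full e S).
Local Notation alt := (alt S).
Local Notation olink := (olink e X x).
Local Notation Sarc := (Sarc e S).
Local Notation too_longx := (@too_longx T e c d G X x pH).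

Lemma reroute_split_link P u1 u2 Q v1 v2 v3 L : lcycle X (P ++ [:: u1; u2] ++ Q ++ [:: v1; v2; v3]) ->
  Sarc P -> Sarc Q -> e u1 v2 -> olink v1 L v3 -> False.
Proof.
move=> lc aP aQ uv [l uL LX xL].
have [p [p' [i [i' [q [q' [j [j' [[wP wI wQ wJ] [[e1 e2 e3 e4] [[xp xp' xq xq'] _]]]]]]]]]]] :=
  conf_facts G ES lc aP aQ isT isT.
have [iE i'E u12] := walk_lit2 wI; have [jE j'E v12 v23] := walk_lit3 wJ; subst.
apply: (@too_longx _ L (rev P ++ v3 :: rev L ++ v1 :: v2 :: u1 :: u2 :: Q ++ [:: x])
  p' x lc uL LX xL); [wk | edge | cnt | szs].
Qed.

Lemma reroute_crossing_edges P u1 u2 Q J j j' : lcycle X (P ++ [:: u1; u2] ++ Q ++ J) ->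
  Sarc P -> Sarc Q -> walk e J j j' -> e u2 j -> e u1 j' -> False.
Proof.
move=> lc aP aQ wJ' e5 e6.
have [p [p' [i [i' [q [q' [j1 [j1' [[wP wI wQ wJ] [[e1 e2 e3 e4] [[xp xp' xq xq'] _]]]]]]]]]]] :=
  conf_facts G ES lc aP aQ isT (walk_size wJ').
have [iE i'E u12] := walk_lit2 wI; subst; clear wJ.
apply: (@too_longx _ [::] (x :: rev Q ++ u2 :: J ++ u1 :: rev P) x p lc) => //;
  [wk | edge | cnt | szs].
Qed.

Lemma reroute_single_to_middle W P u1 u2 Q v1 v2 v3 w : lcycle X (P ++ [:: u1; u2] ++ Q ++ [:: v1; v2; v3]) ->
  alt W P -> alt W Q -> e u1 v3 -> w \in P ++ Q -> w \notin S -> e w v2 -> False.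
Proof.
move=> lc aP aQ uv wPQ wS wv.
have [p [p' [i [i' [q [q' [j [j' [[wP wI wQ wJ] [[e1 e2 e3 e4] [[xp xp' xq xq'] _]]]]]]]]]]] :=
  conf_facts G ES lc (alt_arc e aP) (alt_arc e aQ) isT isT.
have [iE i'E u12] := walk_lit2 wI; have [jE j'E v12 v23] := walk_lit3 wJ; subst.
move: wPQ; rewrite mem_cat => /orP[w'P|w'Q].
  have [Y [Z [PE aY aZ _]]] := alt_split aP w'P wS; subst P.
  have [y [z [wY wZ ez]]] := walk_cat_inv wP (alt_size aY) isT.
  have [z' [zE ez' wZ']] := walk_cons_inv wZ (alt_size aZ); subst.
  have [_ yS] := alt_ends aY wY; have xy := xS G ES yS.
  apply: (@too_longx _ [::] (rev Y ++ v3 :: u1 :: u2 :: Q ++ v1 :: v2 :: z :: Z ++ [:: x])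
    y x lc) => //; [wk | cnt | szs].
have [Y [Z [QE aY aZ _]]] := alt_split aQ w'Q wS; subst Q.
have [y [z [wY wZ ez]]] := walk_cat_inv wQ (alt_size aY) isT.
have [z' [zE ez' wZ']] := walk_cons_inv wZ (alt_size aZ); subst.
have [z'S _] := alt_ends aZ wZ'; have xz := xS G ES z'S.
apply: (@too_longx _ [::] (rev P ++ v3 :: u1 :: u2 :: Y ++ z :: v2 :: v1 :: rev Z ++ [:: x])
    p' x lc) => //; [wk | cnt | szs].
Qed.

(* The cycle through [Q], [J] and the edge from [u1] to the end of [J] omits only
   [P]; a full vertex [w] on [Q] and [x] glue it to [P]. *)
Lemma reroute_full_vertex P u1 u2 Qa w Qb J j j' : lcycle X (P ++ [:: u1; u2] ++ (Qa ++ w :: Qb) ++ J) ->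
  Sarc P -> Sarc Qa -> Sarc Qb -> full w -> walk e J j j' -> e u1 j' -> False.
Proof.
move=> lc aP aQa aQb fw wJ' e6.
have aQ : Sarc (Qa ++ w :: Qb).
  split=> [|q q' w']; first by szs.
  have [y [z [wY wZ ez]]] := walk_cat_inv w' (proj1 aQa) isT.
  have [z' [zE ez' wZ']] := walk_cons_inv wZ (proj1 aQb).
  by have [? _] := proj2 aQa _ _ wY; have [_ ?] := proj2 aQb _ _ wZ'.
have [p [p' [i [i' [q [q' [j1 [j1' [[wP wI wQ wJ] [[e1 e2 e3 e4] [[xp xp' xq xq'] [pS p'S _ _]]]]]]]]]]]] :=
  conf_facts G ES lc aP aQ isT (walk_size wJ').
have [iE i'E u12] := walk_lit2 wI; subst.
have [y [z [wY wZ ez]]] := walk_cat_inv wQ (proj1 aQa) isT.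
have [z' [zE ez' wZ']] := walk_cons_inv wZ (proj1 aQb); subst.
have [_ yS] := proj2 aQa _ _ wY; have xy := xS G ES yS.
have [j1E j1'E] : j1 = j /\ j1' = j'.
  by rewrite -(walk_head x wJ) -(walk_lastE x wJ) (walk_head x wJ') (walk_lastE x wJ').
subst; have zp' := fullP fw p'S.
apply: (@too_longx _ [::] (Qb ++ J ++ u1 :: u2 :: Qa ++ x :: P ++ [:: z]) z' z lc) => //;
  [wk | cnt | szs].
Qed.

(** [N] and [P] divide the cycle, and [Q] traverses [P] anew from the entrance [a]. As [y] and [q]
    lie in [S], the vertex [x] closes the new cycle. *)
Lemma reroute_two_walks s N P Q y y' a q L : lcycle X s -> perm_eq (N ++ P) s ->
  walk e N y y' -> y \in S -> olink y' L a -> walk e Q a q -> q \in S -> perm_eq Q P -> False.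
Proof.
move=> lc NPs wN yS [l uL LX xL] wQ qS QP; have xy := xS G ES yS; have xq := xS G ES qS.
apply: (@too_longx _ L (N ++ L ++ Q ++ [:: x]) y x lc uL LX xL) => //.
- wk.
- move=> v; have /permP/(_ (pred1 v)) := NPs; have /permP/(_ (pred1 v)) := QP.
  by rewrite !count_cat /= => -> <-; arith.
- by rewrite -(perm_size NPs) !size_cat (perm_size QP) /=; arith.
Qed.

(** A nonempty link could be inserted between the two consecutive vertices. *)
Lemma olink_adj P (a b : T) Q L : lcycle X (P ++ a :: b :: Q) -> olink a L b -> L = [::].
Proof.
move=> lc [l uL LX _]; apply: size0nil; apply/eqP; rewrite -leqn0.
apply: (gap G (X := X) (a := a) (I := [::]) (b := b) (J := Q ++ P)) => //.
exact: (lcycle_rot (s := P) lc).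
Qed.

(** Links take the place of neighbours. If [u] has a neighbour in a component with [q] vertices off
    the cycle, then for [q = 1] this component has [d] attachments, too many to lie all in [D2] or
    at [u]; for [q > 1] any other attachment gives a link too long to end in [D]. Otherwise the
    degree of [u] decides. *)
Lemma other_link u D D2 : u \in X :\: S -> count (e u) D < d ->
  (forall v L, v \in D -> olink u L v -> 1 < size L -> False) ->
  (forall v L, v \in D -> v \notin D2 -> olink u L v -> L = [::]) -> size D2 + 1 < d ->
  (exists s, lcycle X s) ->
  exists v L, [/\ v \in X, v \notin D, v != u & olink u L v].
Proof.
move=> uXS cD h1 h2 sD2 [s lc]; move: (uXS); rewrite inE => /andP[uS uX].
have [[k [kX uk]]|allX] := classic (exists k, k \notin X /\ e u k).
  have kX' : k \in ~: X by rewrite inE.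
  have [K [pK kK]] := piece_exists esym kX'.
  have [S' [q ES']] := ear_set_exists G lc pK.
  have uS' : u \in S' by apply: (es_nb ES' kK uX); rewrite esym.
  have [dE _ _] := es_bounds G lc pK ES'.
  have ear v : v \in S' -> v != u -> exists2 L, olink u L v & size L = q.
    move=> vS' vu; have [|P [[_ _ _ l [uP PK _]] sP]] := es_ear ES' uS' vS'; first by rewrite eq_sym.
    have PX z : z \in P -> z \notin X by move=> /PK; exact: (comp_out pK).
    exists P => //; split=> //; exact: (bl_link_x G pH ES uXS l PX).
  have [q1|q1] := leqP q 1.
    have [v vS' vn] : exists2 v, v \in S' & v \notin u :: D2.
      apply: NNPP => no; have : #|S'| <= size (u :: D2).
        by apply: card_le_size => v vS'; apply: contraT => vn; case: no; exists v.
      by move: dE q1 sD2 (es_pos ES') => /=; arith.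
    move: vn; rewrite inE negb_or => /andP[vu vD2].
    have [L o sL] := ear v vS' vu; exists v, L; split=> //; first exact: (subsetP (es_sub ES') _ vS').
    apply/negP => vD; have := h2 _ _ vD vD2 o; have := es_pos ES'; rewrite -sL.
    by move=> + E; rewrite E.
  have [v [vS' vu]] : exists v, v \in S' /\ v != u.
    have /card_gt1P [a [b [aS bS ab]]] := es_two ES'.
    have [au|au] := eqVneq a u; last by exists a.
    by exists b; rewrite -au eq_sym.
  have [L o sL] := ear v vS' vu; exists v, L; split=> //; first exact: (subsetP (es_sub ES') _ vS').
  by apply/negP => vD; apply: (h1 _ _ vD o); rewrite sL.
have [v uv vD] : exists2 v, e u v & v \notin D.
  apply: NNPP => no; suff : d <= count (e u) D by rewrite leqNgt cD.
  apply: leq_trans (ctx_deg G u) _; rewrite -size_filter; apply: card_le_size => v.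
  rewrite inE mem_filter => uv; rewrite uv; apply: contraT => vD; case: no; by exists v.
exists v, [::]; split=> //; last exact: olink_edge.
  by apply: contraT => vX; case: allX; exists v.
by apply: contraTneq uv => ->; rewrite (ctx_irr G).
Qed.

Section FixedBlocks.

Variable bl : seq (T * seq T).
Hypothesis B : blocks bl.

(* A vertex forming an interval by itself can trade places with [x]. *)
Lemma single_nb b w : b \in bl -> b.2 = [:: w] ->
  exists S' : {set T}, [/\ S' \subset X, #|S'| = d & forall v, e w v = (v \in S')].
Proof.
move=> bB bE; have sz := bk_size B (SsubX ES).
have [b' [J [lc' bS b'S]]] : exists b' J,
    [/\ lcycle X (b.1 :: [:: w] ++ b'.1 :: J), b.1 \in S & b'.1 \in S].
  have s2 : 1 < size bl by rewrite sz; apply: es_two ES.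
  move: bB s2 => /splitPr bB; case: bB B => p1 p2 BB s2.
  have [lc i _] := blocks_rot BB.
  case E: (p2 ++ p1) => [|b' m]; first by move: s2 (congr1 size E); rewrite !size_cat /=; arith.
  rewrite /= E in lc i; rewrite flat_cons bE flat_cons in lc.
  exists b', (b'.2 ++ flat m); split=> //; apply: i; rewrite !inE eqxx ?orbT //.
have wXS : w \in X :\: S by apply: (bk_sub B bB); rewrite bE inE.
move: (wXS); rewrite inE => /andP[wS wX].
have [cs us ss sX] := lc'.
have xX := xX pH.
have xb := xS G ES bS; have xb' := xS G ES b'S.
pose X' := x |: (X :\ w).
have xw : x != w by apply: contraNneq xX => ->.
have lcx : lcycle X' (b.1 :: [:: x] ++ b'.1 :: J).
  split=> //.
  - by move: cs => /= /and3P[_ _ ->]; rewrite esym xb xb'.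
  - move: us xX; rewrite -sX /= !inE !negb_or.
    move=> /and3P[/and3P[_ -> ->] _ /andP[-> ->]] /and4P[xb1 _ -> ->].
    by rewrite eq_sym xb1.
  move=> v; have : count_mem v (b.1 :: [:: w] ++ b'.1 :: J) = (v \in X).
    by rewrite count_uniq_mem // sX.
  rewrite -count_gt0 /= !inE; have [->|vx] := eqVneq v x => /=.
    by rewrite ?eqxx => _; rewrite addnCA.
  have [->|vw] := eqVneq v w => /=.
    by rewrite ?eqxx wX ?(negPf xw) => h; apply/negbTE; rewrite -leqNgt; move: h => /=; arith.
  by rewrite ?(eq_sym x) ?(negPf vx) ?(eq_sym w) ?(negPf vw) => ->; case: (v \in X).
have wX' : w \in ~: X' by rewrite !inE eqxx negb_or eq_sym xw.
have [H' [pH' wH']] := piece_exists esym wX'.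
have [S' [q ES']] := ear_set_exists G lcx pH'.
have [cb cb'] : e w b.1 /\ e w b'.1 by move: cs => /= /and3P[h1 h2 _]; rewrite esym.
have bX' : b.1 \in X' by have [_ _ _ <-] := lcx; rewrite inE eqxx.
have b'X' : b'.1 \in X' by have [_ _ _ <-] := lcx; rewrite !inE eqxx !orbT.
(* On the new cycle the attachments [b.1] and [b'.1] of [w] enclose only [x], so the gap between
   them allows no larger [q]. *)
have q1 : q = 1.
  have := es_gapped G pH' ES' (es_nb ES' wH' bX' cb) (es_nb ES' wH' b'X' cb') lcx.
  by have := es_pos ES'; rewrite /=; arith.
have HE : H' = [set w].
  apply/eqP; rewrite eq_sym eqEcard sub1set wH' cards1.
  by rewrite (es_card ES') q1.
rewrite q1 HE in ES' pH' *.
have [dE _ _] := es_bounds G lcx pH' ES'.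
have nbw v : e w v = (v \in S').
  by apply/idP/idP => h; [exact: (xnb G pH' ES' h) | exact: (xS G ES' h)].
exists S'; split=> //; last by move: dE; arith.
apply/subsetP => v vS'; have := subsetP (es_sub ES') _ vS'.
rewrite !inE => /orP[/eqP vx|/andP[]//].
by move: vS'; rewrite -nbw vx esym => /(xnb G pH ES); rewrite (negPf wS).
Qed.

(** [single_nb] gives [w] exactly [d] neighbours, here all in [S], and [|S| = d]. *)
Lemma single_full b w : b \in bl -> b.2 = [:: w] ->
  (forall v, v \in X :\: S -> e w v -> False) -> full w.
Proof.
move=> bB bE nw; have [S' [S'X dE nb]] := single_nb bB bE.
have [s lc] : exists s, lcycle X s by exists (flat bl); apply: bk_lc B.
have [dS _ _] := es_bounds G lc pH ES.
have S'S : S' \subset S.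
  apply/subsetP => v vS'; apply: contraT => vS; case: (nw v).
    by rewrite inE vS (subsetP S'X).
  by rewrite nb.
have SE : S' = S by apply/eqP; rewrite eqEcard S'S dE; move: dS; arith.
by apply/forallP => a; apply/implyP; rewrite -SE -nb.
Qed.

(** A link from a one-vertex interval ends strictly inside an interval of at least three vertices,
    so here [w] has no neighbour in another interval. *)
Lemma short_full b : (forall b0, b0 \in bl -> size b0.2 <= 2) -> b \in bl -> size b.2 = 1 ->
  exists2 w, b.2 = [:: w] & full w.
Proof.
move=> short bB s1; have [w bE] : exists w, b.2 = [:: w].
  by case: b.2 s1 => [|w []] // _; exists w.
exists w => //; apply: (single_full bB bE) => v vXS wv.
have [b0 b0B vb0] := bk_find B vXS.
have wb : w \in b.2 by rewrite bE inE.
have bb0 : b != b0.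
  apply/eqP => E; move: vb0; rewrite -E bE inE => /eqP vw.
  by move: wv; rewrite vw (ctx_irr G).
have [J1 [J2 [E h1 h2]]] := single_link G pH ES B bB b0B bb0 s1 wb vb0 (olink_edge X x wv).
by have := short b0 b0B; rewrite E; move: h1 h2; szs.
Qed.

End FixedBlocks.
End TwoIntervals.

(** * Intervals of sizes two and three *)

Section IntervalTypes.

Variables (T : finType) (e : rel T) (c d : nat).
Implicit Types (s t D L P Q R I J M : seq T) (A B K : {set T}) (W : pred T).
Implicit Types (bl m : seq (T * seq T)) (b : T * seq T).
Hypothesis G : tough_ctx e c d.
Let esym := ctx_sym G.
Local Notation lcycle := (lcycle e c).
Variables (X S : {set T}) (x : T).
Hypotheses (pH : piece e (~: X) [set x]) (ES : ear_set e d X [set x] S 1).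
Local Notation blocks := (blocks e c X S).
Local Notation full := (full e S).
Local Notation alt := (alt S).
Local Notation olink := (olink e X x).
Local Notation Sarc := (Sarc e S).
Variable bl : seq (T * seq T).
Hypothesis B : blocks bl.

Lemma Sarc_walk P p p' : walk e P p p' -> p \in S -> p' \in S -> Sarc P.
Proof.
move=> w pS p'S; split=> [|r r' w']; first exact: (walk_size w).
by rewrite -(walk_head p w') (walk_head p w) -(walk_lastE p w') (walk_lastE p w).
Qed.

Lemma bl_arcs b b' : b \in bl -> b' \in bl -> b != b' ->
  exists P Q, [/\ lcycle X (P ++ b.2 ++ Q ++ b'.2), Sarc P & Sarc Q].
Proof.
move=> bB b'B bb'; have [m [m' [B' _]]] := bk_two B bB b'B bb'.
have [p1 [p2 [lc w1 w2 [p1S p2S _ _]]]] := bk_arcs B'.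
exists (rcons (flat m') b.1), (rcons (flat m) b'.1); split=> //.
  by apply: Sarc_walk w2 p2S _; apply: bk_in B _ bB.
by apply: Sarc_walk w1 p1S _; apply: bk_in B _ b'B.
Qed.

Lemma adj_only u v w L P Q : lcycle X (P ++ u :: v :: w :: Q) -> 
  olink v L u \/ olink v L w -> L = [::].
Proof.
move=> lc [/(olink_sym G)|] o.
  by have := olink_adj G lc o; move/(congr1 size); rewrite size_rev => /size0nil.
by apply: (olink_adj (P := rcons P u) (Q := Q) G) o; rewrite cat_rcons.
Qed.

Lemma other_link2 u v w P Q : lcycle X (P ++ u :: v :: w :: Q) -> v \in X :\: S -> 2 < d ->
  exists r L, [/\ r \in X, r != u, r != w, r != v & olink v L r].
Proof.
move=> lc vXS d3; have [|||||r [L [rX rD rv o]]] :=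
    @other_link _ _ _ _ G _ _ _ pH ES v [:: u; w] [::] vXS.
- by apply: leq_ltn_trans (count_size _ _) _.
- move=> r L; rewrite !inE => /orP[]/eqP-> o; rewrite (adj_only lc (L := L)) //; [by left | by right].
- move=> r L; rewrite !inE => /orP[]/eqP-> _ o; apply: (adj_only lc (L := L)); [by left | by right].
- by rewrite /=; arith.
- by exists (P ++ u :: v :: w :: Q).
by move: rD; rewrite !inE negb_or => /andP[ru rw]; exists r, L.
Qed.

Lemma lc_mem s v : lcycle X s -> (v \in s) = (v \in X).
Proof. by case. Qed.

Lemma bl_inS b v : b \in bl -> v \in b.2 -> v \notin S.
Proof. exact: (bk_out B). Qed.

Section TwoThree.

Variables b b' : T * seq T.
Hypotheses (bB : b \in bl) (b'B : b' \in bl) (s2 : size b.2 = 2) (s3 : size b'.2 = 3).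
Hypothesis s1 : forall b0, b0 \in bl -> b0 != b -> b0 != b' -> size b0.2 = 1.

Let bb' : b != b'. Proof. by apply/eqP => E; move: s2; rewrite E s3. Qed.

(** The two cases are the two directions of the cycle; arguments that are symmetric under reversal
    are then given once. *)
Definition oriented23 u1 u2 v1 v2 v3 :=
  (b.2 = [:: u1; u2] /\ b'.2 = [:: v1; v2; v3]) \/
  (b.2 = [:: u2; u1] /\ b'.2 = [:: v3; v2; v1]).

Let pair23 u1 u2 v1 v2 v3 (y r : T) :=
  [\/ y = u1 /\ r = v2, y = u1 /\ r = v3, y = u2 /\ r = v1 | y = u2 /\ r = v2].

Let conf23 W u1 u2 v1 v2 v3 : oriented23 u1 u2 v1 v2 v3 ->
  (forall b0, b0 \in bl -> b0 != b -> b0 != b' -> exists2 w, b0.2 = [:: w] & W w) ->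
  exists P Q, [/\ lcycle X (P ++ [:: u1; u2] ++ Q ++ [:: v1; v2; v3]), alt W P & alt W Q].
Proof.
move=> O h; have [P [Q [lc aP aQ]]] := bl_conf B bB b'B bb' h.
case: O => -[E E']; rewrite E E' in lc; first by exists P, Q.
by exists (rev Q), (rev P); split; [exact: (conf_rev G lc) | exact: alt_rev | exact: alt_rev].
Qed.

(** The length rule with [q = 1] leaves no room for inner vertices of a link and fixes the positions
    of its ends. *)
Let links23 u1 u2 v1 v2 v3 b1 b2 y r M : oriented23 u1 u2 v1 v2 v3 ->
  b1 \in bl -> b2 \in bl -> b1 != b2 -> y \in b1.2 -> r \in b2.2 -> olink y M r ->
  M = [::] /\ [\/ [/\ b1 = b, b2 = b' & pair23 u1 u2 v1 v2 v3 y r],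
                  [/\ b1 = b', b2 = b & pair23 u1 u2 v1 v2 v3 r y],
                  [/\ b1.2 = [:: y], b2 = b' & r = v2] |
                  [/\ b2.2 = [:: r], b1 = b' & y = v2]].
Proof.
move=> O.
have half b3 b4 z z' N : b3 \in bl -> b4 \in bl -> b3 != b4 -> z \in b3.2 -> z' \in b4.2 ->
    olink z N z' -> b4 = b' -> N = [::] /\ ((b3 = b /\ pair23 u1 u2 v1 v2 v3 z z') \/
      (b3.2 = [:: z] /\ z' = v2)).
  move=> b3B b4B b34 zb tb o b4b; rewrite b4b in b4B b34 tb.
  have [l uN NX _] := o.
  have [I1 [I2 [J1 [J2 [E E' h1 h2]]]]] := bl_link G pH ES B b3B b4B b34 zb tb l uN NX.
  have := congr1 size E'; rewrite s3 size_cat /= => sJ.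
  have [b3b|b3b] := eqVneq b3 b.
    rewrite b3b in E; have := congr1 size E; rewrite s2 size_cat /= => sI.
    split; first by apply: size0nil; move: sJ sI h1 h2; arith.
    left; split=> //; rewrite /pair23.
    case: I1 E sI h1 => [|i1 [|i2 I1]] E sI h1; last by move: sI => /=; arith.
    - case: I2 E sI h2 => [|i3 [|i4 I2]] E sI h2; try by move: sI => /=; arith.
      case: J1 E' sJ h1 => [|j1 [|j2 [|j3 J1]]] E' sJ h1; try by move: sJ h1 => /=; arith.
      + case: J2 E' sJ h2 => [|j3 [|j4 J2]] E' sJ h2; try by move: sJ => /=; arith.
        by move: E E'; case: O => -[-> ->] [-> _] [_ -> _]; [constructor 1 | constructor 4].
      + case: J2 E' sJ h2 => [|j3 J2] E' sJ h2; last by move: sJ => /=; arith.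
        by move: E E'; case: O => -[-> ->] [-> _] [_ _ ->]; [constructor 2 | constructor 3].
    - case: I2 E sI h2 => [|i3 I2] E sI h2; last by move: sI => /=; arith.
      case: J1 E' sJ h1 => [|j1 [|j2 J1]] E' sJ h1; last by move: sJ h2 => /=; arith.
      + case: J2 E' sJ h2 => [|j3 [|j4 [|j5 J2]]] E' sJ h2; try by move: sJ => /=; arith.
        by move: E E'; case: O => -[-> ->] [_ ->] [-> _ _]; [constructor 3 | constructor 2].
      + case: J2 E' sJ h2 => [|j3 [|j4 J2]] E' sJ h2; try by move: sJ => /=; arith.
        by move: E E'; case: O => -[-> ->] [_ ->] [_ -> _]; [constructor 4 | constructor 1].
  have s := s1 b3B b3b b34; have b3E := size1 s zb.
  have := congr1 size E; rewrite s size_cat /= => sI.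
  split; first by apply: size0nil; move: sJ sI h1 h2; arith.
  right; split=> //.
  case: J1 E' sJ h1 => [|j1 [|j2 J1]] E' sJ h1; try by move: sI sJ h1 h2 => /=; arith.
  by move: E'; case: O => -[_ ->] [_ -> _].
move=> b1B b2B b12 yb rb o; have [E2|n2] := eqVneq b2 b'.
  have [-> h] := half _ _ _ _ _ b1B b2B b12 yb rb o E2; split=> //.
  by case: h => [[? ?]|[? ?]]; [constructor 1 | constructor 3].
have [E1|n1] := eqVneq b1 b'.
  have b21 : b2 != b1 by rewrite eq_sym.
  have [M0 h] := half _ _ _ _ _ b2B b1B b21 rb yb (olink_sym G o) E1; split.
    by apply: size0nil; rewrite -size_rev M0.
  by case: h => [[? ?]|[? ?]]; [constructor 2 | constructor 4].
have le2 b0 : b0 \in bl -> b0 != b' -> size b0.2 <= 1 \/ b0 = b.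
  by move=> b0B nb'; have [->|nb] := eqVneq b0 b; [right | left; rewrite s1].
exfalso; have := big_link G pH ES B b1B b2B b12 yb rb o.
case: (le2 b1 b1B n1) => [h1|E1]; case: (le2 b2 b2B n2) => [h2|E2]; try by move: h1 h2; arith.
- by move: h1; rewrite E2 s2; arith.
- by move: h2; rewrite E1 s2; arith.
- by move: b12; rewrite E1 E2 eqxx.
Qed.

Let mem23 u1 u2 v1 v2 v3 : oriented23 u1 u2 v1 v2 v3 ->
  b.2 =i [:: u1; u2] /\ b'.2 =i [:: v1; v2; v3].
Proof.
case=> -[-> ->]; split=> // v; rewrite !inE; first by rewrite orbC.
by case: (v == v1); case: (v == v2); case: (v == v3).
Qed.

(** Given the edge, no one-vertex interval sends an edge to [v2], so these vertices are full; hence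
    none lies on [Q], which shrinks to one vertex. As [d > 2], both [u2] and [v1] have a further
    link. That of [u2] can only be an edge to [v2], and then that of [v1] has nowhere to end. *)
Let no_outer_edge23 u1 u2 v1 v2 v3 : 2 < d -> oriented23 u1 u2 v1 v2 v3 -> e u1 v3 -> False.
Proof.
move=> d3 O e13; have [mb mb'] := mem23 O.
have single b0 : b0 \in bl -> b0 != b -> b0 != b' -> exists2 w, b0.2 = [:: w] & predT w.
  by move=> b0B n n'; have := s1 b0B n n'; case: b0.2 => [|w []] // _; exists w.
have [P0 [Q0 [lc0 aP0 aQ0]]] := conf23 O single.
have inPQ w b0 : b0 \in bl -> b0 != b -> b0 != b' -> w \in b0.2 -> w \in P0 ++ Q0.
  move=> b0B n n' wb; have wX := bk_sub B b0B wb.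
  have : w \in X by move: wX; rewrite inE => /andP[].
  rewrite -(lc_mem _ lc0) !mem_cat -mb -mb'.
  have -> : (w \in b.2) = false by apply: contraNF n => h; rewrite (bk_own B b0B bB wb h).
  have -> : (w \in b'.2) = false by apply: contraNF n' => h; rewrite (bk_own B b0B b'B wb h).
  by rewrite /= orbF.
have fsingle b0 : b0 \in bl -> b0 != b -> b0 != b' -> exists2 w, b0.2 = [:: w] & full w.
  move=> b0B n n'; have [w b0E _] := single b0 b0B n n'; exists w => //.
  apply: (single_full G pH ES B b0B b0E) => v vX wv; have [b2 b2B vb] := bk_find B vX.
  have wb : w \in b0.2 by rewrite b0E inE.
  have b02 : b0 != b2.
    apply/eqP => E; move: vb; rewrite -E b0E inE => /eqP vw.
    by move: wv; rewrite vw (ctx_irr G).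
  have [_ h] := links23 O b0B b2B b02 wb vb (olink_edge X x wv).
  case: h => [[E _ _]|[E _ _]|[_ _ E]|[_ E _]]; try by rewrite E eqxx in n n'.
  by apply: (reroute_single_to_middle G pH ES lc0 aP0 aQ0 e13 (inPQ _ _ b0B n n' wb) (bl_inS b0B wb)); rewrite -E.
have [P [Q [lc aP aQ]]] := conf23 O fsingle.
have [p [p' [i [i' [q [q' [j [j' [[wP wI wQ wJ] [[e1 e2 e3 e4] [_ [pS p'S qS q'S]]]]]]]]]]]] :=
  conf_facts G ES lc (alt_arc e aP) (alt_arc e aQ) isT isT.
have [iE i'E u12] := walk_lit2 wI; have [jE j'E v12 v23] := walk_lit3 wJ; subst i i' j j'.
have nB : ~ e u2 v1.
  by move=> e21; apply: (reroute_crossing_edges G pH ES lc (alt_arc e aP) (alt_arc e aQ) wJ e21 e13).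
case: (alt_single aQ) => [[s2' s2S QE]|[a [w [Q' [QE aS fw wS aQ']]]]]; last first.
  apply: (reroute_full_vertex G pH ES (u1 := u1) (u2 := u2) (Qa := [:: a]) (w := w) (Qb := Q') _ (alt_arc e aP) _ _ fw wJ e13).
  - by move: lc; rewrite QE.
  - by apply: (alt_arc e (W := full)); apply: alt1.
  - exact: (alt_arc e aQ').
have [qE q'E] : q = s2' /\ q' = s2' by move: wQ; rewrite QE => /walk_lit1.
subst q q' Q.
have bX r : r \in b.2 -> r \in X :\: S by exact: (bk_sub B bB).
have b'X r : r \in b'.2 -> r \in X :\: S by exact: (bk_sub B b'B).
have ub : u2 \in b.2 by rewrite mb !inE eqxx orbT.
have vb : v1 \in b'.2 by rewrite mb' !inE eqxx.
have inP r : r \in X -> r \in S -> r != s2' -> r \in P.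
  move=> rX rS rs; move: rX; rewrite -(lc_mem _ lc) !mem_cat -mb -mb' inE (negPf rs).
  have -> : (r \in b.2) = false by apply: contraTF rS => h; exact: (bl_inS bB h).
  have -> : (r \in b'.2) = false by apply: contraTF rS => h; exact: (bl_inS b'B h).
  by rewrite !orbF.
(* All one-vertex intervals on [P] are full, so [P] can be traversed from any of its vertices in
   [S]. A link to such a vertex from the end of a walk over the rest closes a longer cycle. *)
have cover N y y' r L : walk e N y y' -> y \in S -> perm_eq (N ++ P)
    (P ++ [:: u1; u2] ++ [:: s2'] ++ [:: v1; v2; v3]) -> r \in P -> r \in S -> olink y' L r -> False.
  move=> wN yS NP rP rS o; have wP' : walk e (P ++ [::]) p p' by rewrite cats0.
  have [R [t [wR tS RP]]] := alt_cover esym aP wP' p'S rP rS.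
  by rewrite cats0 in RP; apply: (reroute_two_walks G pH ES lc NP wN yS o wR tS RP).
have e22 : e u2 v2.
  have [r [L [rX ru rs2 ru2 o]]] := other_link2 (u := u1) (v := u2) (w := s2') lc (bX _ ub) d3.
  have [rS|rS] := boolP (r \in S).
    have w1 : walk e [:: s2'; v1; v2; v3; u1; u2] s2' u2.
      by rewrite /= !eqxx e3 v12 v23 u12 esym e13.
    exfalso; apply: (cover _ _ _ _ _ w1 s2S _ (inP _ rX rS rs2) rS o).
    by apply/permP => f; do 4 rewrite ?count_cat /=; arith.
  have rXS : r \in X :\: S by rewrite inE rS.
  have [b2 b2B rb] := bk_find B rXS.
  have [b2b|b2b] := eqVneq b b2.
    by move: rb; rewrite -b2b mb !inE (negPf ru) (negPf ru2).
  have [M0 h] := links23 O bB b2B b2b ub rb o; have e2r : e u2 r.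
    by case: o; rewrite M0 linkE.
  case: h => [[_ _ h]|[E _ _]|[E _ _]|[_ E _]]; try by move: bb'; rewrite E eqxx.
    case: h => -[h1 h2]; rewrite ?h2 in e2r => //.
    by move: u12; rewrite h1 (ctx_irr G).
  by move: s2; rewrite E.
have [r [L [rX rs rv2 rv1 o]]] : exists r L, [/\ r \in X, r != s2', r != v2, r != v1 & olink v1 L r].
  apply: (other_link2 (P := P ++ [:: u1; u2]) (Q := [:: v3]) _ (b'X _ vb) d3).
  by move: lc; rewrite -catA.
have [rS|rS] := boolP (r \in S).
  have w1 : walk e [:: s2'; u2; u1; v3; v2; v1] s2' v1.
    by rewrite /= !eqxx e13 (esym s2') e2 (esym u2) u12 (esym v3) v23 (esym v2) v12.
  apply: (cover _ _ _ _ _ w1 s2S _ (inP _ rX rS rs) rS o).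
  by apply/permP => f; do 4 rewrite ?count_cat /=; arith.
have rXS : r \in X :\: S by rewrite inE rS.
  have [b2 b2B rb] := bk_find B rXS.
have [b2b|b2b] := eqVneq b' b2.
  have r3 : r = v3.
    by move: rb; rewrite -b2b mb' !inE (negPf rv1) (negPf rv2) => /eqP.
  rewrite r3 in o; apply: (reroute_split_link G pH ES (conf_rev G lc) _ _ e22 (olink_sym G o)).
    by apply: (alt_arc e (W := full)); apply: alt1.
  exact: (alt_arc e (alt_rev aP)).
have [M0 h] := links23 O b'B b2B b2b vb rb o; have e1r : e v1 r.
  by case: o; rewrite M0 linkE.
have v1nv2 : v1 <> v2 by move=> E; move: v12; rewrite E (ctx_irr G).
case: h => [[E _ _]|[_ _ h]|[E _ _]|[_ _ E]].
- by move: bb'; rewrite E eqxx.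
- case: h => -[h1 h2]; [by case: v1nv2 | | | by case: v1nv2].
    have : uniq [:: v1; v2; v3] by have [_ us _ _] := lc; apply: (uniq_count us); cnt.
    by rewrite /= h2 !inE eqxx orbT.
  by apply: nB; rewrite esym -h1.
- by move: s3; rewrite E.
- by [].
Qed.

(** Without outer edges, toughness for [S] with the middle vertex [c2] links [c1] to [c3]. Any edge
    between two intervals then ends in [c2] and is rerouted. *)
Lemma intervals23_degree : d <= 2.
Proof.
rewrite leqNgt; apply/negP => d3.
have [a1 [a2 bE]] : exists a1 a2, b.2 = [:: a1; a2].
  by case: b.2 s2 => [|a1 [|a2 []]] // _; exists a1, a2.
have [c1 [c2 [c3 b'E]]] : exists c1 c2 c3, b'.2 = [:: c1; c2; c3].
  by case: b'.2 s3 => [|c1 [|c2 [|c3 []]]] // _; exists c1, c2, c3.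
have O : oriented23 a1 a2 c1 c2 c3 by left.
have O' : oriented23 a2 a1 c3 c2 c1 by right.
have good y r : pair23 a1 a2 c1 c2 c3 y r -> e y r -> r <> c2 -> False.
  case=> -[-> ->] yr // _; first exact: (no_outer_edge23 d3 O yr).
  exact: (no_outer_edge23 d3 O' yr).
have ub' : uniq [:: c1; c2; c3] by rewrite -b'E; exact: (bl_uniq ES B b'B).
move: (ub'); rewrite /= !inE negb_or => /and3P[/andP[n12 n13] n23 _].
have edge y r M : olink y M r -> M = [::] -> e y r by case=> l _ _ _ E; move: l; rewrite E linkE.
have [L o] : exists L, olink c1 L c3.
  have [|||||u [v [L [b1 [b2 [[b1B b2B ub vb uy] [vy h o]]]]]]] :=
    @tough_mid _ _ _ _ G _ _ _ pH ES _ B b' c2 c3 (fun r => r == c3) b'B.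
  - by rewrite b'E !inE eqxx orbT.
  - by rewrite b'E !inE eqxx !orbT.
  - by rewrite eq_sym.
  - by rewrite b'E.
  - by rewrite b'E /= eqxx (negPf n13).
  case: h => [b12|[E guv]].
    exfalso; have [M0 h] := links23 O b1B b2B b12 ub vb o; have uv := edge _ _ _ o M0.
    have vu : e v u by rewrite esym.
    case: h => [[_ _ h]|[_ _ h]|[_ _ h]|[_ _ h]].
    - by apply: (good _ _ h uv); apply/eqP.
    - by apply: (good _ _ h vu); apply/eqP.
    - by rewrite h eqxx in vy.
    - by rewrite h eqxx in uy.
  have c3b : c3 \in b'.2 by rewrite b'E !inE eqxx !orbT.
  have E1 : b1 = b'.
    have [uc|uc] := eqVneq u c3; first by apply: (bk_own B b1B b'B ub); rewrite uc.
    have [vc|vc] := eqVneq v c3; first by rewrite E; apply: (bk_own B b2B b'B vb); rewrite vc.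
    by rewrite (negPf uc) (negPf vc) in guv.
  move: ub vb; rewrite -E E1 b'E !inE (negPf uy) (negPf vy) /= => ub vb.
  case/orP: ub => /eqP uE; case/orP: vb => /eqP vE; subst u v; try by rewrite eqxx in guv.
    by exists L.
  by exists (rev L); apply: (olink_sym G).
have [P [Q [lc aP aQ]]] := bl_arcs bB b'B bb'; rewrite bE b'E in lc.
have [b1 [b2 [u [v [M [[b1B b2B b12 ub vb] oM]]]]]] := tough_bl G pH ES B.
have fin y r : pair23 a1 a2 c1 c2 c3 y r -> e y r -> False.
  move=> p yr; have [rc|rc] := eqVneq r c2; last by apply: (good _ _ p yr); apply/eqP.
  case: p => -[h1 h2]; rewrite ?h1 ?rc in yr.
  - exact: (reroute_split_link G pH ES lc aP aQ yr o).
  - by move: n23; rewrite -rc h2 eqxx.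
  - by move: n12; rewrite -rc h2 eqxx.
  - have r_arc R : Sarc R -> Sarc (rev R).
      move=> [R0 h]; split; first by rewrite size_rev.
      by move=> r1 r2 /(walk_rev esym); rewrite revK => /h[].
    exact: (reroute_split_link G pH ES (conf_rev G lc) (r_arc _ aQ) (r_arc _ aP) yr (olink_sym G o)).
have sing b0 w : b0 \in bl -> b0 != b' -> b0.2 = [:: w] -> e w c2 -> False.
  move=> b0B n' b0E wc; have [P' [Q' [lc' aP' aQ']]] := bl_arcs b0B b'B n'.
  rewrite b0E b'E in lc'; exact: (reroute_middle_of_three G pH ES lc' aP' aQ' wc o).
have [M0 h] := links23 O b1B b2B b12 ub vb oM; have uv := edge _ _ _ oM M0.
have vu : e v u by rewrite esym.
case: h => [[_ _ h]|[_ _ h]|[b1E E h]|[b2E E h]].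
- exact: (fin _ _ h uv).
- exact: (fin _ _ h vu).
- by apply: (sing _ _ b1B _ b1E); rewrite -?E -?h.
- by apply: (sing _ _ b2B _ b2E); rewrite -?E -?h // eq_sym.
Qed.

End TwoThree.
End IntervalTypes.

(** * Intervals with at most two vertices *)

Section ShortIntervals.

Variables (T : finType) (e : rel T) (c d : nat).
Implicit Types (s t D L P Q R I J M : seq T) (A B K : {set T}) (W : pred T).
Implicit Types (bl m : seq (T * seq T)) (b : T * seq T).
Hypothesis G : tough_ctx e c d.
Let esym := ctx_sym G.
Local Notation lcycle := (lcycle e c).
Variables (X S : {set T}) (x : T).
Hypotheses (pH : piece e (~: X) [set x]) (ES : ear_set e d X [set x] S 1).
Local Notation blocks := (blocks e c X S).
Local Notation full := (full e S).
Local Notation alt := (alt S).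
Local Notation olink := (olink e X x).
Local Notation Sarc := (Sarc e S).
Variable bl : seq (T * seq T).
Hypothesis B : blocks bl.
Hypothesis short : forall b, b \in bl -> size b.2 <= 2.

(** With [q = 1] some vertex must precede and some must follow the ends of a link within their
    intervals, so a link runs from a first to a last vertex and is an edge. *)
Lemma link22 b1 b2 y r M : b1 \in bl -> b2 \in bl -> b1 != b2 -> y \in b1.2 ->
  r \in b2.2 -> olink y M r -> M = [::] /\
  ((exists z z', b1.2 = [:: y; z] /\ b2.2 = [:: z'; r]) \/
   (exists z z', b1.2 = [:: z; y] /\ b2.2 = [:: r; z'])).
Proof.
move=> b1B b2B b12 yb rb [l uM MX _].
have [I1 [I2 [J1 [J2 [E E' h1 h2]]]]] := bl_link G pH ES B b1B b2B b12 yb rb l uM MX.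
have := short b1B; have := short b2B; rewrite E E' !size_cat /= => sJ sI.
split; first by apply: size0nil; move: sI sJ h1 h2; arith.
case: I1 E sI h1 => [|i1 [|i2 I1]] E sI h1; last by move: sI => /=; arith.
  left; case: I2 E sI h2 => [|i3 [|i4 I2]] E sI h2; try by move: sI sJ h1 h2 => /=; arith.
  case: J1 E' sJ h1 => [|j1 [|j2 J1]] E' sJ h1; try by move: sJ h1 => /=; arith.
  case: J2 E' sJ h2 => [|j3 J2] E' sJ h2; last by move: sJ => /=; arith.
  by exists i3, j1.
right; case: I2 E sI h2 => [|i3 I2] E sI h2; last by move: sI => /=; arith.
case: J2 E' sJ h2 => [|j1 [|j2 J2]] E' sJ h2; try by move: sJ h2 => /=; arith.
case: J1 E' sJ h1 => [|j3 J1] E' sJ h1; last by move: sJ => /=; arith.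
by exists i1, j1.
Qed.

Lemma edge22 : exists b b' u1 u2 v1 v2,
  [/\ b \in bl, b' \in bl, b != b', b.2 = [:: u1; u2] & b'.2 = [:: v1; v2]] /\ e u1 v2.
Proof.
have [b [b' [u [v [L [[bB b'B bb' ub vb] o]]]]]] := tough_bl G pH ES B.
have [L0 h] := link22 bB b'B bb' ub vb o; have uv : e u v.
  by case: o; rewrite L0 linkE.
case: h => -[z [z' [E E']]]; first by exists b, b', u, z, z', v.
by exists b', b, v, z', z, u; rewrite eq_sym esym.
Qed.

Definition dir (o : bool) s := if o then rev s else s.

Lemma mem_dir o s : dir o s =i s.
Proof. by case: o => v; rewrite //= mem_rev. Qed.

Section Edge.

Variables (b b' : T * seq T) (u1 u2 v1 v2 : T).
Hypotheses (bB : b \in bl) (e12 : e u1 v2).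

Lemma edge_neq o : b.2 = dir o [:: u1; u2] -> u1 != u2.
Proof.
by move=> bE; have := bl_uniq ES B bB; rewrite bE; case: o {bE}; rewrite /= inE andbT // eq_sym.
Qed.

(** [other_link] applied to [u2]. An end at [v1] is excluded by [reroute_crossing_edges], and
    [link22] settles the position in any third interval; [o] covers both directions of the cycle. *)
Lemma second_link o P (s2 : T) Q D D2 : b.2 = dir o [:: u1; u2] -> b'.2 = dir o [:: v1; v2] ->
  lcycle X (P ++ [:: u1; u2] ++ (s2 :: Q) ++ [:: v1; v2]) ->
  Sarc P -> Sarc (s2 :: Q) -> count (e u2) D < d - 2 ->
  (forall v L, v \in D -> olink u2 L v -> 1 < size L -> False) ->
  (forall v L, v \in D -> v \notin D2 -> olink u2 L v -> L = [::]) -> size D2 + 1 < d ->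
  exists r L, [/\ r \in X, r \notin s2 :: D, olink u2 L r & r \in S \/
    exists b3 r', [/\ b3 \in bl, b3 != b, b3 != b' & b3.2 = dir o [:: r; r']]].
Proof.
move=> bE b'E lc aP aQ cD h1 h2 sD2; have ub : u2 \in b.2 by rewrite bE mem_dir !inE eqxx orbT.
have uXS := bk_sub B bB ub; have u12 := edge_neq bE.
have adj v L : v \in [:: u1; s2] -> olink u2 L v -> L = [::].
  rewrite !inE => /orP[]/eqP-> ol; apply: (adj_only G (x := x) lc (L := L)); [by left | by right].
have [|||||r [L [rX rD ru ol]]] :=
    @other_link _ _ _ _ G _ _ _ pH ES u2 (u1 :: s2 :: D) D2 uXS.
- by rewrite /=; case: (e _ u1); case: (e _ s2); move: cD; arith.
- move=> v L; rewrite !inE orbA => /orP[h ol|]; last exact: h1.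
  by rewrite (adj v L) // !inE.
- move=> v L; rewrite !inE orbA => /orP[h _ ol|]; last exact: h2.
  by rewrite (adj v L) // !inE.
- by [].
- by exists (P ++ [:: u1; u2] ++ (s2 :: Q) ++ [:: v1; v2]).
move: rD; rewrite inE negb_or => /andP[ru1 rD]; exists r, L; split=> //.
have [rS|rS] := boolP (r \in S); [by left | right].
have rXS : r \in X :\: S by rewrite inE rS.
have [b3 b3B rb] := bk_find B rXS.
have [E|bb3] := eqVneq b b3.
  by move: rb; rewrite -E bE mem_dir !inE (negPf ru) (negPf ru1).
have [L0 h] := link22 bB b3B bb3 ub rb ol; have ur : e u2 r by case: ol; rewrite L0 linkE.
have n3 : b3 != b by rewrite eq_sym.
have [r' b3E] : exists r', b3.2 = dir o [:: r; r'].
  move: u12 h; rewrite bE; case: o {bE b'E uXS} => /= u12;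
    case=> -[z [z' [E E']]]; [by exists z' | | | by exists z']; move: u12; case: E => E E1.
  - by rewrite E1 eqxx.
  - by rewrite E eqxx.
exists b3, r'; split=> //; apply/eqP => b3b'; move: b3E; rewrite b3b' b'E => b3E.
have v1r : v1 = r by move: b3E; case: (o) => -[].
apply: (reroute_crossing_edges (j := v1) (j' := v2) G pH ES lc aP aQ) => //; last by rewrite v1r.
have [cs _ _ _] := lc; apply: walkI => //=; rewrite andbT.
have [p [p' [i [i' [q [q' [j [j' [[_ _ _ /walk_lit2[_ _ w]] _]]]]]]]]] :=
  conf_facts G ES lc aP aQ isT isT; exact: w.
Qed.

End Edge.

(** One-vertex intervals are full, so the arc between [u2] and [v1] is a single vertex [s2]. For
    [d > 2] a further link of [u2] ends in [S] on [P], which can be traversed from there, while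
    [s2], [v1], [v2], [u1], [u2] covers the rest. *)
Lemma intervals22_degree b b' (u1 u2 v1 v2 : T) : b \in bl -> b' \in bl -> b != b' ->
  b.2 = [:: u1; u2] -> b'.2 = [:: v1; v2] -> e u1 v2 ->
  (forall b0, b0 \in bl -> b0 != b -> b0 != b' -> size b0.2 = 1) -> d <= 2.
Proof.
move=> bB b'B bb' bE b'E e12 s1; rewrite leqNgt; apply/negP => d3.
have fsingle b0 : b0 \in bl -> b0 != b -> b0 != b' -> exists2 w, b0.2 = [:: w] & full w.
  by move=> b0B n n'; apply: (short_full G pH ES B short b0B); apply: s1.
have [P [Q [lc aP aQ]]] := bl_conf B bB b'B bb' fsingle; rewrite bE b'E in lc.
have [p [p' [i [i' [q [q' [j [j' [[wP wI wQ wJ] [[e1 e2 e3 e4] [_ [pS p'S qS q'S]]]]]]]]]]]] :=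
  conf_facts G ES lc (alt_arc e aP) (alt_arc e aQ) isT isT.
have [iE i'E u12] := walk_lit2 wI; have [jE j'E v12] := walk_lit2 wJ; subst i i' j j'.
case: (alt_single aQ) => [[s2 s2S QE]|[a [w [Q' [QE aS fw wS aQ']]]]]; last first.
  apply: (reroute_full_vertex G pH ES (u1 := u1) (u2 := u2) (Qa := [:: a]) (w := w) (Qb := Q') _ (alt_arc e aP) _ _ fw wJ e12).
  - by move: lc; rewrite QE.
  - by apply: (alt_arc e (W := full)); apply: alt1.
  - exact: (alt_arc e aQ').
have [qE q'E] : q = s2 /\ q' = s2 by move: wQ; rewrite QE => /walk_lit1.
subst q q' Q.
have [||||r [L [rX rs o h]]] := @second_link _ _ _ _ _ _ bB e12 false P s2 [::] [::] [::] bE b'E lc (alt_arc e aP) (alt_arc e aQ) => //.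
- by rewrite /=; move: d3; arith.
- by rewrite /=; move: d3; arith.
case: h => [rS|[b3 [r' [b3B n n' E]]]]; last by have := s1 _ b3B n n'; rewrite E.
have rP : r \in P.
  move: rX; rewrite -(lc_mem _ lc) !mem_cat -bE -b'E (negPf rs).
  have -> : (r \in b.2) = false by apply: contraTF rS => h; exact: (bl_inS B bB h).
  have -> : (r \in b'.2) = false by apply: contraTF rS => h; exact: (bl_inS B b'B h).
  by rewrite !orbF.
have wP' : walk e (P ++ [::]) p p' by rewrite cats0.
have [R [t [wR tS RP]]] := alt_cover esym aP wP' p'S rP rS.
rewrite cats0 in RP.
apply: (reroute_two_walks G pH ES (N := [:: s2; v1; v2; u1; u2]) lc _ _ s2S o wR tS RP).
- by apply/permP => f; do 4 rewrite ?count_cat /=; arith.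
- by rewrite /= !eqxx e3 v12 u12 (esym v2) e12.
Qed.


Lemma Sarc_cat Pa I Pb : Sarc Pa -> Sarc Pb -> Sarc (Pa ++ I ++ Pb).
Proof.
move=> [P0 aP] [Q0 aQ]; split=> [|p p' w]; first by szs.
case: I w => [|i I] w.
  by have [y [z [/aP[-> _] /aQ[_ ->] _]]] := walk_cat_inv w P0 Q0.
have [y [z [/aP[-> _] w2 _]]] := walk_cat_inv w P0 isT.
by have [y' [z' [_ /aQ[_ ->] _]]] := walk_cat_inv w2 isT Q0.
Qed.

(** The third interval lies on one of the two arcs between the others; the disjunction records
    which. *)
Lemma bl_conf3 W b b' b3 : b \in bl -> b' \in bl -> b3 \in bl -> b != b' -> b3 != b ->
  b3 != b' -> (forall b0, b0 \in bl -> b0 != b -> b0 != b' -> b0 != b3 ->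
    exists2 w, b0.2 = [:: w] & W w) ->
  exists P Qa Qb, [/\ alt W P, alt W Qa, alt W Qb &
    lcycle X ((Qa ++ b3.2 ++ Qb) ++ b.2 ++ P ++ b'.2) \/
    lcycle X (P ++ b.2 ++ (Qa ++ b3.2 ++ Qb) ++ b'.2)].
Proof.
move=> bB b'B b3B bb' n3 n3' h; have [m [m' [B' p]]] := bk_two B bB b'B bb'.
have [_ [_ [lc _ _ _]]] := bk_arcs B'.
have up := bk_uniq B; rewrite (perm_uniq p) in up.
have mem b0 : b0 \in m ++ m' -> [/\ b0 \in bl, b0 != b & b0 != b'].
  move: up; rewrite /= cat_uniq /= !mem_cat inE !negb_or.
  move=> /andP[/and3P[bm _ bm'] /and3P[_ /andP[b'm _] /andP[b'm' _]]].
  move=> bmm; split; first by rewrite (perm_mem p) !(inE, mem_cat); case/orP: bmm => ->; rewrite ?orbT.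
    by apply: contraTneq bmm => ->; rewrite (negPf bm) (negPf bm').
  by apply: contraTneq bmm => ->; rewrite (negPf b'm) (negPf b'm').
have altm n a : {subset n <= m ++ m'} -> b3 \notin n -> a \in S -> alt W (rcons (flat n) a).
  move=> nm b3n aS; apply: alt_blocks B _ _ _ _ aS => b0 b0n; have [b0B n1 n2] := mem b0 (nm _ b0n).
  by split=> //; apply: h => //; apply: contraNneq b3n => <-.
have bS := bk_in B bB; have b'S := bk_in B b'B; have b3S := bk_in B b3B.
have split3 n1 n2 a : rcons (flat (n1 ++ b3 :: n2)) a =
    rcons (flat n1) b3.1 ++ b3.2 ++ rcons (flat n2) a.
  by rewrite flat_cat flat_cons -!cats1 -!catA /= -catA.
have : b3 \in m ++ m'.
  by move: b3B; rewrite (perm_mem p) !(inE, mem_cat) (negPf n3) (negPf n3').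
have um : uniq (m ++ m').
  apply: subseq_uniq up; apply: subseq_trans (subseq_cons _ _).
  by apply: cat_subseq => //; exact: subseq_cons.
clear mem B' p up; rewrite mem_cat => /orP[] /splitPr h3; case: h3 lc altm um => n1 n2 lc altm um.
  move: um; rewrite -catA uniq_catCA /= !mem_cat !negb_or => /andP[/and3P[b32 b31 b3m] _].
  exists (rcons (flat m') b.1), (rcons (flat n1) b3.1), (rcons (flat n2) b'.1).
  split; [apply: altm| apply: altm| apply: altm | by right; rewrite -split3] => // v vn;
    by rewrite !(mem_cat, inE) vn ?orbT.
move: um; rewrite uniq_catC -catA uniq_catCA /= !mem_cat !negb_or => /andP[/and3P[b32 b31 b3m] _].
exists (rcons (flat m) b'.1), (rcons (flat n1) b3.1), (rcons (flat n2) b.1).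
split; [apply: altm| apply: altm| apply: altm | by left; rewrite -split3] => // v vn;
  by rewrite !(mem_cat, inE) vn ?orbT.
Qed.

Lemma coverR P M p p' N y y' r L s : alt full P -> walk e (P ++ M) p p' -> p' \in S ->
  r \in P -> r \in S -> lcycle X s -> perm_eq (N ++ P ++ M) s -> walk e N y y' ->
  y \in S -> olink y' L r -> False.
Proof.
move=> aP wP p'S rP rS lc NP wN yS o.
have [R [t [wR tS RP]]] := alt_cover esym aP wP p'S rP rS.
exact: (reroute_two_walks G pH ES lc NP wN yS o wR tS RP).
Qed.

Lemma short_link_nil b1 b2 y r M : b1 \in bl -> b2 \in bl -> b1 != b2 -> y \in b1.2 ->
  r \in b2.2 -> olink y M r -> M = [::].
Proof. by move=> b1B b2B b12 yb rb o; have [] := link22 b1B b2B b12 yb rb o. Qed.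

(** Without this edge [d > 3] gives [u2] a link that avoids [u1], [s2], [w1] and [t1]. It ends in
    [S] on [P], and the walk from [s2] over [t1], [v1], [v2], [u1] to [u2] covers everything
    else. *)
Lemma inner_edge o b b' b3 P (u1 u2 v1 v2 s2 w1 w2 t1 : T) : b \in bl -> b' \in bl ->
  b3 \in bl -> b3 != b -> b3 != b' ->
  (forall b0, b0 \in bl -> b0 != b -> b0 != b' -> b0 != b3 -> size b0.2 = 1) ->
  b.2 = dir o [:: u1; u2] -> b'.2 = dir o [:: v1; v2] -> b3.2 = dir o [:: w1; w2] ->
  e u1 v2 -> lcycle X (P ++ [:: u1; u2] ++ [:: s2; w1; w2; t1] ++ [:: v1; v2]) ->
  alt full P -> s2 \in S -> t1 \in S -> Sarc [:: s2; w1; w2; t1] -> 3 < d -> e u2 w1.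
Proof.
move=> bB b'B b3B n3 n3' single bE b'E b3E e12 lc aP s2S t1S aQ d4.
case uw: (e u2 w1) => //; exfalso.
have [p [p' [i [i' [q [q' [j [j' [[wP wI wQ wJ] [[e1 e2 e3 e4] [[xp xp' xq _] [pS p'S _ _]]]]]]]]]]]] :=
  conf_facts G ES lc (alt_arc e aP) aQ isT isT.
have [iE i'E u12] := walk_lit2 wI; have [jE j'E v12] := walk_lit2 wJ; subst i i' j j'.
have [qE q'E sw1 w12 w2t] := walk_lit4 wQ; subst q q'.
have ub : u2 \in b.2 by rewrite bE mem_dir !inE eqxx orbT.
have wb : w1 \in b3.2 by rewrite b3E mem_dir !inE eqxx.
have bb3 : b != b3 by rewrite eq_sym.
have [||||r [L [rX rD ol h]]] :=
  @second_link _ _ _ _ _ _ bB e12 o P s2 [:: w1; w2; t1] [:: w1; t1] [:: t1]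
    bE b'E lc (alt_arc e aP) aQ.
- by rewrite /= uw; case: (e u2 t1); move: d4; arith.
- move=> v L; rewrite !inE => /orP[]/eqP-> ol; first by rewrite (short_link_nil bB b3B bb3 ub wb ol).
  move=> sL; have [l uL LX xL] := ol.
  apply: (@too_longx _ _ _ _ G X x pH _ L (P ++ u1 :: u2 :: L ++ t1 :: w2 :: w1 :: s2 :: [:: x])
    p x lc uL LX xL); [wk | edge | cnt | move: sL; szs].
- move=> v L; rewrite !inE => /orP[]/eqP-> h ol; first exact: (short_link_nil bB b3B bb3 ub wb ol).
  by rewrite eqxx in h.
- by rewrite /=; move: d4; arith.
case: h => [rS|[b4 [r' [b4B n4 n4' b4E]]]].
  have rP : r \in P.
    move: rX rD; rewrite -(lc_mem _ lc) !mem_cat !inE !negb_or => + /and3P[r1 r2 r3].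
    rewrite (negPf r1) (negPf r2) (negPf r3) /=; case/or4P=> // h; exfalso.
    - by have := bl_inS B (v := r) bB; rewrite bE mem_dir !inE h rS => /(_ isT).
    - move: h; rewrite orbF => h.
      by have := bl_inS B (v := r) b3B; rewrite b3E mem_dir !inE h rS orbT => /(_ isT).
    - by have := bl_inS B (v := r) b'B; rewrite b'E mem_dir !inE h rS => /(_ isT).
  apply: (coverR (M := [::]) (N := [:: s2; w1; w2; t1; v1; v2; u1; u2]) aP _ p'S rP rS lc _ _ s2S ol).
  - by rewrite cats0; exact: wP.
  - by apply/permP => f; do 4 rewrite ?count_cat /=; arith.
  - by rewrite /= !eqxx sw1 w12 w2t e3 v12 u12 (esym v2) e12.
have [E|n43] := eqVneq b4 b3; last by have := single _ b4B n4 n4' n43; rewrite b4E; case: (o).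
by move: rD; rewrite !inE; move: b4E; rewrite E b3E; case: (o) => -[h1 h2]; rewrite ?h1 ?h2 eqxx ?orbT.
Qed.

(** If the third interval is not between [u2] and [v1], a further link of [u2] is covered as for two
    intervals. If it is, both remaining parts of that arc are single vertices, [inner_edge] applies
    on both sides of the third interval, and a full vertex on [P] completes a longer cycle. *)
Lemma intervals222_degree b b' b3 (u1 u2 v1 v2 : T) : b \in bl -> b' \in bl -> b3 \in bl -> b != b' ->
  b3 != b -> b3 != b' -> b.2 = [:: u1; u2] -> b'.2 = [:: v1; v2] -> size b3.2 = 2 -> e u1 v2 ->
  (forall b0, b0 \in bl -> b0 != b -> b0 != b' -> b0 != b3 -> size b0.2 = 1) -> d <= 3.
Proof.
move=> bB b'B b3B bb' n3 n3' bE b'E s3 e12 s1; rewrite leqNgt; apply/negP => d4.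
have [w1 [w2 b3E]] : exists w1 w2, b3.2 = [:: w1; w2].
  by case: b3.2 s3 => [|r1 [|r2 []]] // _; exists r1, r2.
have fsingle b0 : b0 \in bl -> b0 != b -> b0 != b' -> b0 != b3 ->
    exists2 w, b0.2 = [:: w] & full w.
  by move=> b0B n n' n''; apply: (short_full G pH ES B short b0B); apply: s1.
have ub : u2 \in b.2 by rewrite bE !inE eqxx orbT.
have wb : w1 \in b3.2 by rewrite b3E !inE eqxx.
have bb3 : b != b3 by rewrite eq_sym.
have S1 (a : T) : a \in S -> Sarc [:: a].
  by move=> aS; apply: (alt_arc e (W := full)); apply: alt1.
have [P [Qa [Qb [aP aQa aQb lc]]]] := bl_conf3 bB b'B b3B bb' n3 n3' fsingle.
have [arcP [arcA arcB]] : Sarc P /\ Sarc Qa /\ Sarc Qb.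
  by split; [|split]; apply: alt_arc; eassumption.
rewrite b3E bE b'E in lc; case: lc => lc.
  have arcQ := Sarc_cat [:: w1; w2] arcA arcB.
  have [p [p' [i [i' [q [q' [j [j' [[wP wI wQ wJ] [[e1 e2 e3 e4] [_ [pS p'S qS q'S]]]]]]]]]]]] :=
    conf_facts G ES lc arcQ arcP isT isT.
  have [iE i'E u12] := walk_lit2 wI; have [jE j'E v12] := walk_lit2 wJ; subst i i' j j'.
  case: (alt_single aP) => [[s2 s2S PE]|[a [w [P' [PE aS fw wS aP']]]]]; last first.
    apply: (reroute_full_vertex G pH ES (u1 := u1) (u2 := u2) (Qa := [:: a]) (w := w) (Qb := P') _ arcQ _ _ fw wJ e12).
    - by move: lc; rewrite PE.
    - exact: S1.
    - exact: (alt_arc e aP').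
  subst P; have [qE q'E] := walk_lit1 wQ; subst q q'.
  have [||||r [L [rX rD ol h]]] :=
    @second_link _ _ _ _ _ _ bB e12 false _ s2 [::] [:: w1] [::] bE b'E lc arcQ arcP.
  - by rewrite /=; case: (e u2 w1); move: d4; arith.
  - by move=> v L; rewrite !inE => /eqP-> ol; rewrite (short_link_nil bB b3B bb3 ub wb ol).
  - by move=> v L; rewrite !inE => /eqP-> h ol; exact: (short_link_nil bB b3B bb3 ub wb ol).
  - by rewrite /=; move: d4; arith.
  case: h => [rS|[b4 [r' [b4B n4 n4' b4E]]]]; last first.
    have [E|n43] := eqVneq b4 b3; last by have := s1 _ b4B n4 n4' n43; rewrite b4E.
    by move: rD; rewrite !inE; move: b4E; rewrite E b3E => -[-> _]; rewrite eqxx ?orbT.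
  have wN : walk e [:: s2; v1; v2; u1; u2] s2 u2.
    by rewrite /= !eqxx e3 v12 u12 (esym v2) e12.
  have rAB : (r \in Qa) || (r \in Qb).
    move: rD; rewrite inE negb_or => /andP[r1 _].
    move: rX; rewrite -(lc_mem _ lc) !mem_cat -bE -b'E -b3E inE (negPf r1).
    have -> : (r \in b.2) = false by apply: contraTF rS => h; exact: (bl_inS B bB h).
    have -> : (r \in b'.2) = false by apply: contraTF rS => h; exact: (bl_inS B b'B h).
    have -> : (r \in b3.2) = false by apply: contraTF rS => h; exact: (bl_inS B b3B h).
    by rewrite !orbF.
  case/orP: rAB => rQ.
    apply: (coverR (M := [:: w1; w2] ++ Qb) aQa wP p'S rQ rS lc _ wN s2S ol).
    by apply/permP => f; do 4 rewrite ?count_cat /=; arith.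
  rewrite -mem_rev in rQ; have := walk_rev esym wP; rewrite !rev_cat -catA => wP'.
  apply: (coverR (M := rev [:: w1; w2] ++ rev Qa) (alt_rev aQb) wP' pS rQ rS lc _ wN s2S ol).
  by apply/permP => f; do 5 rewrite ?count_cat ?count_rev /=; arith.
have arcQ := Sarc_cat [:: w1; w2] arcA arcB.
have [p [p' [i [i' [q [q' [j [j' [[wP wI wQ wJ] [[e1 e2 e3 e4] [[xp xp' xq xq'] [pS p'S qS q'S]]]]]]]]]]]] :=
  conf_facts G ES lc arcP arcQ isT isT.
have [iE i'E u12] := walk_lit2 wI; have [jE j'E v12] := walk_lit2 wJ; subst i i' j j'.
case: (alt_single aQa) => [[s2 s2S QaE]|[a [w [Q' [QE aS fw wS aQ']]]]]; last first.
  apply: (reroute_full_vertex G pH ES (u1 := u1) (u2 := u2) (Qa := [:: a]) (w := w)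
    (Qb := Q' ++ [:: w1; w2] ++ Qb) _ arcP _ _ fw wJ e12).
  - by move: lc; rewrite QE -!catA.
  - exact: S1.
  - exact: Sarc_cat (alt_arc e aQ') arcB.
case: (alt_single aQb) => [[t1 t1S QbE]|[a [w [Q' [QE aS fw wS aQ']]]]]; last first.
  apply: (reroute_full_vertex G pH ES (u1 := u1) (u2 := u2) (Qa := Qa ++ [:: w1; w2] ++ [:: a]) (w := w)
    (Qb := Q') _ arcP _ _ fw wJ e12).
  - by move: lc; rewrite QE -!catA.
  - exact: Sarc_cat arcA (S1 _ aS).
  - exact: (alt_arc e aQ').
subst Qa Qb.
have euw : e u2 w1.
  by apply: (inner_edge (o := false) bB b'B b3B n3 n3' s1 bE b'E b3E e12 lc aP s2S t1S arcQ d4).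
(* The same argument on the reversed cycle, with [b] and [b'] exchanged. *)
have evw : e v1 w2.
  have lc' : lcycle X (rev P ++ [:: v2; v1] ++ [:: t1; w2; w1; s2] ++ [:: u2; u1]).
    have := lcycle_rot (s := rev [:: s2; w1; w2; t1] ++ rev [:: u1; u2]) (t := rev P ++ rev [:: v1; v2]).
    by rewrite -!catA; apply; have := conf_rev G lc.
  have arcQ' : Sarc [:: t1; w2; w1; s2] by exact: (Sarc_cat [:: w2; w1] arcB arcA).
  have s1' b0 : b0 \in bl -> b0 != b' -> b0 != b -> b0 != b3 -> size b0.2 = 1.
    by move=> b0B n n' n''; apply: s1.
  apply: (inner_edge (o := true) b'B bB b3B n3' n3 s1' _ _ _ _ lc' (alt_rev aP) t1S s2S arcQ' d4) => //.
  by rewrite esym.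
have [qE q'E sw1 w12 w2t] := walk_lit4 wQ; subst q q'.
have [lcc uniqc sc Xc] := lc.
have [_ _ c2] := es_bounds G lc pH ES.
(* With no one-vertex interval on [P] the cycle would have nine vertices, less than [2 d + 2]. *)
case: (alt_single aP) => [[a aS PE]|[a [z [P' [PE aS fz zS aP']]]]].
  by move: sc c2 d4; rewrite PE /=; arith.
have [za zt] := (fullP fz aS, fullP fz t1S).
subst P; have [y [z1 [wY wZ ez]]] := walk_cat_inv wP isT isT.
have [z' [zE ez' wZ']] := walk_cons_inv wZ (alt_size aP'); subst z1.
have [yE y'E] := walk_lit1 wY; subst p y.
apply: (@too_longx _ _ _ _ G X x pH _ [::]
  (P' ++ u1 :: v2 :: a :: x :: s2 :: u2 :: w1 :: w2 :: v1 :: t1 :: [:: z]) z' z lc) => //;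
  [wk | cnt | szs].
Qed.

End ShortIntervals.

(** * Interval sizes permitted by the excess *)

Section ExcessBound.

Variables (T : finType) (e : rel T) (c d : nat).
Implicit Types (s t D L P Q R I J M : seq T) (A B K : {set T}) (W : pred T).
Implicit Types (bl m : seq (T * seq T)) (b : T * seq T).
Hypothesis G : tough_ctx e c d.
Variables (X S H : {set T}) (q : nat).
Hypotheses (pH : piece e (~: X) H) (ES : ear_set e d X H S q).
Variable bl : seq (T * seq T).
Hypothesis B : blocks e c X S bl.

Lemma excess_sub m : uniq m -> {subset m <= bl} -> excess q m <= excess q bl.
Proof.
move=> um mb; have p : perm_eq bl (m ++ [seq b <- bl | b \notin m]).
  apply: uniq_perm; first exact: bk_uniq B.
    rewrite cat_uniq um filter_uniq ?(bk_uniq B) // andbT.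
    by apply/hasPn => b; rewrite mem_filter => /andP[].
  move=> b; rewrite mem_cat mem_filter; case bm: (b \in m) => //=.
  by rewrite (mb b bm).
by rewrite (excess_perm q p) excess_cat leq_addr.
Qed.

Lemma es_size b : b \in bl -> q <= size b.2.
Proof.
move=> bB; apply: (bk_gap B (es_gapped G pH ES)) => //.
by rewrite (bk_size B (es_sub ES)); apply: es_two ES.
Qed.

End ExcessBound.

Section SingleComponent.

Variables (T : finType) (e : rel T) (c d : nat).
Implicit Types (s t D L P Q R I J M : seq T) (A B K : {set T}) (W : pred T).
Implicit Types (bl m : seq (T * seq T)) (b : T * seq T).
Hypothesis G : tough_ctx e c d.
Variables (X S : {set T}) (x : T).
Hypotheses (pH : piece e (~: X) [set x]) (ES : ear_set e d X [set x] S 1).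
Variable bl : seq (T * seq T).
Hypothesis B : blocks e c X S bl.

(** Here [q = 1] and [|S| = d], so [c = 2 d] plus the excess, which is therefore 2 or 3. The
    intervals with more than one vertex can only have sizes 4; 3; 3 and 2; 2 and 2; or three times
    2. *)
Theorem single_component_intervals : d = 2 \/ d = 3 /\ forall b, b \in bl -> size b.2 = 2.
Proof.
have [dE _ _] := es_bounds G (bk_lc B) pH ES; have [cE _] := es_excess G pH ES B.
have sbl := bk_size B (es_sub ES).
have d2 : 1 < d by move: dE (es_two ES); arith.
have ex3 : excess 1 bl <= 3 by move: cE dE (ctx_small G); arith.
have sub m : uniq m -> {subset m <= bl} -> excess 1 m <= 3.
  by move=> um mb; apply: leq_trans (excess_sub 1 B um mb) ex3.
have s1 := es_size G pH ES B.
have two b b' : b \in bl -> b' \in bl -> b != b' -> size b.2 + size b'.2 <= 5.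
  move=> bB b'B bb'; have := sub [:: b; b']; rewrite /excess /= !inE bb' => /(_ isT) h.
  have {h}h : size b.2 - 1 + (size b'.2 - 1 + 0) <= 3.
    by apply: h => b0; rewrite !inE => /orP[]/eqP->.
  by move: h (s1 b bB) (s1 b' b'B); arith.
have three b b' b3 : b \in bl -> b' \in bl -> b3 \in bl -> b != b' -> b3 != b -> b3 != b' ->
    size b.2 + size b'.2 + size b3.2 <= 6.
  move=> bB b'B b3B bb' n n'; have := sub [:: b3; b; b']; rewrite /excess /= !inE negb_or n n' bb'.
  move=> /(_ isT) h; have {h}h : size b3.2 - 1 + (size b.2 - 1 + (size b'.2 - 1 + 0)) <= 3.
    by apply: h => b0; rewrite !inE => /or3P[]/eqP->.
  by move: h (s1 b bB) (s1 b' b'B) (s1 b3 b3B); arith.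
have four b b' b3 b4 : b \in bl -> b' \in bl -> b3 \in bl -> b4 \in bl -> b != b' -> b3 != b ->
    b3 != b' -> b4 != b -> b4 != b' -> b4 != b3 ->
    size b.2 + size b'.2 + size b3.2 + size b4.2 <= 7.
  move=> bB b'B b3B b4B bb' n n' n1 n2 n3; have := sub [:: b4; b3; b; b'].
  rewrite /excess /= !inE !negb_or n n' bb' n1 n2 n3.
  move=> /(_ isT) h.
  have {h}h : size b4.2 - 1 + (size b3.2 - 1 + (size b.2 - 1 + (size b'.2 - 1 + 0))) <= 3.
    by apply: h => b0; rewrite !inE => /or4P[]/eqP->.
  by move: h (s1 b bB) (s1 b' b'B) (s1 b3 b3B) (s1 b4 b4B); arith.
have d2or : d <= 2 -> d = 2 by move: d2; arith.
have [[b [bB b4]]|no4'] := classic (exists b, b \in bl /\ 3 < size b.2).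
  exfalso; have sing b0 : b0 \in bl -> b0 != b -> size b0.2 = 1.
    by move=> b0B n; have := two b0 b b0B bB n; have := s1 _ b0B; move: b4; arith.
  apply: (no_interval_of_size4 G pH ES B bB _ sing).
  have : 1 < size bl by rewrite sbl; apply: es_two ES.
  have := sub [:: b] isT; rewrite /excess /= => h _.
  have {h}h : size b.2 - 1 + 0 <= 3 by apply: h => b0; rewrite inE => /eqP->.
  by move: h b4; arith.
have le3 b : b \in bl -> size b.2 <= 3.
  by move=> bB; rewrite leqNgt; apply/negP => h; apply: no4'; exists b.
have [[b [bB b3]]|no3'] := classic (exists b, b \in bl /\ size b.2 = 3).
  have [[b' [b'B b'b b'2]]|all1] := classic (exists b', [/\ b' \in bl, b' != b & size b'.2 != 1]).
    left; apply: d2or; apply: (intervals23_degree G pH ES B b'B bB _ b3).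
      by have := two b' b b'B bB b'b; have := s1 _ b'B; move: b'2 b3; arith.
    move=> b0 b0B n n'; have := three b' b b0 b'B bB b0B b'b n n'.
    by have := s1 _ b0B; have := s1 _ b'B; move: b'2 b3; arith.
  exfalso; apply: (no_interval_of_size3 G pH ES B bB b3) => b' b'B n; apply/eqP; apply: contraT => h.
  by case: all1; exists b'.
have short b : b \in bl -> size b.2 <= 2.
  move=> bB; have := le3 b bB; rewrite leq_eqVlt => /orP[/eqP h|//].
  by case: no3'; exists b.
have [b [b' [u1 [u2 [v1 [v2 [[bB b'B bb' bE b'E] e12]]]]]]] := edge22 G pH ES B short.
have [[b3 [b3B n n' b32]]|all1] := classic (exists b3, [/\ b3 \in bl, b3 != b, b3 != b' & size b3.2 != 1]).
  have s3 : size b3.2 = 2 by have := short _ b3B; have := s1 _ b3B; move: b32; arith.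
  have d3 : d <= 3.
    apply: (intervals222_degree G pH ES B short bB b'B b3B bb' n n' bE b'E s3 e12) => b0 b0B n1 n2 n3.
    have := four b b' b3 b0 bB b'B b3B b0B bb' n n' n1 n2 n3.
    by have := s1 _ b0B; rewrite bE b'E s3 /=; arith.
  have [d_2|d_3] : d = 2 \/ d = 3 by move: d2 d3; arith.
    by left.
  right; split=> // b0 b0B; have [->|n1] := eqVneq b0 b; first by rewrite bE.
  have [->|n2] := eqVneq b0 b'; first by rewrite b'E.
  have [->|n3] := eqVneq b0 b3; first by rewrite s3.
  (* A fourth interval contradicts [|S| = d = 3]. *)
  have : size [:: b0; b3; b; b'] <= size bl.
    apply: uniq_leq_size; first by rewrite /= !inE !negb_or n1 n2 n3 n n' bb'.
    by move=> b4; rewrite !inE => /or4P[]/eqP->.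
  by rewrite sbl /=; move: dE d_3; arith.
left; apply: d2or; apply: (intervals22_degree G pH ES B short bB b'B bb' bE b'E e12) => b0 b0B n n'.
by apply/eqP; apply: contraT => h; case: all1; exists b0.
Qed.

End SingleComponent.

(** * Components attached at two vertices *)

Section TwoComponents.

Variables (T : finType) (e : rel T) (c d : nat).
Implicit Types (s t D L P Q R I J M : seq T) (A B : {set T}).
Hypothesis G : tough_ctx e c d.
Let esym := ctx_sym G.
Local Notation lcycle := (lcycle e c).
Variables (X S H : {set T}) (q : nat).
Hypotheses (pH : piece e (~: X) H) (ES : ear_set e d X H S q).

(** A walk between two vertices of [S] closes through an ear that spans [H], so it may miss up to
    [q - 1] vertices of the cycle. *)
Lemma ear_close s L t (y z : T) : lcycle X s -> uniq L -> (forall v, v \in L -> v \notin X) ->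
  (forall v, v \in L -> v \notin H) -> walk e t y z -> y \in S -> z \in S -> y != z ->
  (forall v, count_mem v t <= count_mem v (s ++ L)) -> size s < size t + q -> False.
Proof.
move=> lc uL LX LH w yS zS yz ct lt; rewrite eq_sym in yz.
have [P [p [p' [[wP zp py uP PH] sP]]]] := es_ear_walk ES zS yS yz.
apply: (@too_long _ _ _ _ G X s (L ++ P) (t ++ P) y p' lc).
- by apply: uniq_cat_out => // v /PH; apply: contraL; apply: LH.
- move=> v; rewrite mem_cat => /orP[/LX//|/PH]; exact: (comp_out pH).
- exact: walk_cat w wP zp.
- by [].
- by move=> v; have := ct v; rewrite !count_cat; arith.
- by rewrite size_cat sP.
Qed.

Lemma piece_disjoint K (z : T) : piece e (~: X) K -> z \in H -> z \in K -> H = K.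
Proof.
have sub A B : piece e (~: X) A -> piece e (~: X) B -> z \in A -> z \in B -> A \subset B.
  move=> [_ AX _ cA] pB zA zB; apply/subsetP => v vA.
  by apply: (piece_closed pB zB); apply: joined_sub AX _; apply: cA.
move=> pK zH zK; apply/eqP; rewrite eqEsubset.
by rewrite !sub.
Qed.

Section Other.

Variables (K SK : {set T}) (qK : nat).
Hypotheses (pK : piece e (~: X) K) (EK : ear_set e d X K SK qK) (HK : H != K).

Lemma other_out (v : T) : v \in K -> v \notin H.
Proof. by move=> vK; apply: contra HK => vH; apply/eqP; apply: piece_disjoint vH vK. Qed.

(** [H] and [K] are two components already, so [R] may have one element less than [S']. *)
Lemma es_tough2 (A : eqType) (f : T -> A) (S' : {set T}) R : S \subset S' -> SK \subset S' ->
  S' \subset X -> uniq R -> 0 < size R -> #|S'| <= size R + 1 -> {subset R <= X :\: S'} ->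
  {in R &, injective f} ->
  exists u v L, [/\ u \in X :\: S', v \in X :\: S', f u != f v, link e u L v & uniq L]
    /\ forall z, z \in L -> z \notin X.
Proof.
move=> SS' SKS' S'X uR R0 sR RX fR.
have [h hH] : exists h, h \in H by case: pH.
have [k kK] : exists k, k \in K by case: pK.
have RX' r : r \in R -> (r \in X) && (r \notin S') by move/RX; rewrite inE andbC.
have hX := comp_out pH hH; have kX := comp_out pK kK.
have hS' : h \notin S' by apply: contra hX; apply: (subsetP S'X).
have kS' : k \notin S' by apply: contra kX; apply: (subsetP S'X).
have stuck r : r \in R -> joined e (~: S') h r -> False.
  by move=> /RX'/andP[rX _] /(es_stuck pH ES SS' hH)/(comp_out pH); rewrite rX.
have stuckK r : r \in R -> joined e (~: S') k r -> False.
  by move=> /RX'/andP[rX _] /(es_stuck pK EK SKS' kK)/(comp_out pK); rewrite rX.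
have stuckHK : joined e (~: S') h k -> False.
  by move=> /(es_stuck pH ES SS' hH) kH; have := other_out kK; rewrite kH.
have hk : h != k by apply: contraNneq (other_out kK) => <-.
have [||||r [r' [rR r'R rr j]]] := ctx_tough G (S := S') (R := h :: k :: R).
- rewrite /= uR inE negb_or hk andbT /=; apply/andP; split.
    by apply: contra hX => /RX'/andP[].
  by apply: contra kX => /RX'/andP[].
- by rewrite /=; arith.
- by [].
- by move=> r; rewrite !inE => /or3P[/eqP->//|/eqP->//|/RX'/andP[]].
have j' := joined_sym esym j.
move: rR r'R rr j j'; rewrite !inE => /or3P[/eqP->|/eqP->|rR] /or3P[/eqP->|/eqP->|r'R]; rewrite ?eqxx //.
all: try by move=> _ jj jj'; exfalso;
  first [exact: (stuckHK jj) | exact: (stuckHK jj') | exact: (stuck _ r'R jj)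
    | exact: (stuck _ rR jj') | exact: (stuckK _ r'R jj) | exact: (stuckK _ rR jj')].
move=> rr j _; have frr : f r != f r' by apply: contra rr => /eqP/fR->.
have /andP[rX _] := RX' _ rR; have /andP[r'X _] := RX' _ r'R.
have [u [v [L [p LX]]]] := extract_link j rX r'X frr.
by exists u, v, L; split=> // z /LX; rewrite inE negb_or => /andP[].
Qed.

(** Two components with the same two attachments, together with the rest of the cycle, would be
    three components left by two vertices. *)
Lemma es_neq s : lcycle X s -> #|S| = 2 -> S != SK.
Proof.
move=> lc S2; apply/eqP => SE; have [r rX rS] : exists2 r, r \in X & r \notin S.
  apply: NNPP => no; have : #|X| <= 2.
    rewrite -S2; apply: subset_leq_card; apply/subsetP => r rX.
    by apply: contraT => rS; case: no; exists r.
  have [_ us sz sX] := lc; have /card_uniqP us' := us.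
  have := ctx_gt2 G; rewrite -sz -us' (eq_card sX); arith.
(* With a constant colour the conclusion of [es_tough2] is absurd. *)
have [||||||||u [v [L [[_ _ + _ _] _]]]] := es_tough2 (f := fun _ => tt) (S' := S) (R := [:: r]).
- exact: subxx.
- by rewrite SE.
- exact: es_sub ES.
- by [].
- by [].
- by rewrite S2.
- by move=> v; rewrite inE => /eqP->; rewrite inE rS.
- by move=> v w; rewrite !inE => /eqP-> /eqP->.
- by rewrite eqxx.
Qed.

End Other.
End TwoComponents.

Lemma cycle_link (T : eqType) (e : rel T) s1 x M y s3 :
  cycle e (s1 ++ x :: M ++ y :: s3) -> path e x (rcons M y).
Proof.
rewrite -(rot_cycle (size s1)) rot_size_cat /= -catA -cat_rcons rcons_cat cat_path.
by move=> /andP[].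
Qed.

Lemma cat_cons_eq (T : Type) (s t I1 I2 : seq T) u : s ++ t = I1 ++ u :: I2 ->
  (exists r, s = I1 ++ u :: r) \/ (exists r, I1 = s ++ r /\ t = r ++ u :: I2).
Proof.
elim: s I1 => [|x s IH] [|y I1] /=.
- by move=> ->; right; exists [::].
- by move=> ->; right; exists (y :: I1).
- by move=> [-> _]; left; exists s.
by move=> [-> /IH[[r ->]|[r [-> ->]]]]; [left | right]; exists r.
Qed.

(** Locates [u] relative to the marks [a] and [b]; outside them only a comparison of lengths is
    kept. *)
Lemma two_marks (T : Type) (M J N I1 I2 : seq T) a b u :
  M ++ a :: J ++ b :: N = I1 ++ u :: I2 ->
  [\/ size I1 < size M \/ size I2 < size N, [/\ u = a, I1 = M & I2 = J ++ b :: N],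
      exists r1 r2, J = r1 ++ u :: r2 | [/\ u = b, I1 = M ++ a :: J & I2 = N]].
Proof.
move=> E; case: (cat_cons_eq E) => [[r ->]|[[|x r] [-> /= []]]].
- by constructor 1; left; rewrite size_cat /=; arith.
- by move=> -> <-; constructor 2; rewrite cats0.
move=> <- {}E; case: (cat_cons_eq E) => [[r' ->]|[[|y r'] [-> /= []]]].
- by constructor 3; exists r, r'.
- by move=> -> ->; constructor 4; rewrite cats0.
by move=> _ ->; constructor 1; right; rewrite size_cat /=; arith.
Qed.

(** * Two components with two attachments each *)

Section TwoAttachments.

Variables (T : finType) (e : rel T) (c d : nat).
Implicit Types (s t D L P Q R I J M N : seq T) (A B : {set T}) (a b : T).
Hypothesis G : tough_ctx e c d.
Let esym := ctx_sym G.
Local Notation lcycle := (lcycle e c).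
Variables (X : {set T}).

Lemma cyc_link s1 x M y s3 s : lcycle X s -> s = s1 ++ x :: M ++ y :: s3 -> link e x M y.
Proof. by move=> [cs _ _ _] E; move: cs; rewrite E; apply: cycle_link. Qed.

Section Pair.

Variables (H : {set T}) (a b : T) (q : nat).
Hypotheses (pH : piece e (~: X) H) (EH : ear_set e d X H [set a; b] q).

Lemma pair_neq : a != b.
Proof. by have := es_two EH; rewrite cards2; case: (a != b). Qed.

Lemma pair_blocks I J : lcycle X (a :: I ++ b :: J) ->
  blocks e c X [set a; b] [:: (a, I); (b, J)].
Proof.
move=> lc; have [_ us _ _] := lc; split.
- by rewrite !flat_cons /= /flat /= cats0.
- by move=> b0; rewrite !inE => /orP[]/eqP-> /=; rewrite eqxx ?orbT.
have ab := pair_neq; move: us; rewrite /= cat_uniq /= !mem_cat !inE !negb_or.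
move=> /and3P[/and3P[aI _ aJ] _ /and3P[/andP[bI _] bJ _]].
move=> b0 z; rewrite !inE negb_or => /orP[]/eqP-> /= zI; apply/andP; split;
  by apply: contraTneq zI => ->.
Qed.

Lemma pair_gap I J : lcycle X (a :: I ++ b :: J) -> q <= size I /\ q <= size J.
Proof.
have g := es_gapped G pH EH; have [aS bS] : a \in [set a; b] /\ b \in [set a; b].
  by rewrite !inE !eqxx orbT.
move=> lc; split; first exact: g aS bS lc.
exact: (g _ _ _ _ bS aS (lcycle_rot (s := a :: I) (t := b :: J) lc)).
Qed.

Lemma pair_link I1 u I2 J1 v J2 L : lcycle X (a :: (I1 ++ u :: I2) ++ b :: (J1 ++ v :: J2)) ->
  link e u L v -> uniq L -> (forall z, z \in L -> z \notin X) ->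
  size L + q <= size I1 + size J1 /\ size L + q <= size I2 + size J2.
Proof.
move=> lc l uL LX; have B := pair_blocks lc.
apply: (es_link G pH EH B (b := (a, I1 ++ u :: I2)) (b' := (b, J1 ++ v :: J2)) _ _ _ _ _ l uL LX) => //.
- by rewrite inE eqxx.
- by rewrite !inE eqxx orbT.
- by rewrite xpair_eqE negb_and pair_neq.
Qed.

Lemma pair_tough I J : lcycle X (a :: I ++ b :: J) -> exists I1 u I2 J1 v J2 L,
  [/\ I = I1 ++ u :: I2, J = J1 ++ v :: J2, link e u L v, uniq L & forall z, z \in L -> z \notin X].
Proof.
move=> lc; have B := pair_blocks lc.
have [b1 [b2 [I1 [u [I2 [J1 [v [J2 [L [[b1B b2B b12 E E'] [l uL LX]]]]]]]]]]] :=
  es_tough_blocks G pH EH B.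
move: b1B b2B b12 E E'; rewrite !inE => /orP[]/eqP-> /orP[]/eqP->; rewrite ?eqxx //= => _ E E'.
  by exists I1, u, I2, J1, v, J2, L.
exists J1, v, J2, I1, u, I2, (rev L); split=> //; first exact: link_rev.
  by rewrite rev_uniq.
by move=> z; rewrite mem_rev; apply: LX.
Qed.

End Pair.

Section TwoPairs.

Variables (H K : {set T}) (a b a' b' : T) (q : nat).
Hypotheses (pH : piece e (~: X) H) (EH : ear_set e d X H [set a; b] q).
Hypotheses (pK : piece e (~: X) K) (EK : ear_set e d X K [set a'; b'] q).
Hypotheses (HK : H != K) (dE : d = q + 1).

Let c_le : c <= 2 * q + 5. Proof. by have := ctx_small G; rewrite dE; arith. Qed.
Let q0 : 0 < q. Proof. exact: es_pos EH. Qed.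

Lemma K_walk : exists P p p', [/\ walk e P p p', e a' p, e p' b', uniq P & size P = q] /\
  forall z, z \in P -> z \notin X /\ z \notin H.
Proof.
have [|||P [p [p' [[w ap pb uP PK] sP]]]] := es_ear_walk EK (a := a') (b := b').
- by rewrite !inE eqxx.
- by rewrite !inE eqxx orbT.
- exact: pair_neq EK.
exists P, p, p'; split=> // z /PK zK; split; first exact: (comp_out pK zK).
exact: (other_out pH pK HK zK).
Qed.

(** The two arcs have together at most [2 q + 3] vertices and by [pair_link] at least
    [2 |L| + 2 q + 2], so the link is an edge. *)
Lemma pair_edge I1 u I2 J1 v J2 L : lcycle X (a :: (I1 ++ u :: I2) ++ b :: (J1 ++ v :: J2)) ->
  link e u L v -> uniq L -> (forall z, z \in L -> z \notin X) ->
  [/\ e u v, q <= size I1 + size J1 & q <= size I2 + size J2].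
Proof.
move=> lc l uL LX; have [h1 h2] := pair_link pH EH lc l uL LX.
have [_ _ sz _] := lc; move: sz; rewrite /= !size_cat /= !size_cat /= => sz.
have L0 : L = [::] by apply: size0nil; move: sz h1 h2 c_le; arith.
by rewrite L0 linkE /= in l h1 h2; split; rewrite // -1?(add0n q).
Qed.

(** The lengths leave at most one vertex in [M] and [N] together. As no edge joins [J1] to [J], the
    edge that toughness provides for [H] starts in [a'] or [b'], and the one for [K] ends in [a] or
    [b]. *)
Lemma no_inner_pair M J1 N J : lcycle X (a :: (M ++ a' :: J1 ++ b' :: N) ++ b :: J) -> False.
Proof.
move=> lc; have [gI gJ] := pair_gap pH EH lc.
have lcK : lcycle X (a' :: J1 ++ b' :: N ++ b :: J ++ a :: M).
  have := lcycle_rot (s := a :: M) (t := a' :: J1 ++ b' :: N ++ b :: J).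
  by rewrite /= -!catA /= -!catA /= => h; apply: h; move: lc; rewrite -!catA /= -!catA.
have [gJ1 _] := pair_gap pK EK lcK.
have [_ _ sz _] := lc; move: sz; rewrite /= !size_cat /= !size_cat /= => sz.
have [P [p [p' [[wP ap pb uP sP] PO]]]] := K_walk.
have PX z : z \in P -> z \notin X by case/PO.
have PH z : z \in P -> z \notin H by case/PO.
have wPr := walk_rev esym wP.
have [aS bS] : a \in [set a; b] /\ b \in [set a; b] by rewrite !inE !eqxx orbT.
have ab := pair_neq EH.
have laM : link e a M a'.
  by apply: (cyc_link (s1 := [::]) (s3 := J1 ++ b' :: N ++ b :: J) lc); rewrite /= -!catA /= -!catA.
have lNb : link e b' N b.
  by apply: (cyc_link (s1 := a :: M ++ a' :: J1) (s3 := J) lc); rewrite /= -!catA /= -!catA.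
(* Such an edge would give a walk from [b] to [a] that uses a path through [K] and closes through
   [H]. *)
have no X1 u X2 Y1 v Y2 : J1 = X1 ++ u :: X2 -> J = Y1 ++ v :: Y2 -> e u v -> False.
  move=> J1E JE uv; subst J1 J.
  have l1 : link e b Y1 v.
    by apply: (cyc_link (s1 := a :: M ++ a' :: X1 ++ u :: X2 ++ b' :: N) (s3 := Y2) lc);
      do 4 rewrite /= -?catA.
  have l2 : link e u X2 b'.
    by apply: (cyc_link (s1 := a :: M ++ a' :: X1) (s3 := N ++ b :: Y1 ++ v :: Y2) lc);
      do 4 rewrite /= -?catA.
  rewrite eq_sym in ab.
  apply: (@ear_close _ _ _ _ G X _ H q pH EH _ P (b :: Y1 ++ v :: u :: X2 ++ b' :: rev P ++ a' :: rev M ++ [:: a])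
    b a lc uP PX PH _ bS aS ab).
  - have l3 : link e a' (rev M) a by apply: (link_rev esym).
    wk.
  - cnt.
  - by move: sP sz c_le; szs.
have [I1 [u [I2 [Y1 [v [Y2 [L [IE JE l uL LX]]]]]]]] := pair_tough pH EH lc.
move: (lc); rewrite IE JE => lc1; have [uv h1 h2] := pair_edge lc1 l uL LX.
have [X1 [w [X2 [Z1 [z [Z2 [L' [J1E ZE l' uL' LX']]]]]]]] := pair_tough pK EK lcK.
have {l' uL' LX' L'} [wz h3 h4] : [/\ e w z, q <= size X1 + size Z1 & q <= size X2 + size Z2].
  move: (lcK); rewrite J1E ZE => lcK'; have [h3 h4] := pair_link pK EK lcK' l' uL' LX'.
  have := congr1 size J1E; have := congr1 size ZE; rewrite !size_cat /= !size_cat /= => s1 s2.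
  have L0 : L' = [::] by apply: size0nil; move: sz c_le s1 s2 h3 h4; arith.
  by rewrite L0 linkE /= in l' h3 h4; split; rewrite // -1?(add0n q).
have K0 Q1 Q2 : size Q1 + size (Q2 : seq T) < q -> q <= size Q1 + size Q2 -> False by arith.
have sI := congr1 size IE; have sJ := congr1 size JE; have sJ1 := congr1 size J1E.
rewrite !size_cat /= !size_cat /= in sI sJ sJ1.
have sZ := congr1 size ZE; rewrite !size_cat /= !size_cat /= in sZ.
have hu : [/\ u = a', I1 = M & I2 = J1 ++ b' :: N] \/ [/\ u = b', I1 = M ++ a' :: J1 & I2 = N].
  case: (two_marks IE) => [h|h|[r1 [r2 E]]|h]; [|by left| |by right].
    by exfalso; case: h; move: sI sJ sz c_le gJ1 h1 h2; arith.
  by case: (no _ _ _ _ _ _ E JE uv).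
have hz : [/\ z = b, Z1 = N & Z2 = J ++ a :: M] \/ [/\ z = a, Z1 = N ++ b :: J & Z2 = M].
  case: (two_marks ZE) => [h|h|[r1 [r2 E]]|h]; [|by left| |by right].
    by exfalso; case: h; move: sZ sJ1 sz c_le gJ h3 h4; arith.
  by case: (no _ _ _ _ _ _ J1E E wz).
(* In two of the four cases the lengths are contradictory. In the other two they push the remaining
   ends of the two edges to the ends of [J] and [J1], and a walk over both edges and a path through
   [K] closes through [H]. *)
case: hu => -[uE I1E I2E]; case: hz => -[zE Z1E Z2E]; subst u z I1 I2 Z1 Z2.
- by move: sJ1 sJ sz c_le gJ gJ1 h1 h3; arith.
- have Y20 : Y2 = [::] by apply: size0nil; move: sJ1 sJ sz c_le gJ gJ1 h1; arith.
  have X10 : X1 = [::] by apply: size0nil; move: sJ1 sJ sz c_le gJ gJ1 h4; arith.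
  subst X1 Y2 J J1.
  have l1 : link e b Y1 v.
    by apply: (cyc_link (s1 := a :: M ++ a' :: w :: X2 ++ b' :: N) (s3 := [::]) lc);
      do 4 rewrite /= -?catA.
  have l2 : link e w X2 b'.
    by apply: (cyc_link (s1 := a :: M ++ [:: a']) (s3 := N ++ b :: Y1 ++ [:: v]) lc);
      do 4 rewrite /= -?catA.
  apply: (@ear_close _ _ _ _ G X _ H q pH EH _ P
    (a :: w :: X2 ++ b' :: rev P ++ a' :: v :: rev Y1 ++ [:: b]) a b lc uP PX PH _ aS bS ab).
  - have l3 := link_rev esym l1; wk.
  - cnt.
  - by move: sP sJ1 sJ sz c_le gJ gJ1 q0; szs.
- have Y10 : Y1 = [::] by apply: size0nil; move: sJ1 sJ sz c_le gJ gJ1 h2; arith.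
  have X20 : X2 = [::] by apply: size0nil; move: sJ1 sJ sz c_le gJ gJ1 h3; arith.
  subst X2 Y1 J J1; rewrite eq_sym in ab.
  have l1 : link e v Y2 a.
    have := lcycle_rot (s := [:: a]) (t := (M ++ a' :: (X1 ++ [:: w]) ++ b' :: N) ++ b :: v :: Y2) lc.
    by move=> lc'; apply: (cyc_link (s1 := M ++ a' :: X1 ++ w :: b' :: N ++ [:: b]) (s3 := [::]) lc');
      do 4 rewrite /= -?catA.
  have l2 : link e a' X1 w.
    by apply: (cyc_link (s1 := a :: M) (s3 := b' :: N ++ b :: v :: Y2) lc);
      do 4 rewrite /= -?catA.
  apply: (@ear_close _ _ _ _ G X _ H q pH EH _ P
    (b :: w :: rev X1 ++ a' :: P ++ b' :: v :: Y2 ++ [:: a]) b a lc uP PX PH _ bS aS ab).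
  - have l3 := link_rev esym l2; wk.
  - cnt.
  - by move: sP sJ1 sJ sz c_le gJ gJ1 q0; szs.
by move: sJ1 sJ sz c_le gJ gJ1 h2 h4; arith.
Qed.

End TwoPairs.

Section SharedVertex.

Variables (H K : {set T}) (a b b' : T) (q : nat).
Hypotheses (pH : piece e (~: X) H) (EH : ear_set e d X H [set a; b] q).
Hypotheses (pK : piece e (~: X) K) (EK : ear_set e d X K [set a; b'] q).
Hypotheses (HK : H != K) (dE : d = q + 1).

(** If an edge joins [J1] to [J], a rerouting and the length rules of both components fix all sizes.
    Otherwise toughness for [a], [b], [b'] gives edges from [J1] and from [J] to [N]; the lengths
    then force [N] to have two vertices, and a longer cycle results. *)
Lemma shared_attachment J1 N J : lcycle X (a :: (J1 ++ b' :: N) ++ b :: J) ->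
  [/\ N = [::], size J1 = q + 1 & size J = q + 1].
Proof.
move=> lc; have c_le : c <= 2 * q + 5 by have := ctx_small G; rewrite dE; arith.
have q0 : 0 < q by exact: es_pos EH.
have [gI gJ] := pair_gap pH EH lc.
have lcK : lcycle X (a :: J1 ++ b' :: N ++ b :: J) by move: lc; rewrite -!catA.
have [gJ1 _] := pair_gap pK EK lcK.
have [_ us sz sX] := lc; move: (sz); rewrite /= !size_cat /= => sz'.
have [P [p [p' [[wP ap pb uP sP] PO]]]] := K_walk pH pK EK HK.
have PX z : z \in P -> z \notin X by case/PO.
have PH z : z \in P -> z \notin H by case/PO.
have wPr := walk_rev esym wP.
have [aS bS] : a \in [set a; b] /\ b \in [set a; b] by rewrite !inE !eqxx orbT.
have ab := pair_neq EH; have ba := ab; rewrite eq_sym in ba.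
have direct X1 u X2 Y1 v Y2 : J1 = X1 ++ u :: X2 -> J = Y1 ++ v :: Y2 -> e u v ->
    [/\ N = [::], size J1 = q + 1 & size J = q + 1].
  move=> J1E JE uv; subst J1 J.
  have [/size0nil X20 /size0nil Y10] : size X2 = 0 /\ size Y1 = 0.
    suff : size X2 + size Y1 = 0 by arith.
    apply/eqP; rewrite -leqn0 leqNgt; apply/negP => lt.
    have l1 : link e b Y1 v.
      by apply: (cyc_link (s1 := a :: X1 ++ u :: X2 ++ b' :: N) (s3 := Y2) lc);
        do 4 rewrite /= -?catA.
    have l2 : link e u X2 b'.
      by apply: (cyc_link (s1 := a :: X1) (s3 := N ++ b :: Y1 ++ v :: Y2) lc);
        do 4 rewrite /= -?catA.
    apply: (@ear_close _ _ _ _ G X _ H q pH EH _ P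
      (b :: Y1 ++ v :: u :: X2 ++ b' :: rev P ++ [:: a]) b a lc uP PX PH _ bS aS ba).
    - wk.
    - cnt.
    - by move: sz' sP lt c_le; szs.
  subst X2 Y1.
  have lu : link e u [::] v by rewrite linkE.
  have lc1 : lcycle X (a :: (X1 ++ u :: b' :: N) ++ b :: ([::] ++ v :: Y2)).
    by move: lc; rewrite -!catA.
  have [_ h1 _] := pair_edge pH EH dE lc1 lu isT (fun _ h => False_ind _ (notF h)).
  have lc2 : lcycle X (a :: (X1 ++ u :: [::]) ++ b' :: ((N ++ [:: b]) ++ v :: Y2)).
    by move: lcK; rewrite -!catA.
  have [_ _ h2] := pair_edge pK EK dE lc2 lu isT (fun _ h => False_ind _ (notF h)).
  have N0 : N = [::] by apply: size0nil; move: sz' c_le h1 h2; szs.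
  by split=> //; move: sz' c_le h1 h2; rewrite N0; szs.
have cle z : (a == z) + (count_mem z J1 + ((b' == z) + count_mem z N) +
    ((b == z) + count_mem z J)) <= 1.
  by have := count_le1 z us; rewrite /= !count_cat /=.
pose S' := [set a; b; b'].
have ins z : z \in X :\: S' -> [\/ z \in J1, z \in N | z \in J].
  rewrite !inE !negb_or => /andP[/andP[/andP[za zb] zb']]; rewrite -sX.
  rewrite !(inE, mem_cat) (negPf za) (negPf zb) (negPf zb') /=.
  by case/orP=> [/orP[->|->]|->]; [constructor 1 | constructor 2 | constructor 3].
have out z : [\/ z \in J1, z \in N | z \in J] -> z \in X :\: S'.
  move=> zin; have zX : z \in X.
    by rewrite -sX !(inE, mem_cat); case: zin => ->; rewrite ?orbT.
  rewrite !inE zX andbT; apply/negP => zabb.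
  have := cle z.
  have : 0 < count_mem z J1 + count_mem z N + count_mem z J.
    by case: zin; rewrite -has_pred1 has_count; arith.
  have : 0 < (a == z) + (b == z) + (b' == z).
    by case/orP: zabb => [/orP[]|] /eqP->; rewrite eqxx; arith.
  move: (nat_of_bool _) (nat_of_bool _) (nat_of_bool _) => n1 n2 n3; arith.
have [S'a S'b S'b'] : [/\ a \in S', b \in S' & b' \in S'] by rewrite !inE !eqxx !orbT.
have hd s0 : q <= size s0 -> exists2 z, z \in s0 & z = head a s0.
  by case: s0 => [|z s0] /=; [move: q0; arith | exists z; rewrite ?mem_head].
have disj z s1 s2 : [\/ s1 = J1 /\ s2 = J, s1 = J1 /\ s2 = N | s1 = J /\ s2 = N] ->
    z \in s1 -> z \in s2 -> False.
  move=> h z1 z2; have := cle z.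
  have : 0 < count_mem z s1 by rewrite -has_count has_pred1.
  have : 0 < count_mem z s2 by rewrite -has_count has_pred1.
  by case: h => -[-> ->]; arith.
have SH : [set a; b] \subset S' by apply/subsetP => z; rewrite !inE => /orP[]->; rewrite ?orbT.
have SK : [set a; b'] \subset S' by apply/subsetP => z; rewrite !inE => /orP[]->; rewrite ?orbT.
have S'X : S' \subset X.
  by apply/subsetP => z; rewrite -sX !(inE, mem_cat) => /orP[/orP[]|] ->; rewrite ?orbT.
have S'3 : #|S'| <= 3.
  by rewrite /S' -setUA cardsU1 cards2; case: (_ \notin _); case: (_ != _).
(* Both components count for toughness, so two representatives suffice against the three vertices of
   [S']; the colour is membership in [s0]. *)
have tough2 s0 s1 : (s0 = J1 /\ s1 = J) \/ (s0 = J /\ s1 = J1) -> exists u v L,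
    [/\ u \in s0, v \in s1 \/ v \in N, link e u L v, uniq L & forall z, z \in L -> z \notin X].
  move=> s01; have [z0 z0J z0E] : exists2 z, z \in s0 & z = head a s0.
    by case: s01 => -[-> _]; apply: hd.
  have [z1 z1J z1E] : exists2 z, z \in s1 & z = head a s1.
    by case: s01 => -[_ ->]; apply: hd.
  have d01 z : z \in s0 -> z \in s1 -> False.
    case: s01 => -[-> ->] h1 h2; [apply: (disj z J1 J) | apply: (disj z J1 J)] => //; by constructor 1.
  have z1n : z1 \notin s0 by apply/negP => h; apply: (d01 z1).
  have [||||||||u [v [L [[uX vX fuv l uL] LX]]]] :=
    es_tough2 G pH EH pK EK HK (f := mem s0) (S' := S') (R := [:: z0; z1]) => //.
  - by rewrite /= inE andbT; apply: contra z1n => /eqP<-.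
  - move=> z z01; apply: out; move: z01; rewrite !inE; case: s01 => -[E0 E1] /orP[]/eqP->;
      rewrite -?E0 -?E1 ?z0J ?z1J; [constructor 1|constructor 3|constructor 3|constructor 1] => //.
  - move=> z z'; rewrite !inE => /orP[]/eqP-> /orP[]/eqP->; rewrite // ?z0J ?(negPf z1n) //.
  have cases z : z \in X :\: S' -> z \notin s0 -> z \in s1 \/ z \in N.
    move=> /ins zX zs; case: s01 zs => -[-> ->] /negPf zs; case: zX; rewrite ?zs; by [left | right | ].
  have {}fuv : (u \in s0) != (v \in s0) by exact: fuv.
  move: fuv; case us0: (u \in s0); case vs0: (v \in s0) => // _.
    by exists u, v, L; split=> //; apply: cases => //; rewrite vs0.
  exists v, u, (rev L); split=> //; [ | exact: (link_rev esym) | by rewrite rev_uniq | ].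
    by apply: cases => //; rewrite us0.
  by move=> z; rewrite mem_rev; apply: LX.
have split_at z s0 : z \in s0 -> exists s1 s2, s0 = s1 ++ z :: s2.
  by move=> /splitPr[s1 s2]; exists s1, s2.
have far X1 u X2 Y1 v Y2 L : J1 = X1 ++ u :: X2 -> J = Y1 ++ v :: Y2 -> link e u L v ->
    uniq L -> (forall z, z \in L -> z \notin X) -> [/\ N = [::], size J1 = q + 1 & size J = q + 1].
  move=> J1E JE l uL LX; apply: (direct _ _ _ _ _ _ J1E JE).
  have lc' : lcycle X (a :: (X1 ++ u :: X2 ++ b' :: N) ++ b :: (Y1 ++ v :: Y2)).
    by move: lc; rewrite J1E JE; do 3 rewrite /= -?catA.
  by have [] := pair_edge pH EH dE lc' l uL LX.
have [|u [v [L [uJ [vJ|vN] l uL LX]]]] := tough2 J1 J; first by left.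
  have [X1 [X2 J1E]] := split_at _ _ uJ; have [Y1 [Y2 JE]] := split_at _ _ vJ.
  exact: far J1E JE l uL LX.
have [|u' [v' [L' [u'J [v'J|v'N] l' uL' LX']]]] := tough2 J J1; first by right.
  have [X1 [X2 J1E]] := split_at _ _ v'J; have [Y1 [Y2 JE]] := split_at _ _ u'J.
  apply: (far _ _ _ _ _ _ (rev L') J1E JE); rewrite ?rev_uniq //; first exact: (link_rev esym).
  by move=> z; rewrite mem_rev; apply: LX'.
exfalso; have [X1 [X2 J1E]] := split_at _ _ uJ; have [N1 [N2 NE]] := split_at _ _ vN.
have [Y1 [Y2 JE]] := split_at _ _ u'J; have [M1 [M2 NE']] := split_at _ _ v'N.
have lc1 : lcycle X (a :: (X1 ++ u :: X2) ++ b' :: (N1 ++ v :: N2 ++ b :: J)).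
  by move: lcK; rewrite J1E NE; do 3 rewrite /= -?catA.
have [uv h1 h2] := pair_edge pK EK dE lc1 l uL LX.
have lc2 : lcycle X (a :: ((J1 ++ b' :: M1) ++ v' :: M2) ++ b :: (Y1 ++ u' :: Y2)).
  by move: lc; rewrite JE NE'; do 3 rewrite /= -?catA.
have LX'' z : z \in rev L' -> z \notin X by rewrite mem_rev; apply: LX'.
have uL'' : uniq (rev L') by rewrite rev_uniq.
have [v'u' h3 h4] := pair_edge pH EH dE lc2 (link_rev esym l') uL'' LX''.
have := congr1 size J1E; have := congr1 size JE; have := congr1 size NE; have := congr1 size NE'.
rewrite !size_cat /= => s1 s2 s3 s4.
have X20 : X2 = [::] by apply: size0nil; move: s1 s2 s3 s4 sz' c_le gJ gJ1 h1 h4; arith.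
have Y10 : Y1 = [::] by apply: size0nil; move: s1 s2 s3 s4 sz' c_le gJ gJ1 h1 h4; arith.
have N20 : N2 = [::] by apply: size0nil; move: s1 s2 s3 s4 sz' c_le gJ gJ1 h1 h4; arith.
have M10 : M1 = [::] by apply: size0nil; move: s1 s2 s3 s4 sz' c_le gJ gJ1 h1 h4; arith.
have sN : size N = 2 by move: s1 s2 s3 s4 sz' c_le gJ gJ1 h1 h4; arith.
have NL : N = [:: v'; v].
  move: sN NE; rewrite NE' M10 N20 /=; case: M2 {NE' s1 lc2 h3 h4} => [|g []] //= _.
  case: N1 {h1 h2 lc1 s2} => [|g1 [|g2 N1]] //= => [[_ ->] //|].
  by move/(congr1 size); rewrite /= size_cat /= addnS.
clear NE NE' N20 M10; subst X2 Y1 N J J1.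
have l1 : link e u' Y2 a.
  have := lcycle_rot (s := [:: a]) (t := ((X1 ++ [:: u]) ++ b' :: [:: v'; v]) ++ b :: u' :: Y2) lc.
  by move=> lc'; apply: (cyc_link (s1 := X1 ++ [:: u; b'; v'; v; b]) (s3 := [::]) lc');
    do 4 rewrite /= -?catA.
have l2 : link e u [::] b'.
  by apply: (cyc_link (s1 := a :: X1) (s3 := [:: v'; v] ++ b :: u' :: Y2) lc); do 4 rewrite /= -?catA.
have l3 : link e b' [::] v'.
  by apply: (cyc_link (s1 := a :: X1 ++ [:: u]) (s3 := [:: v] ++ b :: u' :: Y2) lc); do 4 rewrite /= -?catA.
have l4 : link e v [::] b.
  by apply: (cyc_link (s1 := a :: X1 ++ [:: u; b'; v']) (s3 := u' :: Y2) lc); do 4 rewrite /= -?catA.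
rewrite !linkE in l2 l3 l4.
(* Only [X1], of [q - 1] vertices, is omitted, and the way through [H] gains [q]. *)
apply: (@ear_close _ _ _ _ G X _ H q pH EH _ [::]
  (a :: rev Y2 ++ u' :: v' :: b' :: u :: v :: [:: b]) a b lc) => //.
- have l5 := link_rev esym l1; wk.
- cnt.
- by move: s3 s4 sz' gJ gJ1; szs.
Qed.

End SharedVertex.
End TwoAttachments.

Lemma split_at (T : eqType) (z : T) s : z \in s -> exists s1 s2, s = s1 ++ z :: s2.
Proof. by move=> /splitPr[s1 s2]; exists s1, s2. Qed.

(** * The number of vertices off the cycle *)

Section OutsideCount.

Variables (T : finType) (e : rel T) (c d : nat).
Implicit Types (s t D L P Q R I J M N : seq T) (A B : {set T}) (a b : T).
Hypothesis G : tough_ctx e c d.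
Let esym := ctx_sym G.
Local Notation lcycle := (lcycle e c).
Variables (X : {set T}).

Lemma pair_rev a I b J : lcycle X (a :: I ++ b :: J) -> lcycle X (b :: rev I ++ a :: rev J).
Proof.
move=> /(lcycle_rev G); rewrite (_ : rev _ = rev J ++ (b :: rev I ++ [:: a])).
  by move=> /lcycle_rot; rewrite /= -catA.
by rewrite rev_cons rev_cat rev_cons -!cats1 -!catA.
Qed.

Lemma card_cycle s : lcycle X s -> #|X| = c.
Proof. by case=> _ us <- sX; have /card_uniqP <- := us; apply: eq_card => v; rewrite sX. Qed.

Lemma count_one s H : lcycle X s -> piece e (~: X) H -> (forall v, v \notin X -> v \in H) ->
  #|T| = c + #|H|.
Proof.
move=> lc pH h; rewrite -(cardsC X) (card_cycle lc); suff -> : ~: X = H by [].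
by apply/setP => v; rewrite inE; apply/idP/idP => [/h//|]; apply: comp_out pH _.
Qed.

Lemma count_two s H K : lcycle X s -> piece e (~: X) H -> piece e (~: X) K -> H != K ->
  (forall v, v \notin X -> v \in H \/ v \in K) -> #|T| = c + (#|H| + #|K|).
Proof.
move=> lc pH pK HK h; rewrite -(cardsC X) (card_cycle lc); congr (_ + _).
have <- : H :|: K = ~: X.
  apply/setP => v; rewrite !inE; apply/idP/idP => [/orP[]|/h[]->]; rewrite ?orbT //.
    exact: (comp_out pH).
  exact: (comp_out pK).
rewrite cardsU; suff -> : H :&: K = set0 by rewrite cards0 subn0.
apply/setP => v; rewrite !inE; apply/negbTE/negP => /andP[vH vK].
by move: HK; rewrite (piece_disjoint pH pK vH vK) eqxx.
Qed.

(** [K] shares one attachment with [H]; its other one is the cycle neighbour, inside [I], of the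
    other attachment of [H]. *)
Definition near q I J SK a b := [/\ size I = q + 2, size J = q + 1 &
  exists y I', (I = rcons I' y /\ SK = [set a; y]) \/ (I = y :: I' /\ SK = [set b; y])].

Section OneRepresentation.

Variables (H K SK : {set T}) (q : nat).
Hypotheses (pH : piece e (~: X) H) (pK : piece e (~: X) K).
Hypotheses (EK : ear_set e d X K SK q) (SK2 : #|SK| = 2) (HK : H != K) (dE : d = q + 1).

(** [no_inner_pair] excludes that both attachments of [K] are inner vertices of the arc, [es_neq]
    that they are [a] and [b]. What remains is [shared_attachment], up to reversing the cycle. *)
Lemma near_one a b I J : ear_set e d X H [set a; b] q -> lcycle X (a :: I ++ b :: J) ->
  (forall z, z \in SK -> z \in a :: I ++ [:: b]) -> near q I J SK a b.
Proof.
move=> EH lc sub; have ab := pair_neq EH.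
have /eqP/cards2P [p [r [pr SE]]] := SK2.
wlog pc : p r pr SE / p \in I \/ (p = a /\ r = b).
  move=> h; have : p \in a :: I ++ [:: b] by apply: sub; rewrite SE !inE eqxx.
  rewrite !(inE, mem_cat) => /or3P[/eqP pa|pI|/eqP pb].
  - have : r \in a :: I ++ [:: b] by apply: sub; rewrite SE !inE eqxx orbT.
    rewrite !(inE, mem_cat) => /or3P[/eqP ra|rI|/eqP rb]; first by rewrite pa ra eqxx in pr.
      by apply: (h r p); [rewrite eq_sym | rewrite setUC | left].
    by apply: (h p r) => //; right.
  - by apply: (h p r) => //; left.
  have : r \in a :: I ++ [:: b] by apply: sub; rewrite SE !inE eqxx orbT.
  rewrite !(inE, mem_cat) => /or3P[/eqP ra|rI|/eqP rb]; last by rewrite pb rb eqxx in pr.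
    by apply: (h r p); [rewrite eq_sym | rewrite setUC | right].
  by apply: (h r p); [rewrite eq_sym | rewrite setUC | left].
case: pc => [pI|[pa rb]].
- have : r \in a :: I ++ [:: b] by apply: sub; rewrite SE !inE eqxx orbT.
  have [I1 [I2 IE]] := split_at pI; rewrite !(inE, mem_cat) => /or3P[/eqP ra|rI|/eqP rb].
  + have lc' : lcycle X (a :: (I1 ++ p :: I2) ++ b :: J) by rewrite -IE.
    have EK' : ear_set e d X K [set a; p] q by rewrite -ra setUC -SE.
    have [I20 s1 s2] := shared_attachment G pH EH pK EK' HK dE lc'.
    rewrite I20 in IE; split=> //; first by rewrite IE size_cat s1 /=; arith.
    by exists p, I1; left; rewrite IE cats1 SE ra setUC.
  + exfalso; move: rI; rewrite IE mem_cat inE eq_sym (negPf pr) /= => /orP[rI|rI].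
      have [M1 [M2 ME]] := split_at rI; subst I1 I.
      apply: (@no_inner_pair _ _ _ _ G X H K a b r p q pH EH pK _ HK dE M1 M2 I2 J).
        by rewrite setUC -SE.
      by move: lc; rewrite -catA.
    have [M1 [M2 ME]] := split_at rI; subst I2 I.
    apply: (@no_inner_pair _ _ _ _ G X H K a b p r q pH EH pK _ HK dE I1 M1 M2 J) => //.
    by rewrite -SE.
  have EK' : ear_set e d X K [set b; p] q by rewrite -rb setUC -SE.
  have EH' : ear_set e d X H [set b; a] q by rewrite setUC.
  have lc' : lcycle X (b :: (rev I2 ++ p :: rev I1) ++ a :: rev J).
    by have := pair_rev lc; rewrite IE rev_cat rev_cons -cats1 -!catA.
  have [I10 s1 s2] := shared_attachment G pH EH' pK EK' HK dE lc'.
  have {}I10 : I1 = [::] by rewrite -[I1]revK I10.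
  rewrite I10 in IE; rewrite !size_rev in s1 s2; split=> //; first by rewrite IE /= s1; arith.
  by exists p, I2; right; rewrite IE SE rb setUC.
have := es_neq G pH EH pK EK HK lc; rewrite cards2 ab => /(_ erefl).
by rewrite SE pa rb eqxx.
Qed.

(** With one attachment inside [I] and one inside [J], an ear through [K] would be a link of [q]
    vertices between the arcs, and [pair_link] would make the cycle longer than [2 d + 3]. *)
Lemma near_two a b I J : ear_set e d X H [set a; b] q -> lcycle X (a :: I ++ b :: J) ->
  near q I J SK a b \/ near q J I SK b a.
Proof.
move=> EH lc; have EH' : ear_set e d X H [set b; a] q by rewrite setUC.
have lc' := lcycle_rot (s := a :: I) (t := b :: J) lc.
have [_ us sz sX] := lc.
have SX z : z \in SK -> [\/ z = a, z = b, z \in I | z \in J].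
  move=> /(subsetP (es_sub EK)); rewrite -sX !(inE, mem_cat).
  by case/or4P=> [/eqP->|h|/eqP->|h]; [constructor 1 | constructor 3 | constructor 2 | constructor 4].
have [[z [zS zJ]]|noJ] := classic (exists z, z \in SK /\ z \in J); last first.
  left; apply: (near_one EH lc) => z zS; rewrite !(inE, mem_cat).
  case: (SX _ zS) => [->|->|->|h]; rewrite ?eqxx ?orbT //; case: noJ; by exists z.
have [[w [wS wI]]|noI] := classic (exists w, w \in SK /\ w \in I); last first.
  right; apply: (near_one EH' lc') => w wS; rewrite !(inE, mem_cat).
  case: (SX _ wS) => [->|->|h|->]; rewrite ?eqxx ?orbT //; case: noI; by exists w.
exfalso; have wz : w != z.
  apply/eqP => E; move: us; rewrite /= cat_uniq => /andP[_ /and3P[_ /hasPn h _]].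
  by have := h z; rewrite inE zJ orbT /= -E wI => /(_ isT).
have [P [[_ _ _ l [uP PK _]] sP]] := es_ear EK wS zS wz.
have PX v : v \in P -> v \notin X by move=> /PK; exact: (comp_out pK).
have [I1 [I2 IE]] := split_at wI; have [J1 [J2 JE]] := split_at zJ; subst I J.
have [h1 h2] := pair_link G pH EH lc l uP PX.
by move: sz sP (ctx_small G) dE (es_pos EK) h1 h2; szs.
Qed.

End OneRepresentation.

Hypothesis all2 : forall H S q, piece e (~: X) H -> ear_set e d X H S q -> #|S| = 2.

Lemma all2_q s H S q : lcycle X s -> piece e (~: X) H -> ear_set e d X H S q -> d = q + 1.
Proof.
move=> lc pH ES; have [dE _ _] := es_bounds G lc pH ES.
by move: dE; rewrite (all2 pH ES); arith.
Qed.

Lemma pair_arcs s (S : {set T}) : lcycle X s -> S \subset X -> #|S| = 2 -> exists a b I J,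
  S = [set a; b] /\ lcycle X (a :: I ++ b :: J).
Proof.
move=> lc SX S2; have /eqP/cards2P [a [b [ab SE]]] := S2; exists a, b.
have [aX bX] : a \in X /\ b \in X by split; apply: (subsetP SX); rewrite SE !inE eqxx ?orbT.
by have [I [J lc']] := lcycle_at2 lc aX bX ab; exists I, J.
Qed.

(** Reversal and exchange of the arcs turn the four cases of [near] into one normal form. *)
Lemma two_comps s H K SH SK q q' : lcycle X s -> piece e (~: X) H -> piece e (~: X) K -> H != K ->
  ear_set e d X H SH q -> ear_set e d X K SK q' ->
  exists a b y I J, [/\ lcycle X (a :: rcons I y ++ b :: J), SH = [set a; b], SK = [set a; y],
    size I = q + 1 & size J = q + 1].
Proof.
move=> lc pH pK HK EH EK; have dE := all2_q lc pH EH.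
have qq : q' = q by have := all2_q lc pK EK; arith.
rewrite {}qq in EK; have [a [b [I [J [SE lc']]]]] := pair_arcs lc (es_sub EH) (all2 pH EH).
have gen a0 b0 I0 J0 : SH = [set a0; b0] -> lcycle X (a0 :: I0 ++ b0 :: J0) -> near q I0 J0 SK a0 b0 ->
    exists a b y I J, [/\ lcycle X (a :: rcons I y ++ b :: J), SH = [set a; b], SK = [set a; y],
    size I = q + 1 & size J = q + 1].
  move=> SE0 lc0 [s1 s2 [y [I' [[E E']|[E E']]]]].
    exists a0, b0, y, I', J0; split=> //; first by rewrite -E.
    by move: s1; rewrite E size_rcons; arith.
  exists b0, a0, y, (rev I'), (rev J0); split=> //.
  - by have := pair_rev lc0; rewrite E rev_cons.
  - by rewrite SE0 setUC.
  - by move: s1; rewrite E /= size_rev; arith.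
  - by rewrite size_rev.
have EH' : ear_set e d X H [set a; b] q by rewrite -SE.
case: (near_two pH pK EK (all2 pK EK) HK dE EH' lc') => h; first exact: gen SE lc' h.
by apply: (gen b a J I) => //; [rewrite setUC | exact: (lcycle_rot (s := a :: I) (t := b :: J) lc')].
Qed.

(** Seen from [H], the third component is attached at [b] and at the first vertex [y'] of [I], as
    [es_neq] excludes the other case. Seen from [K], it is attached at [a] or [y] and at a vertex of
    [b :: J], which leaves no place for [y']. *)
Lemma three_comps s H K K' SH SK SK' q q' q'' : lcycle X s -> piece e (~: X) H ->
  piece e (~: X) K -> piece e (~: X) K' -> H != K -> H != K' -> K != K' ->
  ear_set e d X H SH q -> ear_set e d X K SK q' -> ear_set e d X K' SK' q'' -> False.
Proof.
move=> lc pH pK pK' HK HK' KK' EH EK EK'.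
have [a [b [y [I [J [lc' SHE SKE sI sJ]]]]]] := two_comps lc pH pK HK EH EK.
have dE := all2_q lc pH EH; have q2 := all2 pK EK; have q3 := all2 pK' EK'.
have qq : q' = q by have := all2_q lc pK EK; arith.
have qq' : q'' = q by have := all2_q lc pK' EK'; arith.
rewrite {}qq in EK; rewrite {}qq' in EK'.
have n12 := es_neq G pK EK pK' EK' KK' lc (all2 pK EK).
rewrite SHE in EH; rewrite SKE in EK n12.
have lcK : lcycle X (a :: I ++ y :: b :: J) by rewrite -cat_rcons.
have [_ us _ _] := lc'.
have hK := near_two pK pK' EK' q3 KK' dE EK lcK.
have hH := near_two pH pK' EK' q3 HK' dE EH lc'.
have {hH} [I' [y' [E SE]]] : exists I' y', rcons I y = y' :: I' /\ SK' = [set b; y'].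
  case: hH => -[s1 s2 [y' [I' h]]]; last by move: s1; rewrite sJ; arith.
  case: h => -[E SE]; last by exists I', y'.
  by move: n12; rewrite SE; have /rcons_inj[_ <-] := E; rewrite eqxx.
have [I0 IE] : exists I0, I = y' :: I0.
  by case: I sI E {lc' lcK us hK} => [|z I0]; [rewrite /=; arith | move=> _ [-> _]; exists I0].
have nb v : v \in [:: a; y; b] ++ J -> v != y'.
  move=> vin; have : uniq (y' :: [:: a; y; b] ++ J).
    by apply: (uniq_count us); rewrite IE -cats1; cnt.
  by rewrite cons_uniq => /andP[h _]; apply: contraNneq h => <-.
have y'S : y' \in SK' by rewrite SE !inE eqxx orbT.
case: hK => -[s1 s2 [z [J' h]]]; first by move: s1; rewrite sI; arith.
have zJ : z \in b :: J by case: h => -[-> _]; rewrite ?mem_rcons mem_head.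
case: h => -[_ h]; move: y'S; rewrite h !inE => /orP[]/eqP y'E.
- by have := nb y'; rewrite -y'E !inE eqxx orbT => /(_ isT).
- by have := nb y'; rewrite mem_cat y'E; move: zJ; rewrite !inE => /orP[]->; rewrite ?orbT eqxx => /(_ isT).
- by have := nb y'; rewrite -y'E !inE eqxx => /(_ isT).
- by have := nb y'; rewrite mem_cat y'E; move: zJ; rewrite !inE => /orP[]->; rewrite ?orbT eqxx => /(_ isT).
Qed.

Theorem two_attachments_count s v0 : lcycle X s -> v0 \notin X ->
  #|T| = c + (d - 1) \/ (c = 2 * d + 3 /\ #|T| = c + 2 * (d - 1)).
Proof.
move=> lc v0X; have get v : v \notin X -> exists H, [/\ piece e (~: X) H, v \in H &
    exists S q, ear_set e d X H S q].
  move=> vX; have vX' : v \in ~: X by rewrite inE.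
  have [H [pH vH]] := piece_exists esym vX'; exists H; split=> //.
  have [S [q ES]] := ear_set_exists G lc pH; by exists S, q.
have [H [pH v0H [S [q ES]]]] := get _ v0X; have dE := all2_q lc pH ES.
have [[v [vX vH]]|one] := classic (exists v, v \notin X /\ v \notin H); last first.
  left; rewrite (count_one lc pH); first by rewrite (es_card ES); move: dE; arith.
  by move=> v vX; apply: contraT => vH; case: one; exists v.
have [K [pK vK [SK [q' EK]]]] := get _ vX; have dE' := all2_q lc pK EK.
have HK : H != K by apply: contraNneq vH => ->.
right; have [a [b [y [I [J [lc' _ _ sI sJ]]]]]] := two_comps lc pH pK HK ES EK.
have cE : c = 2 * d + 3.
  by have [_ _ <- _] := lc'; rewrite /= size_cat size_rcons /= sI sJ dE; arith.
split=> //; rewrite (count_two lc pH pK HK); first by rewrite (es_card ES) (es_card EK); move: dE dE'; arith.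
move=> w wX; apply: NNPP => no; have [K' [pK' wK' [S'' [q'' EK']]]] := get _ wX.
apply: (three_comps lc pH pK pK' HK _ _ ES EK EK').
  by apply/eqP => E; apply: no; left; rewrite E.
by apply/eqP => E; apply: no; right; rewrite E.
Qed.

End OutsideCount.

(** * Components attached at three vertices *)

Section ThreeAttachments.

Variables (T : finType) (e : rel T) (c d : nat).
Implicit Types (s t D L P Q R I J M N : seq T) (A B : {set T}) (a b : T).
Hypothesis G : tough_ctx e c d.
Let esym := ctx_sym G.
Local Notation lcycle := (lcycle e c).
Variables (X S H : {set T}) (q : nat).
Hypotheses (pH : piece e (~: X) H) (ES : ear_set e d X H S q).

Definition hlink u L v :=
  [/\ link e u L v, uniq L, forall z, z \in L -> z \notin X & forall z, z \in L -> z \notin H].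

Lemma hlink_sym u L v : hlink u L v -> hlink v (rev L) u.
Proof.
case=> l uL LX LH; split; rewrite ?rev_uniq //; first exact: link_rev.
  by move=> z; rewrite mem_rev; apply: LX.
by move=> z; rewrite mem_rev; apply: LH.
Qed.

Lemma hlink0 u v : hlink u [::] v -> e u v.
Proof. by case; rewrite linkE. Qed.

Lemma gap_at s1 a I b s2 L : lcycle X (s1 ++ a :: I ++ b :: s2) -> hlink a L b ->
  size L <= size I.
Proof.
move=> lc [l uL LX _]; apply: (gap G (J := s2 ++ s1) _ l uL LX).
by have := lcycle_rot (s := s1) lc; rewrite /= -catA.
Qed.

Lemma gap_at' s1 a I b s2 L : lcycle X (s1 ++ a :: I ++ b :: s2) -> hlink b L a ->
  size L <= size I.
Proof. by move=> lc /hlink_sym h; rewrite -size_rev; apply: gap_at lc h. Qed.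

(** A neighbour off the cycle lies in a component with at least two vertices, whose ears give links
    too long to end in [D]. Otherwise the degree of [u] exceeds the number of its neighbours in
    [D]. *)
Lemma long_link_exists u D s : lcycle X s -> u \in X :\: S ->
  (forall K SK q', piece e (~: X) K -> ear_set e d X K SK q' -> 1 < q') ->
  (forall v L, v \in D -> hlink u L v -> size L <= 1) -> count (e u) D < d ->
  exists v L, [/\ v \in X, v \notin D, v != u, hlink u L v & L = [::] \/ 1 < size L].
Proof.
move=> lc uXS big nD cD; move: (uXS); rewrite inE => /andP[uS uX].
have [[k [kX uk]]|allX] := classic (exists k, k \notin X /\ e u k).
  have kX' : k \in ~: X by rewrite inE.
  have [K [pK kK]] := piece_exists esym kX'.
  have [S' [q' ES']] := ear_set_exists G lc pK.
  have uS' : u \in S' by apply: (es_nb ES' kK uX); rewrite esym.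
  have [v [vS' vu]] : exists v, v \in S' /\ v != u.
    have /card_gt1P [a [b [aS bS ab]]] := es_two ES'.
    have [au|au] := eqVneq a u; last by exists a.
    by exists b; rewrite -au eq_sym.
  have [|P [[_ _ _ l [uP PK _]] sP]] := es_ear ES' uS' vS'; first by rewrite eq_sym.
  have PX z : z \in P -> z \notin X by move=> /PK; exact: (comp_out pK).
  have h : hlink u P v by split=> //; exact: (es_link_avoid G pH ES uXS l PX).
  have P1 : 1 < size P by rewrite sP; exact: big pK ES'.
  exists v, P; split=> //; [exact: (subsetP (es_sub ES')) | | by right].
  by apply/negP => vD; have := nD _ _ vD h; move: P1; arith.
have [v uv vD] : exists2 v, e u v & v \notin D.
  apply: NNPP => no; suff : d <= count (e u) D by rewrite leqNgt cD.
  apply: leq_trans (ctx_deg G u) _; rewrite -size_filter; apply: card_le_size => v.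
  rewrite inE mem_filter => uv; rewrite uv; apply: contraT => vD; case: no; by exists v.
exists v, [::]; split=> //; last 1 first.
- by left.
- by apply: contraT => vX; case: allX; exists v.
- by apply: contraTneq uv => ->; rewrite (ctx_irr G).
by split=> //; apply: link_edge.
Qed.

Section Arcs.

Variables (a1 a2 a3 : T) (W U V : seq T).
Hypothesis B : blocks e c X S [:: (a1, W); (a2, U); (a3, V)].

Lemma arcs_lc : lcycle X (a1 :: W ++ a2 :: U ++ a3 :: V).
Proof. by have := bk_lc B; rewrite /flat /= cats0. Qed.

Lemma arcs_neq : [/\ a1 != a2, a1 != a3 & a2 != a3].
Proof.
have [_ us _ _] := arcs_lc; have : uniq [:: a1; a2; a3] by apply: (uniq_count us); cnt.
by rewrite /= !inE negb_or andbT => /andP[/andP[-> ->] ->].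
Qed.

Lemma arcs_rot : blocks e c X S [:: (a2, U); (a3, V); (a1, W)].
Proof. exact: (blocks_rot (bl := [:: (a1, W)]) B). Qed.

Lemma arcs_rev : blocks e c X S [:: (a2, rev W); (a1, rev V); (a3, rev U)].
Proof.
have := lcycle_rev G arcs_lc.
rewrite (_ : rev _ = (rev V ++ a3 :: rev U) ++ (a2 :: rev W ++ [:: a1])); last first.
  by rewrite rev_cons rev_cat rev_cons rev_cat rev_cons -!cats1 -!catA.
move=> /lcycle_rot lc; split.
- by move: lc; rewrite /flat /= cats0 -!catA.
- by move=> b; rewrite !inE => /or3P[]/eqP-> /=;
    [apply: (bk_in B (b := (a2, U))) | apply: (bk_in B (b := (a1, W))) |
     apply: (bk_in B (b := (a3, V)))]; rewrite !inE eqxx ?orbT.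
by move=> b z; rewrite !inE => /or3P[]/eqP-> /=; rewrite mem_rev;
  [apply: (bk_out B (b := (a1, W))) | apply: (bk_out B (b := (a3, V))) |
     apply: (bk_out B (b := (a2, U)))]; rewrite !inE eqxx ?orbT.
Qed.

Lemma arcs_S : [/\ a1 \in S, a2 \in S & a3 \in S].
Proof.
by split; [apply: (bk_in B (b := (a1, W))) | apply: (bk_in B (b := (a2, U))) |
  apply: (bk_in B (b := (a3, V)))]; rewrite !inE eqxx ?orbT.
Qed.

Lemma arcs_out z : z \in W ++ U ++ V -> z \in X :\: S.
Proof.
rewrite !mem_cat => /or3P[h|h|h]; [apply: (bk_sub B (b := (a1, W))) h
  | apply: (bk_sub B (b := (a2, U))) h | apply: (bk_sub B (b := (a3, V))) h];
  by rewrite !inE eqxx ?orbT.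
Qed.

Lemma ruleWU I1 u I2 J1 v J2 L : W = I1 ++ u :: I2 -> U = J1 ++ v :: J2 -> hlink u L v ->
  size L + q <= size I1 + size J1 /\ size L + q <= size I2 + size J2.
Proof.
move=> WE UE [l uL LX _]; have [a12 _ _] := arcs_neq.
by apply: (es_link G pH ES B (b := (a1, W)) (b' := (a2, U)) _ _ _ WE UE l uL LX);
  rewrite ?inE ?xpair_eqE ?eqxx ?orbT // (negPf a12).
Qed.

Lemma ruleWV I1 u I2 J1 v J2 L : W = I1 ++ u :: I2 -> V = J1 ++ v :: J2 -> hlink u L v ->
  size L + q <= size I1 + size J1 /\ size L + q <= size I2 + size J2.
Proof.
move=> WE UE [l uL LX _]; have [_ a13 _] := arcs_neq.
by apply: (es_link G pH ES B (b := (a1, W)) (b' := (a3, V)) _ _ _ WE UE l uL LX);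
  rewrite ?inE ?xpair_eqE ?eqxx ?orbT // (negPf a13).
Qed.

Lemma ruleUV I1 u I2 J1 v J2 L : U = I1 ++ u :: I2 -> V = J1 ++ v :: J2 -> hlink u L v ->
  size L + q <= size I1 + size J1 /\ size L + q <= size I2 + size J2.
Proof.
move=> WE UE [l uL LX _]; have [_ _ a23] := arcs_neq.
by apply: (es_link G pH ES B (b := (a2, U)) (b' := (a3, V)) _ _ _ WE UE l uL LX);
  rewrite ?inE ?xpair_eqE ?eqxx ?orbT // (negPf a23).
Qed.

Lemma arcs_close L t (y z : T) : (exists u v, hlink u L v) -> walk e t y z ->
  y \in S -> z \in S -> y != z ->
  (forall v, count_mem v t <= count_mem v ((a1 :: W ++ a2 :: U ++ a3 :: V) ++ L)) ->
  size (a1 :: W ++ a2 :: U ++ a3 :: V) < size t + q -> False.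
Proof.
move=> [u [v [_ uL LX LH]]].
exact: (ear_close G pH ES arcs_lc uL LX LH).
Qed.

Lemma arcs_close0 t (y z : T) : walk e t y z -> y \in S -> z \in S -> y != z ->
  (forall v, count_mem v t <= count_mem v (a1 :: W ++ a2 :: U ++ a3 :: V)) ->
  size (a1 :: W ++ a2 :: U ++ a3 :: V) < size t + q -> False.
Proof.
by move=> w yS zS yz ct lt; apply: (ear_close G pH ES (L := [::]) arcs_lc _ _ _ w) => // v; rewrite cats0.
Qed.

End Arcs.
End ThreeAttachments.

(** * Two-vertex components: interval sizes two, three, three *)

Section PairComponents.

Variables (T : finType) (e : rel T) (c : nat).
Implicit Types (s t D L P Q R I J M N : seq T) (A B : {set T}) (a b : T).
Hypothesis G : tough_ctx e c 4.
Let esym := ctx_sym G.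
Variables (X S H : {set T}).
Hypotheses (pH : piece e (~: X) H) (ES : ear_set e 4 X H S 2).
Hypothesis big : forall K SK q', piece e (~: X) K -> ear_set e 4 X K SK q' -> 1 < q'.
Local Notation hlink := (hlink e X H).

Section Sizes233.

Definition b233 (a1 w1 w2 a2 u1 u2 u3 a3 v1 v2 v3 : T) :=
  [:: (a1, [:: w1; w2]); (a2, [:: u1; u2; u3]); (a3, [:: v1; v2; v3])].

Lemma b233_rev a1 w1 w2 a2 u1 u2 u3 a3 v1 v2 v3 :
  blocks e c X S (b233 a1 w1 w2 a2 u1 u2 u3 a3 v1 v2 v3) ->
  blocks e c X S (b233 a2 w2 w1 a1 v3 v2 v1 a3 u3 u2 u1).
Proof. by move=> B; exact: (arcs_rev G B). Qed.

Variables (a1 w1 w2 a2 u1 u2 u3 a3 v1 v2 v3 : T).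
Hypothesis B : blocks e c X S (b233 a1 w1 w2 a2 u1 u2 u3 a3 v1 v2 v3).

Let lc := arcs_lc B.
Let cl0 := arcs_close0 G pH ES B.

Lemma mem233 v : v \in X -> [\/ v \in [:: a1; a2; a3], v \in [:: w1; w2],
  v \in [:: u1; u2; u3] | v \in [:: v1; v2; v3]].
Proof.
have p : perm_eq (a1 :: [:: w1; w2] ++ a2 :: [:: u1; u2; u3] ++ a3 :: [:: v1; v2; v3])
    ([:: a1; a2; a3] ++ [:: w1; w2] ++ [:: u1; u2; u3] ++ [:: v1; v2; v3]).
  by apply/permP => f; rewrite /=; arith.
have [_ _ _ <-] := lc; rewrite (perm_mem p) 3!mem_cat.
by case/or4P; [constructor 1 | constructor 2 | constructor 3 | constructor 4].
Qed.

(** Two linked intervals have at least [2 q + 2 = 6] vertices, and here there are only five. *)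
Lemma linkW v r L : v \in [:: w1; w2] -> r \in [:: u1; u2; u3] ++ [:: v1; v2; v3] ->
  hlink v L r -> False.
Proof.
have nu I1 u I2 J1 r0 J2 : [:: w1; w2] = I1 ++ u :: I2 -> [:: u1; u2; u3] = J1 ++ r0 :: J2 ->
    hlink u L r0 -> False.
  move=> E E' h; have [h1 h2] := ruleWU G pH ES B E E' h.
  by have := congr1 size E; have := congr1 size E'; move: h1 h2; szs.
have nv I1 u I2 J1 r0 J2 : [:: w1; w2] = I1 ++ u :: I2 -> [:: v1; v2; v3] = J1 ++ r0 :: J2 ->
    hlink u L r0 -> False.
  move=> E E' h; have [h1 h2] := ruleWV G pH ES B E E' h.
  by have := congr1 size E; have := congr1 size E'; move: h1 h2; szs.
move=> vW; have [I1 [I2 E]] := split_at vW; rewrite mem_cat => /orP[/split_at|/split_at].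
  by move=> [J1 [J2 E']]; apply: nu E E'.
by move=> [J1 [J2 E']]; apply: nv E E'.
Qed.

(** Six vertices are the minimum for linked intervals, so both length rules are equalities: the link
    is an edge between mirror positions. *)
Lemma linkUV u r L : u \in [:: u1; u2; u3] -> r \in [:: v1; v2; v3] -> hlink u L r ->
  L = [::] /\ [\/ u = u1 /\ r = v3, u = u2 /\ r = v2 | u = u3 /\ r = v1].
Proof.
move=> uU rV h; have [I1 [I2 E]] := split_at uU; have [J1 [J2 E']] := split_at rV.
have [h1 h2] := ruleUV G pH ES B E E' h.
have := congr1 size E; have := congr1 size E'; rewrite !size_cat /= => s1 s2.
split; first by apply: size0nil; move: s1 s2 h1 h2; arith.
case: I1 E s2 h1 => [|i1 [|i2 [|i3 I1]]] E s2 h1; [| | |by move: s2 => /=; arith];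
case: J1 E' s1 h1 => [|j1 [|j2 [|j3 J1]]] E' s1 h1; try (by exfalso; move: s1 s2 h1 h2 => /=; arith);
move: E E'.
- by move=> [-> _] [_ _ -> _]; constructor 1.
- by move=> [_ -> _] [_ -> _]; constructor 2.
- by move=> [_ _ -> _] [-> _]; constructor 3.
Qed.


Let cs := let: And4 cs _ _ _ := lc in cs.

Lemma cycle233 : [/\ e a1 w1, e w1 w2, e w2 a2, e a2 u1 & e u1 u2] /\
  [/\ e u2 u3, e u3 a3, e a3 v1, e v1 v2 & e v2 v3 /\ e v3 a1].
Proof.
by move: cs; rewrite /=; do 10 (case/andP=> ? ); case/andP=> ? _.
Qed.

Let uu : [/\ u1 != u2, u1 != u3 & u2 != u3].
Proof.
have : uniq [:: u1; u2; u3] by have [_ us _ _] := lc; apply: (uniq_count us); cnt.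
by rewrite /= !inE negb_or andbT => /andP[/andP[-> ->] ->].
Qed.

Let aS := arcs_S B.
Let an := arcs_neq B.

Let clh u L r (h : hlink u L r) t (y z : T) w yS zS yz ct lt :=
  @arcs_close _ _ _ _ G X S H 2 pH ES _ _ _ _ _ _ B L t y z
    (ex_intro _ u (ex_intro _ r h)) w yS zS yz ct lt.

(** Degree four gives [u3] a link that ends outside [u1], [u2], [a3]. It ends in [a1], in [a2] or,
    as an edge, in [v1]; each of these gives a longer cycle. *)
Lemma no_u1v3 : e u1 v3 -> False.
Proof.
move=> e13; have [[e1 e2 e3 e4 e5] [e6 e7 e8 e9 [e10 e11]]] := cycle233.
have [a1S a2S a3S] := aS; have [a12 a13 a23] := an.
have [|||r [L [rX rD ru h L01]]] := long_link_exists G pH ES lc (u := u3) (D := [:: u1; u2; a3]) _ big.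
- by apply: (arcs_out B); rewrite !inE eqxx ?orbT.
- move=> v L; rewrite !inE => /or3P[]/eqP-> h.
  + by apply: (gap_at' G (s1 := [:: a1; w1; w2; a2]) (a := u1) (I := [:: u2]) (b := u3)) h; exact: lc.
  + by apply: leq_trans (gap_at' G (s1 := [:: a1; w1; w2; a2; u1]) (a := u2) (I := [::]) (b := u3) lc h) _.
  + by apply: leq_trans (gap_at G (s1 := [:: a1; w1; w2; a2; u1; u2]) (a := u3) (I := [::]) (b := a3) lc h) _.
- by apply: leq_ltn_trans (count_size _ _) _.
have [l _ _ _] := h; case: (mem233 rX) => rin.
- move: rD rin; rewrite !inE !negb_or => /and3P[_ _ ra3] /or3P[]/eqP E; subst r.
  + apply: (clh (t := [:: a3; v1; v2; v3; u1; u2; u3] ++ L ++ [:: a1; w1; w2; a2])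
      h (y := a3) (z := a2)) => //; [wk | by rewrite eq_sym | cnt | szs].
  + apply: (clh (t := [:: a3; v1; v2; v3; u1; u2; u3] ++ L ++ [:: a2; w2; w1; a1])
      h (y := a3) (z := a1)) => //; [wk | by rewrite eq_sym | cnt | szs].
  + by rewrite eqxx in ra3.
- by apply: (linkW (v := r) (r := u3) rin _ (hlink_sym G h)); rewrite !inE eqxx ?orbT.
- by move: rD rin; rewrite !inE !negb_or (negPf ru) => /and3P[/negPf-> /negPf-> _].
have [L0 h3] := linkUV (u := u3) ltac:(by rewrite !inE eqxx ?orbT) rin h.
rewrite {}L0 in h; have u3r := hlink0 h.
have rv1 : r = v1.
  have [u12 u13 u23] := uu.
  by case: h3 => -[E E'] //; [move: u13 | move: u23]; rewrite E eqxx.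
subst r; apply: (cl0 (t := [:: a3; u3; v1; v2; v3; u1; a2; w2; w1; a1]) (y := a3) (z := a1)) => //;
  [by rewrite /= !eqxx (esym a3) e7 u3r e9 e10 (esym v3) e13 (esym u1) e4 (esym a2) e3 (esym w2) e2 (esym w1) e1
  | by rewrite eq_sym | cnt ].
Qed.


(** Degree four gives [u1] a link that ends outside [a2], [u2], [u3]. Every end but [a1] is
    excluded, and so is a long link to [a1]. *)
Lemma u3v1_u1a1 : e u3 v1 -> e u1 a1.
Proof.
move=> e31; have [[e1 e2 e3 e4 e5] [e6 e7 e8 e9 [e10 e11]]] := cycle233.
have [a1S a2S a3S] := aS; have [a12 a13 a23] := an; have [u12 u13 u23] := uu.
have [|||r [L [rX rD ru h L01]]] := long_link_exists G pH ES lc (u := u1) (D := [:: a2; u2; u3]) _ big.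
- by apply: (arcs_out B); rewrite !inE eqxx ?orbT.
- move=> v L; rewrite !inE => /or3P[]/eqP-> h.
  + by apply: leq_trans (gap_at' G (s1 := [:: a1; w1; w2]) (a := a2) (I := [::]) (b := u1) lc h) _.
  + by apply: leq_trans (gap_at G (s1 := [:: a1; w1; w2; a2]) (a := u1) (I := [::]) (b := u2) lc h) _.
  + by apply: (gap_at G (s1 := [:: a1; w1; w2; a2]) (a := u1) (I := [:: u2]) (b := u3)) h; exact: lc.
- by apply: leq_ltn_trans (count_size _ _) _.
have [l _ _ _] := h; case: (mem233 rX) => rin.
- move: rD rin; rewrite !inE !negb_or => /and3P[ra2 _ _] /or3P[]/eqP E; subst r.
  + case: L01 => [L0|L1]; first by move: h; rewrite L0 => /hlink0.
    exfalso; apply: (clh (t := [:: a3; u3; u2; u1] ++ L ++ [:: a1; w1; w2; a2])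
      h (y := a3) (z := a2)) => //; [wk | by rewrite eq_sym | cnt | move: L1; szs].
  + by rewrite eqxx in ra2.
  + exfalso; apply: (clh (t := (a3 :: rev L) ++ [:: u1; u2; u3; v1; v2; v3; a1; w1; w2; a2])
      h (y := a3) (z := a2)) => //; [ | cnt | szs].
    by rewrite cat_cons; wk.
- by exfalso; apply: (linkW (v := r) (r := u1) rin _ (hlink_sym G h)); rewrite !inE eqxx ?orbT.
- by move: rD rin; rewrite !inE !negb_or (negPf ru) => /and3P[_ /negPf-> /negPf->].
have [L0 h3] := linkUV (u := u1) ltac:(by rewrite !inE eqxx ?orbT) rin h.
rewrite {}L0 in h; have ur := hlink0 h.
case: h3 => -[E E']; [by case: no_u1v3; rewrite -E' | by rewrite E eqxx in u12
 | by rewrite E eqxx in u13].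
Qed.

(** [linkW] shuts [w1] off from the other intervals, so its link that avoids [a1], [w2] and [a2] can
    only end in [a3]. *)
Lemma w1_a3 : exists L, hlink w1 L a3.
Proof.
have [|||r [L [rX rD ru h L01]]] := long_link_exists G pH ES lc (u := w1) (D := [:: a1; w2; a2]) _ big.
- by apply: (arcs_out B); rewrite !inE eqxx ?orbT.
- move=> v L; rewrite !inE => /or3P[]/eqP-> h.
  + by apply: leq_trans (gap_at' G (s1 := [::]) (a := a1) (I := [::]) (b := w1) lc h) _.
  + by apply: leq_trans (gap_at G (s1 := [:: a1]) (a := w1) (I := [::]) (b := w2) lc h) _.
  + by apply: (gap_at G (s1 := [:: a1]) (a := w1) (I := [:: w2]) (b := a2)) h; exact: lc.
- by apply: leq_ltn_trans (count_size _ _) _.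
have nW : r \in [:: u1; u2; u3] ++ [:: v1; v2; v3] -> False.
  by move=> rin; apply: (linkW (v := w1) (r := r) _ rin h); rewrite !inE eqxx.
case: (mem233 rX) => rin; try by case: nW; rewrite mem_cat rin ?orbT.
  by move: rD rin; rewrite !inE !negb_or => /and3P[/negPf-> _ /negPf->] /eqP E; exists L; rewrite -E.
by move: rD rin; rewrite !inE !negb_or (negPf ru) => /and3P[_ /negPf-> _].
Qed.

Lemma u2v2_u1u3 L : e u2 v2 -> hlink u1 L u3 -> False.
Proof.
move=> e22 h; have [[e1 e2 e3 e4 e5] [e6 e7 e8 e9 [e10 e11]]] := cycle233.
have [a1S a2S a3S] := aS; have [a12 a13 a23] := an; have [l _ _ _] := h.
apply: (clh (t := [:: a1; w1; w2; a2; u1] ++ L ++ [:: u3; u2; v2; v1; a3])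
      h (y := a1) (z := a3)) => //; [wk | cnt | szs].
Qed.

Lemma some_edge233 : [\/ e u1 v3, e u2 v2 | e u3 v1].
Proof.
have [b1 [b2 [I1 [u [I2 [J1 [v [J2 [L [[b1B b2B b12 E E'] [l uL LX]]]]]]]]]]] :=
  es_tough_blocks G pH ES B.
have ub : u \in b1.2 by rewrite E mem_cat mem_head orbT.
have vb : v \in b2.2 by rewrite E' mem_cat mem_head orbT.
have h : hlink u L v.
  by split=> //; apply: (es_link_avoid G pH ES _ l LX); apply: (bk_sub B b1B).
have hs := hlink_sym G h.
have fin y r M : y \in [:: u1; u2; u3] -> r \in [:: v1; v2; v3] -> hlink y M r ->
    [\/ e u1 v3, e u2 v2 | e u3 v1].
  move=> yU rV hy; have [M0 p] := linkUV yU rV hy; rewrite M0 in hy; have yr := hlink0 hy.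
  by case: p => -[E1 E2]; rewrite E1 E2 in yr; [constructor 1 | constructor 2 | constructor 3].
move: b1B b2B b12 ub vb {E E'}; rewrite !inE => /or3P[]/eqP-> /or3P[]/eqP->; rewrite ?eqxx //= => _ ub vb;
  try (by exfalso; apply: (linkW _ _ h); rewrite ?mem_cat ?ub ?vb ?orbT);
  try (by exfalso; apply: (linkW _ _ hs); rewrite ?mem_cat ?ub ?vb ?orbT).
- exact: fin ub vb h.
- exact: fin vb ub hs.
Qed.

End Sizes233.
Lemma no_u3v1 a1 w1 w2 a2 u1 u2 u3 a3 v1 v2 v3 :
  blocks e c X S (b233 a1 w1 w2 a2 u1 u2 u3 a3 v1 v2 v3) -> e u3 v1 -> False.
Proof.
move=> B e31; have B' := b233_rev B.
have eu := u3v1_u1a1 B e31; have ev : e v3 a2 by apply: (u3v1_u1a1 B'); rewrite esym.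
have [L h] := w1_a3 B; have [l _ _ _] := h.
have [[e1 e2 e3 e4 e5] [e6 e7 e8 e9 [e10 e11]]] := cycle233 B.
have [a1S a2S a3S] := arcs_S B; have [a12 a13 a23] := arcs_neq B.
apply: (arcs_close G pH ES B (L := L) (t := [:: a1; u1; u2; u3; v1; v2; v3; a2; w2; w1] ++ L ++ [:: a3])
  (y := a1) (z := a3)) => //; [by exists w1, a3 | wk | cnt | szs].
Qed.

(** Only the edge from [u2] to [v2] can link the two larger intervals. Then [S] with [u2] and [v2]
    has five vertices and leaves, besides [H], five classes that no link connects: [w1] with [w2],
    and four single vertices. *)
Lemma no_intervals233 a1 w1 w2 a2 u1 u2 u3 a3 v1 v2 v3 :
  blocks e c X S (b233 a1 w1 w2 a2 u1 u2 u3 a3 v1 v2 v3) -> False.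
Proof.
move=> B; have B' := b233_rev B; have [n1 n2] := (no_u1v3 B, no_u3v1 B).
have e22 : e u2 v2 by case: (some_edge233 B).
have out := arcs_out B; have lc := arcs_lc B; have [_ us _ _] := lc.
have uR : uniq [:: w1; u1; u3; v1; v3] by apply: (uniq_count us); cnt.
have ur : uniq [:: w2; w1; u1; u3; v1; v3] by apply: (uniq_count us); cnt.
have u2n : u2 \notin [:: w1; u1; u3; v1; v3].
  have : uniq (u2 :: [:: w1; u1; u3; v1; v3]) by apply: (uniq_count us); cnt.
  by rewrite cons_uniq => /andP[].
have v2n : v2 \notin [:: w1; u1; u3; v1; v3].
  have : uniq (v2 :: [:: w1; u1; u3; v1; v3]) by apply: (uniq_count us); cnt.
  by rewrite cons_uniq => /andP[].
have w2n : w2 \notin [:: w1; u1; u3; v1; v3] by move: ur; rewrite cons_uniq => /andP[].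
have [u2X v2X] : u2 \in X :\: S /\ v2 \in X :\: S by split; apply: out; rewrite !inE eqxx ?orbT.
have S3 : #|S| = 3 by have [dE _ _] := es_bounds G lc pH ES; move: dE; arith.
pose S' := u2 |: (v2 |: S).
(* The colour merges [w2] with [w1], since these two are adjacent. *)
have [||||||u [v [L [[uX vX fuv l uL] LX]]]] := @es_tough _ _ _ _ G _ _ pH _ _ ES _
  (fun z => if z == w2 then w1 else z) S' [:: w1; u1; u3; v1; v3].
- by apply/subsetP => z zS; rewrite !inE zS !orbT.
- apply/subsetP => z; rewrite !inE => /or3P[/eqP->|/eqP->|]; last exact: (subsetP (es_sub ES)).
    by move: u2X; rewrite inE => /andP[].
  by move: v2X; rewrite inE => /andP[].
- by [].
- by rewrite /S' !cardsU1 S3; case: (_ \notin _); case: (_ \notin _).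
- move=> z zR; have : z \in X :\: S.
    by apply: out; move: zR; rewrite !inE => /or4P[->|->|->|/orP[]->]; rewrite ?orbT.
  rewrite !inE !negb_or => /andP[-> ->]; rewrite !andbT; apply/andP; split.
    by apply: contraNneq u2n => <-.
  by apply: contraNneq v2n => <-.
- have nw z : z \in [:: w1; u1; u3; v1; v3] -> (z == w2) = false.
    by move=> zR; apply: contraNF w2n => /eqP<-.
  by move=> z z' /nw-> /nw->.
have mem z : z \in X :\: S' -> z \in X :\: S /\
    [\/ z \in [:: w1; w2], z \in [:: u1; u3] | z \in [:: v1; v3]].
  rewrite !in_setD !in_setU1 !negb_or => /andP[/and3P[zu zv zS] zX]; rewrite zS zX; split=> //.
  case: (mem233 B zX) => h; [ | by constructor 1 | constructor 2 | constructor 3].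
  - have [a1S a2S a3S] := arcs_S B; move: h zS; rewrite !inE.
    by case/or3P=> /eqP->; rewrite ?a1S ?a2S ?a3S.
  - by move: h; rewrite !inE (negPf zu).
  - by move: h; rewrite !inE (negPf zv).
have [uXS um] := mem _ uX; have [vXS vm] := mem _ vX.
have h : hlink u L v by split=> //; apply: (es_link_avoid G pH ES uXS l LX).
have sub2 (p1 p2 p3 z : T) : z \in [:: p1; p3] -> z \in [:: p1; p2; p3].
  by rewrite !inE => /orP[]->; rewrite ?orbT.
have nW y r M : y \in [:: w1; w2] -> r \in [:: u1; u3] \/ r \in [:: v1; v3] -> hlink y M r -> False.
  move=> yW rUV; apply: (linkW B yW); rewrite mem_cat.
  by case: rUV => /sub2 ->; rewrite ?orbT.
have nUV y r M : y \in [:: u1; u3] -> r \in [:: v1; v3] -> hlink y M r -> False.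
  move=> yU rV hy; have [M0 p] := linkUV B (sub2 _ _ _ _ yU) (sub2 _ _ _ _ rV) hy.
  rewrite M0 in hy; have yr := hlink0 hy; case: p => -[E1 E2]; rewrite E1 E2 in yr.
  - exact: n1 yr.
  - by move: (sub2 u1 u2 u3 y yU) u2n; move: yU; rewrite E1 !inE => /orP[]->; rewrite ?orbT.
  - exact: n2 yr.
have same (p1 p3 y r : T) : y \in [:: p1; p3] -> r \in [:: p1; p3] -> y != r ->
    (y = p1 /\ r = p3) \/ (y = p3 /\ r = p1).
  rewrite !inE => /orP[]/eqP-> /orP[]/eqP->; rewrite ?eqxx //; by [left | right].
have uv : u != v by apply: contra fuv => /eqP->.
have hs := hlink_sym G h.
case: um => um; case: vm => vm.
- move: fuv; case: (same _ _ _ _ um vm uv) => -[-> ->]; rewrite eqxx; case: (w1 =P w2) => [->|_]; rewrite ?eqxx //.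
- by apply: (nW _ _ _ um _ h); left.
- by apply: (nW _ _ _ um _ h); right.
- by apply: (nW _ _ _ vm _ hs); left.
- case: (same _ _ _ _ um vm uv) => -[uE vE]; rewrite uE vE in h hs.
    exact: (u2v2_u1u3 B e22 h).
  exact: (u2v2_u1u3 B e22 hs).
- exact: (nUV _ _ _ um vm h).
- by apply: (nW _ _ _ vm _ hs); right.
- exact: (nUV _ _ _ vm um hs).
case: (same _ _ _ _ um vm uv) => -[uE vE]; rewrite uE vE in h hs.
  by apply: (u2v2_u1u3 B' _ hs); rewrite esym.
by apply: (u2v2_u1u3 B' _ h); rewrite esym.
Qed.

End PairComponents.

(** * Two-vertex components: interval sizes two, two, four *)

Section PairComponents.

Variables (T : finType) (e : rel T) (c : nat).
Implicit Types (s t D L P Q R I J M N : seq T) (A B : {set T}) (a b : T).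
Hypothesis G : tough_ctx e c 4.
Let esym := ctx_sym G.
Local Notation lcycle := (lcycle e c).
Variables (X S H : {set T}).
Hypotheses (pH : piece e (~: X) H) (ES : ear_set e 4 X H S 2).
Hypothesis big : forall K SK q', piece e (~: X) K -> ear_set e 4 X K SK q' -> 1 < q'.
Local Notation hlink := (hlink e X H).

Definition b224 (a1 w1 w2 a2 u1 u2 a3 v1 v2 v3 v4 : T) :=
  [:: (a1, [:: w1; w2]); (a2, [:: u1; u2]); (a3, [:: v1; v2; v3; v4])].

Lemma b224_rev a1 w1 w2 a2 u1 u2 a3 v1 v2 v3 v4 :
  blocks e c X S (b224 a1 w1 w2 a2 u1 u2 a3 v1 v2 v3 v4) ->
  blocks e c X S (b224 a3 u2 u1 a2 w2 w1 a1 v4 v3 v2 v1).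
Proof.
by move=> B; have := arcs_rev G B => B'; exact: (arcs_rot (arcs_rot B')).
Qed.

Section Sizes224.

Variables (a1 w1 w2 a2 u1 u2 a3 v1 v2 v3 v4 : T).
Hypothesis B : blocks e c X S (b224 a1 w1 w2 a2 u1 u2 a3 v1 v2 v3 v4).

Let lc := arcs_lc B.
Let aS := arcs_S B.
Let an := arcs_neq B.
Let clh u L r (h : hlink u L r) t (y z : T) w yS zS yz ct lt :=
  @arcs_close _ _ _ _ G X S H 2 pH ES _ _ _ _ _ _ B L t y z
    (ex_intro _ u (ex_intro _ r h)) w yS zS yz ct lt.

Lemma mem224 v : v \in X -> [\/ v \in [:: a1; a2; a3], v \in [:: w1; w2],
  v \in [:: u1; u2] | v \in [:: v1; v2; v3; v4]].
Proof.
have p : perm_eq (a1 :: [:: w1; w2] ++ a2 :: [:: u1; u2] ++ a3 :: [:: v1; v2; v3; v4])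
    ([:: a1; a2; a3] ++ [:: w1; w2] ++ [:: u1; u2] ++ [:: v1; v2; v3; v4]).
  by apply/permP => f; rewrite /=; arith.
have [_ _ _ <-] := lc; rewrite (perm_mem p) 3!mem_cat.
by case/or4P; [constructor 1 | constructor 2 | constructor 3 | constructor 4].
Qed.

Lemma linkWU v r L : v \in [:: w1; w2] -> r \in [:: u1; u2] -> hlink v L r -> False.
Proof.
move=> vW rU h; have [I1 [I2 E]] := split_at vW; have [J1 [J2 E']] := split_at rU.
have [h1 h2] := ruleWU G pH ES B E E' h.
by have := congr1 size E; have := congr1 size E'; move: h1 h2; szs.
Qed.

Let at_mid I1 I2 J1 J2 (p1 p2 u r : T) L : [:: p1; p2] = I1 ++ u :: I2 ->
  [:: v1; v2; v3; v4] = J1 ++ r :: J2 ->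
  size L + 2 <= size I1 + size J1 -> size L + 2 <= size I2 + size J2 ->
  L = [::] /\ (u = p1 /\ r = v3 \/ u = p2 /\ r = v2).
Proof.
move=> E E' h1 h2; have := congr1 size E; have := congr1 size E'; rewrite !size_cat /= => s1 s2.
split; first by apply: size0nil; move: s1 s2 h1 h2; arith.
case: I1 E s2 h1 => [|i1 [|i2 I1]] E s2 h1; [| |by move: s2 => /=; arith];
case: J1 E' s1 h1 => [|j1 [|j2 [|j3 J1]]] E' s1 h1; try (by exfalso; move: s1 s2 h1 h2 => /=; arith);
move: E E'.
- by move=> [-> _] [_ _ -> _]; left.
- by move=> [_ -> _] [_ -> _]; right.
Qed.

Lemma linkUV4 u r L : u \in [:: u1; u2] -> r \in [:: v1; v2; v3; v4] -> hlink u L r ->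
  L = [::] /\ (u = u1 /\ r = v3 \/ u = u2 /\ r = v2).
Proof.
move=> uU rV h; have [I1 [I2 E]] := split_at uU; have [J1 [J2 E']] := split_at rV.
have [h1 h2] := ruleUV G pH ES B E E' h; exact: (at_mid E E' h1 h2).
Qed.

Lemma linkWV4 u r L : u \in [:: w1; w2] -> r \in [:: v1; v2; v3; v4] -> hlink u L r ->
  L = [::] /\ (u = w1 /\ r = v3 \/ u = w2 /\ r = v2).
Proof.
move=> uU rV h; have [I1 [I2 E]] := split_at uU; have [J1 [J2 E']] := split_at rV.
have [h1 h2] := ruleWV G pH ES B E E' h; exact: (at_mid E E' h1 h2).
Qed.

Let cs := let: And4 cs _ _ _ := lc in cs.

Lemma cycle224 : [/\ e a1 w1, e w1 w2, e w2 a2, e a2 u1 & e u1 u2] /\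
  [/\ e u2 a3, e a3 v1, e v1 v2, e v2 v3 & e v3 v4 /\ e v4 a1].
Proof.
by move: cs; rewrite /=; do 10 (case/andP=> ? ); case/andP=> ? _.
Qed.

Lemma no_v4 L : e u1 v3 \/ e w1 v3 -> hlink v4 L v1 \/ hlink v4 L v2 -> False.
Proof.
have [[e1 e2 e3 e4 e5] [e6 e7 e8 e9 [e10 e11]]] := cycle224.
have [a1S a2S a3S] := aS; have [a12 a13 a23] := an.
have a31 : a3 != a1 by rewrite eq_sym.
have a32 : a3 != a2 by rewrite eq_sym.
move=> [ev|ev] [h|h]; have [l _ _ _] := h.
- apply: (clh (t := [:: a3; u2; u1; v3; v2] ++ (v1 :: rev L) ++ [:: v4; a1; w1; w2; a2]) h
    (y := a3) (z := a2)) => //; [rewrite !(cat_cons, cat0s); wk | cnt | szs].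
- apply: (clh (t := [:: a1; w1; w2; a2; u1; v3] ++ (v4 :: L) ++ [:: v2; v1; a3]) h
    (y := a1) (z := a3)) => //; [rewrite !(cat_cons, cat0s); wk | cnt | szs].
- apply: (clh (t := [:: a3; u2; u1; a2; w2; w1; v3; v2] ++ (v1 :: rev L) ++ [:: v4; a1]) h
    (y := a3) (z := a1)) => //; [rewrite !(cat_cons, cat0s); wk | cnt | szs].
- apply: (clh (t := [:: a1; w1; v3] ++ (v4 :: L) ++ [:: v2; v1; a3; u2; u1; a2]) h
    (y := a1) (z := a2)) => //; [rewrite !(cat_cons, cat0s); wk | cnt | szs].
Qed.

(** Toughness for [S] with [v3], where the classes are the two short intervals, [v1] with [v2], and
    [v4]. As [no_v4] separates the last two classes, some link leaves a short interval, and it must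
    be an edge to [v2]. *)
Lemma v3_v2 : e u1 v3 \/ e w1 v3 -> e u2 v2 \/ e w2 v2.
Proof.
move=> ev; have no := no_v4 ev.
have out := arcs_out B; have [_ us _ _] := lc.
have ur : uniq [:: w2; u2; v2; v3; w1; u1; v1; v4] by apply: (uniq_count us); cnt.
have v3X : v3 \in X :\: S by apply: out; rewrite !inE eqxx ?orbT.
have S3 : #|S| = 3 by have [dE _ _] := es_bounds G lc pH ES; move: dE; arith.
pose f z := if z == w2 then w1 else if z == u2 then u1 else if z == v2 then v1 else z.
have fR z : z \in [:: w1; u1; v1; v4] -> [/\ f z = z, z \in X :\: S & z != v3].
  move=> zR; have u5 : uniq [:: w2; u2; v2; v3; z].
    move: zR; rewrite !inE => /or4P[]/eqP->; apply: (uniq_count us); cnt.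
  move: u5; rewrite /= !inE !negb_or !andbT => /and4P[/and4P[_ _ _ zw] /and3P[_ _ zu] /andP[_ zv] zv3].
  have zX : z \in X :\: S by apply: out; move: zR; rewrite !inE => /or4P[]->; rewrite ?orbT.
  rewrite inE in zX; by rewrite /f !(eq_sym z) (negPf zw) (negPf zu) (negPf zv) zv3 zX.
have [||||||u [v [L [[uX vX fuv l uL] LX]]]] := @es_tough _ _ _ _ G _ _ pH _ _ ES _
  f (v3 |: S) [:: w1; u1; v1; v4].
- exact: subsetUr.
- apply/subsetP => z; rewrite !inE => /orP[/eqP->|]; last exact: (subsetP (es_sub ES)).
  by move: v3X; rewrite inE => /andP[].
- by apply: (uniq_count us); cnt.
- by rewrite cardsU1 S3; case: (_ \notin _).
- move=> z /fR[_ + zv]; rewrite !inE (negPf zv) => /andP[zS zX].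
  by rewrite zS zX.
- by move=> z z' /fR[-> _ _] /fR[-> _ _].
have mem z : z \in X :\: (v3 |: S) -> z \in X :\: S /\
    [\/ z \in [:: w1; w2], z \in [:: u1; u2] | z \in [:: v1; v2; v4]].
  rewrite !in_setD !in_setU1 !negb_or => /andP[/andP[zv zS] zX]; rewrite zS zX; split=> //.
  case: (mem224 zX) => h; [ | by constructor 1 | by constructor 2 | constructor 3].
  - have [a1S a2S a3S] := aS; move: h zS; rewrite !inE.
    by case/or3P=> /eqP->; rewrite ?a1S ?a2S ?a3S.
  - by move: h; rewrite !inE (negPf zv).
have [uXS um] := mem _ uX; have [vXS vm] := mem _ vX.
have h : hlink u L v by split=> //; apply: (es_link_avoid G pH ES uXS l LX).
have hs := hlink_sym G h.
have sub z : z \in [:: v1; v2; v4] -> z \in [:: v1; v2; v3; v4].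
  by rewrite !inE => /or3P[]->; rewrite ?orbT.
have v3n z : z \in [:: v1; v2; v4] -> z <> v3.
  move=> zV zE; have : uniq [:: v3; v1; v2; v4] by apply: (uniq_count us); cnt.
  by rewrite cons_uniq -zE zV.
have u2w2 : (u2 == w2) = false.
  by apply/eqP => E; have := ur; rewrite -E /= !inE eqxx.
have fW z : z \in [:: w1; w2] -> f z = w1.
  rewrite !inE => /orP[]/eqP->; last by rewrite /f eqxx.
  by have [] := fR w1; rewrite ?inE ?eqxx.
have fU z : z \in [:: u1; u2] -> f z = u1.
  rewrite !inE => /orP[]/eqP->; last by rewrite /f u2w2 eqxx.
  by have [] := fR u1; rewrite ?inE ?eqxx ?orbT.
have uV y r M : y \in [:: u1; u2] -> r \in [:: v1; v2; v4] -> hlink y M r -> e u2 v2 \/ e w2 v2.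
  move=> yU rV hy; have [M0 p] := linkUV4 yU (sub _ rV) hy; rewrite M0 in hy.
  by case: p => -[E E']; [case: (v3n _ rV) | left; rewrite -E -E'; exact: hlink0 hy].
have wV y r M : y \in [:: w1; w2] -> r \in [:: v1; v2; v4] -> hlink y M r -> e u2 v2 \/ e w2 v2.
  move=> yU rV hy; have [M0 p] := linkWV4 yU (sub _ rV) hy; rewrite M0 in hy.
  by case: p => -[E E']; [case: (v3n _ rV) | right; rewrite -E -E'; exact: hlink0 hy].
case: um => um; case: vm => vm.
- by rewrite (fW _ um) (fW _ vm) eqxx in fuv.
- by case: (linkWU um vm h).
- exact: wV um vm h.
- by case: (linkWU vm um hs).
- by rewrite (fU _ um) (fU _ vm) eqxx in fuv.
- exact: uV um vm h.
- exact: wV vm um hs.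
- exact: uV vm um hs.
exfalso; have f12 : f v2 = v1.
  move: ur; rewrite /= !inE !negb_or => /and3P[/and3P[_ wv _] /andP[uv2 _] _].
  by rewrite /f !(eq_sym v2) (negPf wv) (negPf uv2) eqxx.
have f1 : f v1 = v1 by have [] := fR v1; rewrite ?inE ?eqxx ?orbT.
move: um vm fuv h hs; rewrite !inE => /or3P[]/eqP-> /or3P[]/eqP->; rewrite ?eqxx ?f12 ?f1 ?eqxx // => _ h hs.
- by apply: (no (rev L)); left.
- by apply: (no (rev L)); right.
- by apply: (no L); left.
- by apply: (no L); right.
Qed.

Lemma some_edge224 : (e u1 v3 \/ e w1 v3) \/ (e u2 v2 \/ e w2 v2).
Proof.
have [b1 [b2 [I1 [u [I2 [J1 [v [J2 [L [[b1B b2B b12 E E'] [l uL LX]]]]]]]]]]] :=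
  es_tough_blocks G pH ES B.
have ub : u \in b1.2 by rewrite E mem_cat mem_head orbT.
have vb : v \in b2.2 by rewrite E' mem_cat mem_head orbT.
have h : hlink u L v.
  by split=> //; apply: (es_link_avoid G pH ES _ l LX); apply: (bk_sub B b1B).
have hs := hlink_sym G h.
have finU y r M : y \in [:: u1; u2] -> r \in [:: v1; v2; v3; v4] -> hlink y M r ->
    (e u1 v3 \/ e w1 v3) \/ (e u2 v2 \/ e w2 v2).
  move=> yU rV hy; have [M0 p] := linkUV4 yU rV hy; rewrite M0 in hy; have yr := hlink0 hy.
  by case: p => -[E1 E2]; rewrite E1 E2 in yr; tauto.
have finW y r M : y \in [:: w1; w2] -> r \in [:: v1; v2; v3; v4] -> hlink y M r ->
    (e u1 v3 \/ e w1 v3) \/ (e u2 v2 \/ e w2 v2).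
  move=> yU rV hy; have [M0 p] := linkWV4 yU rV hy; rewrite M0 in hy; have yr := hlink0 hy.
  by case: p => -[E1 E2]; rewrite E1 E2 in yr; tauto.
move: b1B b2B b12 ub vb {E E'}; rewrite !inE => /or3P[]/eqP-> /or3P[]/eqP->; rewrite ?eqxx //= => _ ub vb.
- by case: (linkWU ub vb h).
- exact: finW ub vb h.
- by case: (linkWU vb ub hs).
- exact: finU ub vb h.
- exact: finW vb ub hs.
- exact: finU vb ub hs.
Qed.

End Sizes224.

(** By [v3_v2] and its mirror image both [v2] and [v3] receive an edge from a short interval. Three
    of the four combinations give a longer cycle directly; the edges from [u1] to [v3] and from [w2]
    to [v2] need a further link of [v1]. *)
Lemma no_intervals224 a1 w1 w2 a2 u1 u2 a3 v1 v2 v3 v4 :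
  blocks e c X S (b224 a1 w1 w2 a2 u1 u2 a3 v1 v2 v3 v4) -> False.
Proof.
move=> B; have B' := b224_rev B.
have [h3 h2] : (e u1 v3 \/ e w1 v3) /\ (e u2 v2 \/ e w2 v2).
  have up := v3_v2 B; have down := v3_v2 B'; case: (some_edge224 B) => h; first by split; [|exact: up].
  have : e w1 v3 \/ e u1 v3 by apply: down; tauto.
  by tauto.
have [[e1 e2 e3 e4 e5] [e6 e7 e8 e9 [e10 e11]]] := cycle224 B.
have [a1S a2S a3S] := arcs_S B; have [a12 a13 a23] := arcs_neq B.
have a31 : a3 != a1 by rewrite eq_sym.
have a32 : a3 != a2 by rewrite eq_sym.
have a21 : a2 != a1 by rewrite eq_sym.
case: h3 => h3; case: h2 => h2.
- by apply: (arcs_close0 G pH ES B (t := [:: a3; v1; v2; u2; u1; v3; v4; a1; w1; w2; a2])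
    (y := a3) (z := a2)) => //; [wk | cnt].
- have lc := arcs_lc B.
  have [|||r [L [rX rD ru h L01]]] := long_link_exists G pH ES lc (u := v1) (D := [:: a3; v2; v3]) _ big.
  + by apply: (arcs_out B); rewrite !inE eqxx ?orbT.
  + move=> v L; rewrite !inE => /or3P[]/eqP-> h.
    * by apply: leq_trans (gap_at' G (s1 := [:: a1; w1; w2; a2; u1; u2]) (a := a3) (I := [::]) (b := v1) lc h) _.
    * by apply: leq_trans (gap_at G (s1 := [:: a1; w1; w2; a2; u1; u2; a3]) (a := v1) (I := [::]) (b := v2) lc h) _.
    * by apply: (gap_at G (s1 := [:: a1; w1; w2; a2; u1; u2; a3]) (a := v1) (I := [:: v2]) (b := v3)) h; exact: lc.
  + by apply: leq_ltn_trans (count_size _ _) _.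
  have [l _ _ _] := h; have [_ us _ _] := lc.
  have : uniq [:: v1; v2; v3] by apply: (uniq_count us); cnt.
  rewrite /= !inE negb_or andbT => /andP[/andP[v12 v13] _].
  case: (mem224 B rX) => rin.
  + move: rD rin; rewrite !inE !negb_or => /and3P[ra3 _ _] /or3P[]/eqP E; subst r.
    * apply: (arcs_close G pH ES B (L := L) (t := [:: a3; u2; u1; v3; v2; v1] ++ L ++ [:: a1; w1; w2; a2])
        (y := a3) (z := a2)) => //; [by exists v1, a1 | wk | cnt | szs].
    * apply: (arcs_close G pH ES B (L := L) (t := [:: a3; u2; u1; v3; v4; a1; w1; w2; v2; v1] ++ L ++ [:: a2])
        (y := a3) (z := a2)) => //; [by exists v1, a2 | wk | cnt | szs].
    * by rewrite eqxx in ra3.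
  + have [_ [[_ E]|[_ E]]] := linkWV4 B rin (r := v1) (mem_head _ _) (hlink_sym G h).
      by rewrite E eqxx in v13.
    by rewrite E eqxx in v12.
  + have [_ [[_ E]|[_ E]]] := linkUV4 B rin (r := v1) (mem_head _ _) (hlink_sym G h).
      by rewrite E eqxx in v13.
    by rewrite E eqxx in v12.
  have r4 : r = v4.
    by move: rD rin; rewrite !inE !negb_or (negPf ru) => /and3P[_ /negPf-> /negPf->] /eqP.
  apply: (no_v4 B (L := rev L)); first by left.
  by left; rewrite -r4; exact: (hlink_sym G h).
- by apply: (arcs_close0 G pH ES B (t := [:: a1; v4; v3; w1; w2; a2; u1; u2; v2; v1; a3])
    (y := a1) (z := a3)) => //; [wk | cnt].
by apply: (arcs_close0 G pH ES B (t := [:: a2; u1; u2; a3; v1; v2; w2; w1; v3; v4; a1])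
    (y := a2) (z := a1)) => //; [wk | cnt].
Qed.

Lemma no_pair_component s : lcycle X s -> #|S| = 3 -> False.
Proof.
move=> lc S3; have [bl [_ [B _ _]]] := es_blocks ES lc.
have [cE _] := es_excess G pH ES B; have sb := bk_size B (es_sub ES).
have sz := es_size G pH ES B; have cs := ctx_small G.
rewrite S3 in cE sb; have [_ ex] := es_excess G pH ES B.
have key W U V a1 a2 a3 : blocks e c X S [:: (a1, W); (a2, U); (a3, V)] ->
    size W = 2 -> (size U = 2 /\ size V = 4) \/ (size U = 3 /\ size V = 3) -> False.
  move=> B0; case: W B0 => [|w1 [|w2 [|]]] // B0 _ [[]|[]].
    case: U B0 => [|u1 [|u2 [|]]] // B0 _; case: V B0 => [|v1 [|v2 [|v3 [|v4 [|]]]]] // B0 _.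
    exact: no_intervals224 B0.
  case: U B0 => [|u1 [|u2 [|u3 [|]]]] // B0 _; case: V B0 => [|v1 [|v2 [|v3 [|]]]] // B0 _.
  exact: (no_intervals233 G pH ES big B0).
case: bl B sb sz cE ex => [|[a1 W] [|[a2 U] [|[a3 V] []]]] // B _ sz cE ex.
have [sW sU sV] : [/\ 2 <= size W, 2 <= size U & 2 <= size V].
  by split; [apply: (sz (a1, W)) | apply: (sz (a2, U)) | apply: (sz (a3, V))]; rewrite !inE eqxx ?orbT.
(* [c <= 11] and an excess of at least two over [3 (q + 1) = 9] leave [c = 11], of which three
   vertices are in [S]. *)
have sum : size W + size U + size V = 8.
  by move: cE ex; rewrite /excess /=; move: sW sU sV cs; arith.
have B1 := arcs_rot B; have B2 := arcs_rot B1.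
have [sW2|sW2] := eqVneq (size W) 2.
  have [sU2|sU2] := eqVneq (size U) 2; first by apply: (key _ _ _ _ _ _ B sW2); left; move: sum sW2 sU2; rewrite /=; arith.
  have [sV2|sV2] := eqVneq (size V) 2; first by apply: (key _ _ _ _ _ _ B2 sV2); left; move: sum sW2 sV2; rewrite /=; arith.
  by apply: (key _ _ _ _ _ _ B sW2); right; move: sum sU2 sV2 sW2 sW sU sV; arith.
have [sU2|sU2] := eqVneq (size U) 2.
  have [sV2|sV2] := eqVneq (size V) 2; first by apply: (key _ _ _ _ _ _ B1 sU2); left; move: sum sU2 sV2; rewrite /=; arith.
  by apply: (key _ _ _ _ _ _ B1 sU2); right; move: sum sU2 sW2 sV2 sW sU sV; arith.
have sV2 : size V = 2 by move: sum sW2 sU2 sW sU sV; arith.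
by apply: (key _ _ _ _ _ _ B2 sV2); right; move: sum sW2 sU2 sV2 sW sU sV; arith.
Qed.

End PairComponents.

(** * Degree three with three intervals of two vertices *)

Section SingleComponentDegree3.

Variables (T : finType) (e : rel T) (c : nat).
Implicit Types (s t D L P Q R I J M N : seq T) (A B : {set T}) (a b : T).
Hypothesis G : tough_ctx e c 3.
Let esym := ctx_sym G.
Local Notation lcycle := (lcycle e c).
Variables (X S : {set T}) (x : T).
Hypotheses (pH : piece e (~: X) [set x]) (ES : ear_set e 3 X [set x] S 1).
Local Notation hlink := (hlink e X [set x]).

Definition b222 (a1 w1 w2 a2 u1 u2 a3 v1 v2 : T) :=
  [:: (a1, [:: w1; w2]); (a2, [:: u1; u2]); (a3, [:: v1; v2])].

Lemma b222_rev a1 w1 w2 a2 u1 u2 a3 v1 v2 : blocks e c X S (b222 a1 w1 w2 a2 u1 u2 a3 v1 v2) ->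
  blocks e c X S (b222 a1 v2 v1 a3 u2 u1 a2 w2 w1).
Proof. by move=> B; exact: (arcs_rot (arcs_rev G B)). Qed.

Section Other.

Variables (K SK : {set T}) (q : nat).
Hypotheses (pK : piece e (~: X) K) (EK : ear_set e 3 X K SK q) (HK : [set x] != K).

Lemma K_ear a b : a \in SK -> b \in SK -> a != b -> exists2 L, hlink a L b & size L = q.
Proof.
move=> aS bS ab; have [P [[_ _ _ l [uP PK _]] sP]] := es_ear EK aS bS ab.
exists P => //; split=> // z /PK zK; first exact: (comp_out pK zK).
exact: (other_out pH pK HK zK).
Qed.

Section Arcs.

Variables (a1 w1 w2 a2 u1 u2 a3 v1 v2 : T).
Hypothesis B : blocks e c X S (b222 a1 w1 w2 a2 u1 u2 a3 v1 v2).
Let lc := arcs_lc B.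

Lemma cycle222 : [/\ e a1 w1, e w1 w2, e w2 a2, e a2 u1 & e u1 u2] /\
  [/\ e u2 a3, e a3 v1, e v1 v2 & e v2 a1].
Proof.
have [cs _ _ _] := lc; move: cs; rewrite /=; do 8 (case/andP=> ? ); case/andP=> ? _.
by [].
Qed.

(** The length rules allow [K] no other attachments than [a1] and, if [q = 1], [a3]. For [q = 1]
    both occur and the intervals between the attachments have sizes 1, 2 and 3, against
    [single_component_intervals]; for [q > 1] an ear from [u1] to [a1] gives a longer cycle. *)
Lemma not_u1 : u1 \in SK -> False.
Proof.
move=> uS; have [[e1 e2 e3 e4 e5] [e6 e7 e8 e9]] := cycle222.
have [a1S a2S a3S] := arcs_S B; have [a12 a13 a23] := arcs_neq B.
have [dE _ _] := es_bounds G lc pK EK; have q0 := es_pos EK.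
have [_ us _ sX] := lc; have S2 := es_two EK.
have sums I1 (y : T) I2 J1 (r : T) J2 M : size M = q ->
    size M + 1 <= size I1 + size J1 /\ size M + 1 <= size I2 + size J2 ->
    size (I1 ++ y :: I2) = 2 -> size (J1 ++ r :: J2) = 2 -> False.
  by move=> sM []; rewrite !size_cat /=; move: q0 sM; arith.
have u1n z : z \in SK -> z != u1 -> z = a1 \/ (z = a3 /\ q = 1).
  move=> zS zu; have [|L h sL] := K_ear uS zS; first by rewrite eq_sym.
  have p : perm_eq (a1 :: [:: w1; w2] ++ a2 :: [:: u1; u2] ++ a3 :: [:: v1; v2])
      ([:: a1; a3] ++ [:: a2; u1; u2] ++ [:: w1; w2] ++ [:: v1; v2]).
    by apply/permP => f; rewrite /=; arith.
  have : z \in X by apply: (subsetP (es_sub EK)).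
  rewrite -sX (perm_mem p) 3!mem_cat => /or4P[].
  - rewrite !inE => /orP[]/eqP zE; [by left | right; split=> //; rewrite zE in h].
    have := gap_at G (s1 := [:: a1; w1; w2; a2]) (a := u1) (I := [:: u2]) (b := a3) lc h.
    by move: q0; rewrite -sL /=; arith.
  - rewrite !inE (negPf zu) => /orP[]/eqP zE; rewrite zE in h.
      have := gap_at' G (s1 := [:: a1; w1; w2]) (a := a2) (I := [::]) (b := u1) lc h.
      by move: q0; rewrite -sL /=; arith.
    have := gap_at G (s1 := [:: a1; w1; w2; a2]) (a := u1) (I := [::]) (b := u2) lc h.
    by move: q0; rewrite -sL /=; arith.
  - move=> /split_at[I1 [I2 E]]; exfalso.
    have := ruleWU G pH ES B E (erefl : [:: u1; u2] = [::] ++ u1 :: [:: u2]) (hlink_sym G h).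
    by move=> r; apply: (sums I1 z I2 [::] u1 [:: u2] (rev L)); rewrite ?size_rev -?E // in r *.
  - move=> /split_at[I1 [I2 E]]; exfalso.
    have := ruleUV G pH ES B (erefl : [:: u1; u2] = [::] ++ u1 :: [:: u2]) E h.
    by move=> r; apply: (sums [::] u1 [:: u2] I1 z I2 L); rewrite // -E.
have [qE|q2] : q = 1 \/ 1 < q by move: q0; arith.
  have sub z : z \in SK -> z \in [:: u1; a3; a1].
    move=> zS; rewrite !inE; have [//|zu] := eqVneq z u1.
    by case: (u1n z zS zu) => [->|[-> _]]; rewrite eqxx ?orbT.
  have S3 : #|SK| = 3 by move: dE; rewrite qE; arith.
  have u3 : uniq [:: u1; a3; a1] by apply: (uniq_count us); cnt.
  have mem z : z \in [:: u1; a3; a1] -> z \in SK.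
    have E : SK = [set z in [:: u1; a3; a1]].
      apply/eqP; rewrite eqEcard; apply/andP; split; last by rewrite card_undup_set // S3.
      by apply/subsetP => w /sub; rewrite inE.
    by move=> zR; rewrite E in_set.
  have BK : blocks e c X SK [:: (u1, [:: u2]); (a3, [:: v1; v2]); (a1, [:: w1; w2; a2])].
    split.
    - exact: (lcycle_rot (s := [:: a1; w1; w2; a2]) (t := [:: u1; u2; a3; v1; v2]) lc).
    - by move=> b; rewrite !inE => /or3P[]/eqP->; apply: mem; rewrite !inE eqxx ?orbT.
    - have out z : z \in [:: u2; v1; v2; w1; w2; a2] -> z \notin SK.
        move=> zR; apply/negP => /sub; apply/negP; have : uniq (z :: [:: u1; a3; a1]).
          by move: zR; rewrite !inE => /orP[/eqP->|/or4P[/eqP->|/eqP->|/eqP->|/orP[]/eqP->]];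
            apply: (uniq_count us); cnt.
        by rewrite cons_uniq => /andP[].
      move=> b z; rewrite inE => /orP[/eqP->|]; last rewrite inE => /orP[/eqP->|].
      + by move=> /= zR; apply: out; move: zR; rewrite !inE => ->.
      + by move=> /= zR; apply: out; move: zR; rewrite !inE => /orP[]->; rewrite ?orbT.
      + rewrite inE => /eqP-> /= zR; apply: out; move: zR; rewrite !inE.
        by case/or3P=> ->; rewrite ?orbT.
  have [k KE] : exists k, K = [set k].
    by apply/cards1P; rewrite (es_card EK) qE.
  have pK1 : piece e (~: X) [set k] by rewrite -KE.
  have EK1 : ear_set e 3 X [set k] SK 1 by move: EK; rewrite qE KE.
  have [//|[_ h]] := single_component_intervals G pK1 EK1 BK.
  by have := h (u1, [:: u2]) (mem_head _ _).
have [z [zS zu]] : exists z, z \in SK /\ z != u1.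
  have /card_gt1P [a [b [aS bS ab]]] := S2.
  have [au|au] := eqVneq a u1; last by exists a.
  by exists b; rewrite -au eq_sym.
case: (u1n z zS zu) => [zE|[_ qE]]; last by rewrite qE in q2.
rewrite zE in zS zu; rewrite eq_sym in zu; have [L h sL] := K_ear uS zS zu.
have [l _ _ _] := h.
apply: (arcs_close G pH ES B (L := L) (t := [:: a3; u2; u1] ++ L ++ [:: a1; w1; w2; a2])
  (y := a3) (z := a2)) => //; [by exists u1, a1 | wk | by rewrite eq_sym | cnt | move: q2 sL; szs].
Qed.

End Arcs.

(** Rotations and the reversal bring each of the six interval vertices into the place of [u1]. *)
Lemma SK_sub a1 w1 w2 a2 u1 u2 a3 v1 v2 : blocks e c X S (b222 a1 w1 w2 a2 u1 u2 a3 v1 v2) ->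
  SK \subset S.
Proof.
move=> B; apply/subsetP => z zS; apply: contraT => zn.
have zX : z \in X :\: S by rewrite inE zn (subsetP (es_sub EK)).
have B1 := arcs_rot B; have B2 := arcs_rot B1; have B' := b222_rev B.
have B1' := arcs_rot B'; have B2' := arcs_rot B1'.
have [b0 b0B zb] := bk_find B zX; move: b0B zb; rewrite !inE => /or3P[]/eqP-> /=;
  rewrite !inE => /orP[]/eqP zE; rewrite zE in zS; exfalso.
- exact: (not_u1 B2 zS).
- exact: (not_u1 B1' zS).
- exact: (not_u1 B zS).
- exact: (not_u1 B' zS).
- exact: (not_u1 B1 zS).
- exact: (not_u1 B2' zS).
Qed.

(** Counting both components, toughness for [S] links the interval between [a1] and [a2] to another
    one. The length rules of [H] and of [K] both apply to this link and contradict each other. *)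
Lemma not_two a1 w1 w2 a2 u1 u2 a3 v1 v2 : blocks e c X S (b222 a1 w1 w2 a2 u1 u2 a3 v1 v2) ->
  SK \subset S -> SK = [set a1; a2] -> q = 2 -> False.
Proof.
move=> B SKS SE q2; have lc := arcs_lc B.
have EK2 : ear_set e 3 X K [set a1; a2] 2 by move: EK; rewrite q2 SE.
have [dE _ _] := es_bounds G lc pH ES.
have [_ us _ _] := lc; have out := arcs_out B.
have uwu : uniq [:: u1; w1; w2] by apply: (uniq_count us); cnt.
have u1W : u1 \notin [:: w1; w2] by move: uwu; rewrite cons_uniq => /andP[].
have [||||||||u [v [L [[uX vX fuv l uL] LX]]]] :=
  es_tough2 G pH ES pK EK HK (f := mem [:: w1; w2]) (S' := S) (R := [:: w1; u1]).
- exact: subxx.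
- exact: SKS.
- exact: es_sub ES.
- by rewrite /= inE andbT; apply: contraNneq u1W => <-; rewrite inE eqxx.
- by [].
- by move: dE => /=; arith.
- move=> z zR; apply: out; move: zR; rewrite !inE => /orP[]->; rewrite ?orbT //.
- have R2 z : z \in [:: w1; u1] -> z = w1 \/ z = u1.
    by rewrite !inE => /orP[]/eqP; [left | right].
  move=> z z' zR z'R Ez; have {Ez} : (z \in [:: w1; w2]) = (z' \in [:: w1; w2]) by exact: Ez.
  by case: (R2 z zR) => ->; case: (R2 z' z'R) => -> //; rewrite mem_head (negPf u1W).
have mem z : z \in X :\: S -> z \in [:: w1; w2] \/ z \in [:: u1; u2] ++ [:: v1; v2].
  move=> zX; have [b0 b0B zb] := bk_find B zX.
  have : [\/ b0 = (a1, [:: w1; w2]), b0 = (a2, [:: u1; u2]) | b0 = (a3, [:: v1; v2])].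
    by move: b0B; rewrite !inE => /or3P[]/eqP; [constructor 1 | constructor 2 | constructor 3].
  case=> E; rewrite E /= in zb.
  - by left.
  - by right; rewrite mem_cat zb.
  - by right; rewrite mem_cat zb orbT.
have fin y r M : y \in X :\: S -> y \in [:: w1; w2] -> r \in [:: u1; u2] ++ [:: v1; v2] ->
    link e y M r -> uniq M -> (forall z, z \in M -> z \notin X) -> False.
  move=> yX yW rUV lM uM MX.
  have h : hlink y M r by split=> //; apply: (es_link_avoid G pH ES yX lM MX).
  have [I1 [I2 WE]] := split_at yW; have := congr1 size WE; rewrite size_cat /= => sW.
  move: rUV; rewrite mem_cat => /orP[]/split_at[J1 [J2 E]]; have := congr1 size E; rewrite size_cat /= => sE.
    have [h1 h2] := ruleWU G pH ES B WE E h.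
    have lc1 : lcycle X (a1 :: (I1 ++ y :: I2) ++ a2 :: (J1 ++ r :: (J2 ++ [:: a3; v1; v2]))).
      by have := lc; rewrite WE E -!catA.
    have [h3 _] := pair_link G pK EK2 lc1 lM uM MX.
    by move: sW sE h1 h2 h3; arith.
  have [h1 h2] := ruleWV G pH ES B WE E h.
  have lc1 : lcycle X (a1 :: (I1 ++ y :: I2) ++ a2 :: (([:: u1; u2; a3] ++ J1) ++ r :: J2)).
    by have := lc; rewrite WE E -!catA.
  have [_ h3] := pair_link G pK EK2 lc1 lM uM MX.
  by move: sW sE h1 h2 h3; arith.
have lr := link_rev esym l.
have {}fuv : (u \in [:: w1; w2]) != (v \in [:: w1; w2]) by exact: fuv.
case: (mem u uX) => um; case: (mem v vX) => vm.
- by rewrite um vm in fuv.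
- exact: fin uX um vm l uL LX.
- apply: (fin v u (rev L) vX vm um lr); rewrite ?rev_uniq // => z; rewrite mem_rev; exact: LX.
have nW z : z \in X :\: S -> z \in [:: u1; u2] ++ [:: v1; v2] -> z \notin [:: w1; w2].
  move=> zX zUV; have : uniq ([:: w1; w2] ++ [:: u1; u2] ++ [:: v1; v2]) by apply: (uniq_count us); cnt.
  by rewrite cat_uniq => /and3P[_ /hasPn h _]; exact: h.
by rewrite (negPf (nW _ uX um)) (negPf (nW _ vX vm)) in fuv.
Qed.

Lemma K_single a1 w1 w2 a2 u1 u2 a3 v1 v2 : blocks e c X S (b222 a1 w1 w2 a2 u1 u2 a3 v1 v2) ->
  SK \subset S /\ q = 1.
Proof.
move=> B; have sub := SK_sub B; split=> //.
have [dE _ _] := es_bounds G (arcs_lc B) pK EK.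
have [//|q2] : q = 1 \/ q = 2 by move: dE (es_two EK) (es_pos EK); arith.
exfalso; have : #|SK| = 2 by move: dE q2; arith.
move=> SK2; have /eqP/cards2P [p [r [pr SE]]] := SK2.
have inS z : z \in SK -> [\/ z = a1, z = a2 | z = a3].
  move=> /(subsetP sub) zS; have zX := subsetP (es_sub ES) _ zS.
  have out := arcs_out B; have [_ _ _ sX] := arcs_lc B; move: zX; rewrite -sX.
  have p0 : perm_eq (a1 :: [:: w1; w2] ++ a2 :: [:: u1; u2] ++ a3 :: [:: v1; v2])
      ([:: a1; a2; a3] ++ ([:: w1; w2] ++ [:: u1; u2] ++ [:: v1; v2])).
    by apply/permP => f; rewrite /=; arith.
  rewrite (perm_mem p0) mem_cat => /orP[|/out]; last by rewrite inE zS.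
  by rewrite !inE => /or3P[]/eqP; [constructor 1 | constructor 2 | constructor 3].
have B1 := arcs_rot B; have B2 := arcs_rot B1.
have SE' : SK = [set r; p] by rewrite SE setUC.
have [pS rS] : p \in SK /\ r \in SK by rewrite SE !inE !eqxx orbT.
case: (inS p pS) => pE; case: (inS r rS) => rE; subst p r; rewrite ?eqxx // in pr.
- exact: (not_two B sub SE q2).
- exact: (not_two B2 sub SE' q2).
- exact: (not_two B sub SE' q2).
- exact: (not_two B1 sub SE q2).
- exact: (not_two B2 sub SE q2).
- exact: (not_two B1 sub SE' q2).
Qed.

End Other.

Theorem single_count s : lcycle X s -> c = 9 /\ (#|T| = 10 \/ #|T| = 11).
Proof.
move=> lc; have [bl [_ [B0 _ _]]] := es_blocks ES lc.
have [dE _ _] := es_bounds G lc pH ES; have sb := bk_size B0 (es_sub ES).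
have [//|[_ sz]] := single_component_intervals G pH ES B0.
have [a1 [w1 [w2 [a2 [u1 [u2 [a3 [v1 [v2 blE]]]]]]]]] : exists a1 w1 w2 a2 u1 u2 a3 v1 v2,
    bl = b222 a1 w1 w2 a2 u1 u2 a3 v1 v2.
  have : size bl = 3 by rewrite sb; move: dE; arith.
  case: bl sz {B0 sb} => [|[a1 W] [|[a2 U] [|[a3 V] []]]] // sz _.
  have := sz (a1, W); have := sz (a2, U); have := sz (a3, V); rewrite !inE !eqxx !orbT /=.
  case: W {sz} => [|w1 [|w2 [|? ?]]]; do ? (by move=> _ _ /(_ isT)).
  case: U => [|u1 [|u2 [|? ?]]]; do ? (by move=> _ /(_ isT)).
  case: V => [|v1 [|v2 [|? ?]]]; do ? (by move=> /(_ isT)).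
  by move=> _ _ _; exists a1, w1, w2, a2, u1, u2, a3, v1, v2.
rewrite blE in B0; have lc' := arcs_lc B0.
have c9 : c = 9 by have [_ _ <- _] := lc'.
split=> //.
have [[y [yX yx]]|one] := classic (exists y, y \notin X /\ y \notin [set x]); last first.
  left; rewrite (count_one lc pH) ?cards1 ?c9 // => v vX.
  by apply: contraT => vH; case: one; exists v.
have comp v : v \notin X -> v \notin [set x] -> exists K, [/\ piece e (~: X) K, [set x] != K & v \in K].
  move=> vX vx; have vX' : v \in ~: X by rewrite inE.
  have [K [pK vK]] := piece_exists esym vX'; exists K; split=> //.
  by apply: contraNneq vx => ->.
have [K [pK xK yK]] := comp _ yX yx; have [SK [q EK]] := ear_set_exists G lc pK.
have [SKS q1] := K_single pK EK xK B0.
right; rewrite (count_two lc pH pK xK) ?cards1 ?(es_card EK) ?c9 ?q1 // => v vX.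
apply: NNPP => no; have vx : v \notin [set x] by apply/negP => h; apply: no; left.
have vK : v \notin K by apply/negP => h; apply: no; right.
have [K' [pK' xK' vK']] := comp _ vX vx; have [SK' [q' EK']] := ear_set_exists G lc pK'.
have [SKS' q1'] := K_single pK' EK' xK' B0.
have KK' : K != K' by apply: contraNneq vK => ->.
have u1XS : u1 \in X :\: S by apply: (arcs_out B0); rewrite !inE eqxx ?orbT.
move: (u1XS); rewrite inE => /andP[u1S u1X].
have xin : x \in [set x] by rewrite inE.
have xX := comp_out pH xin.
have stuck Z SZ qZ h r : piece e (~: X) Z -> ear_set e 3 X Z SZ qZ -> SZ \subset S -> h \in Z ->
    r \notin Z -> joined e (~: S) h r -> False.
  by move=> pZ EZ ZS hZ rZ /(es_stuck pZ EZ ZS hZ); rewrite (negPf rZ).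
have nx z : z != x -> z \notin [set x] by rewrite inE.
have SX := subsetP (es_sub ES).
have yv : y != v by apply: contraNneq vK => <-.
have yx' : y != x by move: yx; rewrite inE.
have vx' : v != x by move: vx; rewrite inE.
have u1n z : z \notin X -> u1 != z by apply: contraNneq => <-.
(* Every component off the cycle is a single vertex attached within [S], so a third one would give
   four representatives, with [u1] for the cycle, against three vertices. *)
have [||||r [r' [rR r'R rr j]]] := ctx_tough G (S := S) (R := [:: x; y; v; u1]).
- rewrite /= !inE !negb_or !(eq_sym x) yx' vx' yv (u1n _ xX).
  by rewrite !(eq_sym _ u1) (u1n _ yX) (u1n _ vX).
- by move: dE => /=; arith.
- by [].
- have o z : z \notin X -> z \notin S by apply: contra => /SX.
  by move=> r; rewrite !inE => /or4P[]/eqP-> //; exact: o.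
have yK' : y \notin K' by apply/negP => h; have := other_out pK pK' KK' h; rewrite yK.
have u1K Z : piece e (~: X) Z -> u1 \notin Z by move=> pZ; apply/negP => /(comp_out pZ); rewrite u1X.
have sx r0 : r0 != x -> joined e (~: S) x r0 -> False.
  by move=> /nx h; exact: (stuck _ _ _ _ _ pH ES (subxx _) xin h).
have sy r0 : r0 \notin K -> joined e (~: S) y r0 -> False by exact: (stuck _ _ _ _ _ pK EK SKS yK).
have sv r0 : r0 \notin K' -> joined e (~: S) v r0 -> False by exact: (stuck _ _ _ _ _ pK' EK' SKS' vK').
have xKn : x \notin K by apply/negP => /(other_out pH pK xK); rewrite inE eqxx.
have xKn' : x \notin K' by apply/negP => /(other_out pH pK' xK'); rewrite inE eqxx.
have j' := joined_sym esym j.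
move: rR r'R rr j j'; rewrite !inE => /or4P[]/eqP-> /or4P[]/eqP->; rewrite ?eqxx // => rr j j';
  first [ exact: (sx _ _ j) | exact: (sx _ _ j') | exact: (sy _ _ j) | exact: (sy _ _ j')
        | exact: (sv _ _ j) | exact: (sv _ _ j')
        | by apply: (sx _ _ j); rewrite // eq_sym | by apply: (sx _ _ j'); rewrite // eq_sym
        | by apply: (sy _ _ j); rewrite ?u1K | by apply: (sy _ _ j'); rewrite ?u1K
        | by apply: (sv _ _ j); rewrite ?u1K | by apply: (sv _ _ j'); rewrite ?u1K ].
Qed.

End SingleComponentDegree3.

Definition cycle_bound n d :=
  if n %% 3 == 1 then 2 * d + 2
  else if (n %% 3 == 2) || (n %% 4 == 1) then 2 * d + 3
  else 2 * d + 4.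

(** * Conclusion *)

Section Conclusion.

Variables (T : finType) (e : rel T).

Lemma tough_ctx_bound c d (X : {set T}) s v0 : tough_ctx e c d -> lcycle e c X s -> v0 \notin X ->
  cycle_bound #|T| d <= c.
Proof.
move=> G lc v0X; have v0X' : v0 \in ~: X by rewrite inE.
have [H0 [pH0 _]] := piece_exists (ctx_sym G) v0X'.
have [S0 [q0 ES0]] := ear_set_exists G lc pH0.
have [dE0 _ clo] := es_bounds G lc pH0 ES0.
have d2 : 1 < d by move: dE0 (es_two ES0) (es_pos ES0); arith.
have cs := ctx_small G.
have single H (S : {set T}) q : piece e (~: X) H -> ear_set e d X H S q -> q = 1 -> 2 < #|S| ->
    cycle_bound #|T| d <= c /\ d = 3.
  move=> pH ES qE S3; have [dE _ _] := es_bounds G lc pH ES.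
  have [x HE] : exists x, H = [set x] by apply/cards1P; rewrite (es_card ES) qE.
  rewrite HE qE in pH ES dE; have [bl [_ [B _ _]]] := es_blocks ES lc.
  have [d_2|[d_3 _]] := single_component_intervals G pH ES B; first by move: dE S3; rewrite d_2; arith.
  rewrite d_3 in G ES *; have [-> h] := single_count G pH ES lc; split=> //.
  (* The bound is 8 for [n = 10] and 9 for [n = 11], while [c = 9]. *)
  by case: h => ->.
have [[H [S [q [pH ES S2]]]]|all2] := classic (exists H S q,
    [/\ piece e (~: X) H, ear_set e d X H S q & #|S| != 2]).
  have [dE prod _] := es_bounds G lc pH ES.
  have S3 : 2 < #|S| by move: S2 (es_two ES); arith.
  have [qE|q2] : q = 1 \/ 1 < q by move: (es_pos ES); arith.
    by have [] := single _ _ _ pH ES qE S3.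
  (* Both factors of [(|S| - 2)(q - 1) <= 1] are positive. *)
  have [qE SE] : q = 2 /\ #|S| = 3.
    move: prod S3 q2; case: #|S| => [|[|[|k]]] //; case: q {ES dE} => [|[|r]] //.
    by rewrite !subSS !subn0 => h _ _; have : k.+1 * r.+1 <= 1 by []; nia.
  have d4 : d = 4 by move: dE; arith.
  (* A one-vertex component would have [d = 4] attachments, and [single] would then force
     [d = 3]. *)
  exfalso; rewrite qE d4 in G ES single *; apply: (no_pair_component G pH ES _ lc SE) => K SK q' pK EK.
  have [dE' _ _] := es_bounds G lc pK EK.
  have [q1|//] : q' = 1 \/ 1 < q' by move: (es_pos EK); arith.
  have S3' : 2 < #|SK| by move: dE'; arith.
  by have [_] := single _ _ _ pK EK q1 S3'.
have {}all2 H (S : {set T}) q : piece e (~: X) H -> ear_set e d X H S q -> #|S| = 2.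
  by move=> pH ES; apply/eqP; apply: contraT => S2; case: all2; exists H, S, q.
rewrite /cycle_bound; case: (two_attachments_count G all2 lc v0X) => [n1|[cE n1]]; last first.
  (* Residue one modulo four rules out the last case of the bound, whatever [n] is modulo three. *)
  have -> : #|T| %% 4 = 1.
    rewrite n1 cE (_ : 2 * d + 3 + 2 * (d - 1) = d * 4 + 1); last by move: d2; arith.
    by rewrite modnMDl.
  by rewrite eqxx orbT cE; case: ifP => _; arith.
have [cE|cE] : c = 2 * d + 2 \/ c = 2 * d + 3 by move: clo cs; arith.
  have -> : #|T| %% 3 = 1.
    rewrite n1 cE (_ : 2 * d + 2 + (d - 1) = d * 3 + 1); last by move: d2; arith.
    by rewrite modnMDl.
  by rewrite eqxx cE.
have -> : #|T| %% 3 = 2.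
  rewrite n1 cE (_ : 2 * d + 3 + (d - 1) = d * 3 + 2); last by move: d2; arith.
  by rewrite modnMDl.
by rewrite /= cE.
Qed.

Lemma min_degree_le v : min_degree e <= degree e v.
Proof.
rewrite /min_degree; have : v \in index_enum T by rewrite mem_index_enum.
elim: (index_enum T) => // w r IH; rewrite inE big_cons => /orP[/eqP->|/IH h].
  exact: geq_minl.
exact: leq_trans (geq_minr _ _) h.
Qed.

Lemma cycle_le_circumference s : cycle e s -> uniq s -> 2 < size s -> size s <= circumference e.
Proof.
move=> cs us s2; have sT : size s < #|T|.+1.
  by have /card_uniqP <- := us; rewrite ltnS max_card.
rewrite /circumference; apply: (leq_bigmax_cond (Ordinal sT)).
by apply/existsP; exists (in_tuple s); rewrite /graph_cycle /= s2 /ucycleb cs us.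
Qed.

Lemma circumference_attained : 0 < circumference e ->
  exists s, [/\ cycle e s, uniq s & size s = circumference e].
Proof.
rewrite /circumference => c0.
have [k0 kc] : exists k0 : 'I_#|T|.+1, has_cycle_of_length e k0.
  apply: NNPP => no; move: c0; rewrite big1 // => k hk; case: no; by exists k.
have : 0 < #|[pred k : 'I_#|T|.+1 | has_cycle_of_length e k]|.
  by apply/card_gt0P; exists k0.
case/(eq_bigmax_cond (fun k : 'I_#|T|.+1 => k : nat)) => k hk ->.
have /existsP[p] : has_cycle_of_length e k by [].
by rewrite /graph_cycle /ucycleb => /andP[_ /andP[cp up]]; exists p; rewrite size_tuple.
Qed.

Hypotheses (e_sym : symmetric e) (e_irr : irreflexive e).
Hypotheses (n_ge3 : 3 <= #|T|) (G_tough : one_tough e).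

(** Vertices that are pairwise not joined outside [S] have different roots, so each accounts for a
    component of its own. *)
Lemma one_tough_lists : tough_lists e.
Proof.
move=> S R uR SR R1 RS; apply: NNPP => no; pose f := induced e (~: S).
have fsym : connect_sym f.
  by apply: sym_connect_sym => y z; rewrite /f /induced /= e_sym andbCA.
have RnS r : r \in R -> r \in ~: S by move=> /RS; rewrite inE.
have inj : {in R &, injective (root f)}.
  move=> r r' rR r'R /eqP; rewrite (root_connect fsym) => rr'.
  apply/eqP; apply: contraT => ne; case: no; exists r, r'; split=> //.
  by apply/joinedP; split; [exact: RnS|].
suff le : size R <= ncomp_minus e S.
  have := G_tough (leq_trans R1 le); by move: SR le; arith.
have u : uniq (map (root f) R) by rewrite map_inj_in_uniq.
rewrite -(size_map (root f)) /ncomp_minus; have /card_uniqP <- := u.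
apply: subset_leq_card; apply/subsetP => z /mapP[r rR ->].
rewrite !inE roots_root //=.
have /joinedP[rS _] : joined e (~: S) r r by apply: joined_refl; exact: RnS.
have : joined e (~: S) r (root f r) by apply/joinedP; split; [exact: RnS | exact: connect_root].
by case/joined_in => _ ; rewrite inE.
Qed.

Lemma third (y z : T) : exists v, (v != y) && (v != z).
Proof.
apply: NNPP => no; have : #|T| <= 2; last by rewrite leqNgt n_ge3.
rewrite -cardsT; apply: leq_trans (_ : size [:: y; z] <= 2); last by [].
apply: card_le_size => v _; rewrite !inE; apply: contraT; rewrite negb_or => h; case: no; by exists v.
Qed.

(** A vertex with only one neighbour would make that neighbour a cut vertex. *)
Lemma other_neighbour v w : exists2 y, y != w & e v y.
Proof.
wlog vw : w / v != w.
  move=> h; have [E|] := eqVneq v w; last exact: h.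
  have [z /andP[zv _]] := third v v; have [|y _ vy] := h z; first by rewrite eq_sym.
  by exists y => //; apply: contraTneq vy => ->; rewrite E e_irr.
have [u /andP[uv uw]] := third v w.
have vin : v \in [set v] by rewrite inE.
have un : u \notin [set v] by rewrite inE.
have [v' [y [v'v + yv vy]]] := joined_exit (joined_minus e_sym one_tough_lists vw uw) vin un.
move: v'v vy; rewrite !inE => /eqP-> vy yw; by exists y.
Qed.

(** Two neighbours of [v] are joined by a path that avoids [v], and [v] closes it to a cycle. *)
Lemma circumference_gt2 : 2 < circumference e.
Proof.
have [v _] : exists v : T, v \in T by apply/card_gt0P; apply: leq_trans n_ge3.
have [y yv vy] := other_neighbour v v; have [z zy vz] := other_neighbour v y.
have zv : z != v by apply: contraTneq vz => ->; rewrite e_irr.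
have [s [w us sS]] := joined_minus e_sym one_tough_lists yv zv.
have [s' [sE p l]] := walkP w.
have c3 : 2 < size (v :: s).
  by rewrite sE; case: s' l {sE p} => //= yz; rewrite yz eqxx in zy.
apply: leq_trans c3 _; apply: cycle_le_circumference => //.
  by rewrite sE /= rcons_path vy p l e_sym.
by rewrite /= us andbT; apply/negP => /sS; rewrite !inE eqxx.
by rewrite sE; case: s' l {sE p} => //= yz; rewrite yz eqxx in zy.
Qed.

End Conclusion.

Theorem theorem1 (T : finType) (e : rel T)
    (e_sym : symmetric e) (e_irr : irreflexive e)
    (n_ge3 : 3 <= #|T|) (G_tough : one_tough e) :
  hamiltonian e \/
  (if #|T| %% 3 == 1 then 2 * min_degree e + 2
   else if (#|T| %% 3 == 2) || (#|T| %% 4 == 1) then 2 * min_degree e + 3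
   else 2 * min_degree e + 4) <= circumference e.
Proof.
(* The largest of the three bounds; its failure is exactly [ctx_small]. *)
have [big|small] := leqP (2 * min_degree e + 4) (circumference e).
  right; apply: leq_trans big; case: ifP => _; last case: ifP => _; arith.
have c2 := circumference_gt2 e_sym e_irr n_ge3 G_tough.
have G : tough_ctx e (circumference e) (min_degree e).
  split=> //.
  - exact: min_degree_le.
  - exact: one_tough_lists.
  - exact: cycle_le_circumference.
  - by move: small; arith.
have [|s [cs us sz]] := @circumference_attained _ e; first by move: c2; arith.
have lc : lcycle e (circumference e) [set v in s] s by split=> // v; rewrite inE.
have [all|[v vX]] : (forall v, v \in s) \/ exists v, v \notin s.
  by have [[v vs]|no] := classic (exists v, v \notin s); [right; exists v | left=> v; apply: contraT => vs; case: no; exists v].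
  left; have sT : size s = #|T| by have /card_uniqP <- := us; apply: eq_card => v; rewrite all.
  rewrite /hamiltonian -sT; apply/existsP; exists (in_tuple s).
  by rewrite /graph_cycle /= sz c2 /ucycleb cs us.
by right; apply: (tough_ctx_bound (v0 := v) G lc); rewrite inE.
Qed.
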